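(* Let $U=\{(x_1,x_2,x_3)\in\mathbb{R}^3:x_3>0\}$ and let $f\in C_0^{\infty}(B_{\epsilon_1,\epsilon_2}\cap U)$ for some $0<\epsilon_1<\epsilon_2<1$. Let $\delta_2=\frac{1-\epsilon_2^2}{2\epsilon_2}$ and $\delta_1=\frac{1-\epsilon_1^2}{2\epsilon_1}$. Let $\tilde f$ be defined by $$\frac{1}{\sqrt{\frac{(1-|x|^2)^2}{4|x|^4}+1}}\,\tilde f(x)=\left(\frac{1-|x|^2}{2|x|^2}-\frac{\frac{(1-|x|^2)^2}{4|x|^4}}{\sqrt{\frac{(1-|x|^2)^2}{4|x|^4}+1}}\right)f(x),$$ and let $\tilde F$ be its polar form. Define the weighted interior transform $$\mathcal{I}_wf(r',\alpha,\beta)=\int_0^{r'}\int_0^{2\pi}\int_0^{\pi}w(r',t,\varphi)\,\frac{\rho^2\sin\varphi}{t\sqrt{\frac{\sin^2\varphi}{t^2}+1}}\,(h\cdot\tilde F)(\rho,\theta,\varphi)\Big|_{\rho=\sqrt{\frac{\sin^2\varphi}{t^2}+1}-\frac{\sin\varphi}{t}}\mathrm{d}\varphi\,\mathrm{d}\theta\,\mathrm{d}t,$$ where $h=U(\alpha)V(\beta)$ and $r'=1/r$. Suppose that the weighting $w$ satisfies the following: 1. $w$ can be decomposed as $w(r',t,\varphi)=w_1(r',t)\,w_2(t,\varphi)$. 2. $W_2(t,\rho)=w_2\left(1/t,\sin^{-1}(\rho/t)\right)$ and its first order partial derivative with respect to $t$ are continuous on the triangle $T=\{(t,\rho)\in\mathbb{R}^2:\epsilon_1\le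 t\le\epsilon_2,\ \epsilon_1\le\rho\le t\}$, and $W_2(\rho,\rho)\ne0$ on $[\epsilon_1,\epsilon_2]$. 3. $w_1(r',t)$ and its first order partial derivatives are bounded on $0\le r'<\infty$, and $w_1(r',r')\neq0$ for $0\le r'<\infty$. Then $\mathcal{I}_wf$ known for all $r'\in[0,\infty)$ and for all $(\alpha,\beta)\in S^2$ determines $f$ uniquely for $0<|x|<1$.
   Context: Hollow balls: $B_{a,b}=\{x\in\mathbb{R}^3: a<|x|<b\}$. $C_0^\infty(\Omega)$ denotes smooth real-valued functions with compact support in $\Omega$, extended by zero to $\mathbb{R}^3$ (so $\tilde f$ is also zero outside the support of $f$). Polar form: for a function $f$ on $\mathbb{R}^3$, its polar form is $F(\rho,\theta,\varphi)=f(\rho\sin\varphi\cos\theta,\rho\sin\varphi\sin\theta,\rho\cos\varphi)$, with $\rho$ the radius, $\theta\in[0,2\pi]$ the azimuth and $\varphi\in[0,\pi]$ the colatitude. Rotations: $h=U(\alpha)V(\beta)\in \mathrm{SO}(3)$, where $U(\alpha)$ and $V(\beta)$ are the rotations about the $x_3$- and $x_2$-axis by the Euler angles $\alpha$ and $\beta$ respectively (the rotation $U(\alpha)$ is not to be confused with the half space $U$); the pair $(\alpha,\beta)$ is identified with the point of the unit sphere $S^2$ with azimuth $\alpha$ and colatitude $\beta$. The action on functions is $(h\cdot f)(x)=f(hx)$, and $h\cdot F$ is the polar form of $h\cdot f$. The weighting $w$ is a real-valued function of $(r',t,\varphi)$, with arguments as they occur in the integral ($0<t\le r'$, $0\le\varphi\le\pi$).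 The number $r\ge 0$ is the tube centre offset of the spindle torus, i.e. of the surface $\{(r-\sqrt{x_1^2+x_2^2})^2+x_3^2=1+r^2\}$; the transform is expressed in terms of its reciprocal $r'=1/r$.
   Formalization: In condition 2 the triangle and diagonal use [δ2,δ1] instead of [ε1,ε2] (as printed the claim is false: w_2 may vanish wherever f is seen), regularity of W_2 is required for both solutions of sin φ=ρ/t in [0,π], and the integrals I_w f are assumed to exist. *)

(* Defs.v *)
From HB Require Import structures.
From mathcomp Require Import all_boot all_order all_algebra.
From mathcomp Require Import all_classical all_reals all_analysis.

Set Implicit Arguments.
Unset Strict Implicit.
Unset Printing Implicit Defensive.

Import Order.TTheory GRing.Theory Num.Theory.
Import numFieldNormedType.Exports.

Local Open Scope classical_set_scope.
Local Open Scope ring_scope.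

(** MathComp-Analysis; points of R^3 are column vectors, with
    (x_1, x_2, x_3) = (x 0 0, x 1 0, x 2 0). *)

Section Space.
Context {R : realType}.

Definition vec3 (a b c : R) : 'cV[R]_3 := \col_i [:: a; b; c]`_i.

(* The library norm on ['cV[R]_3] is the sup norm, hence: *)
Definition enorm (x : 'cV[R]_3) : R := Num.sqrt (\sum_i (x i 0) ^+ 2).

Definition hollow_ball (a b : R) : set 'cV[R]_3 :=
  [set x | a < enorm x < b].

Definition upper_half_space : set 'cV[R]_3 := [set x | 0 < x 2 0].

Definition partial (i : 'I_3) (f : 'cV[R]_3 -> R) : 'cV[R]_3 -> R :=
  fun x => 'D_(delta_mx i 0) f x.

(* The words [s] enumerate all iterated partial derivatives of all orders. *)
Definition smooth (f : 'cV[R]_3 -> R) : Prop :=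
  forall s : seq 'I_3,
    let g := foldr partial f s in
    continuous g /\ forall i x, derivable g x (delta_mx i 0).

Definition C0_infty (Omega : set 'cV[R]_3) (f : 'cV[R]_3 -> R) : Prop :=
  let supp := closure [set x | f x != 0] in
  [/\ smooth f, compact supp & supp `<=` Omega].

Definition polar (f : 'cV[R]_3 -> R) (rho theta phi : R) : R :=
  f (vec3 (rho * sin phi * cos theta) (rho * sin phi * sin theta)
          (rho * cos phi)).

Definition rotU (alpha : R) : 'M[R]_3 :=
  \matrix_(i, j) (nth [::] [:: [:: cos alpha; - sin alpha; 0];
                               [:: sin alpha;   cos alpha; 0];
                               [:: 0; 0; 1]] i)`_j.

(* With this orientation [rotU alpha *m rotV beta] maps (0, 0, 1) to the point
   of the unit sphere with azimuth [alpha] and colatitude [beta]. *)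
Definition rotV (beta : R) : 'M[R]_3 :=
  \matrix_(i, j) (nth [::] [:: [:: cos beta; 0; sin beta];
                               [:: 0; 1; 0];
                               [:: - sin beta; 0; cos beta]] i)`_j.

Definition rot_act (h : 'M[R]_3) (f : 'cV[R]_3 -> R) : 'cV[R]_3 -> R :=
  fun x => f (h *m x).

End Space.

Section Transform.
Context {R : realType}.

Notation leb := (@lebesgue_measure R).

(* The defining relation of f~, solved for f~ x. *)
Definition ftilde (f : 'cV[R]_3 -> R) (x : 'cV[R]_3) : R :=
  let n := enorm x in
  let v := (1 - n ^+ 2) ^+ 2 / (4 * n ^+ 4) in
  ((1 - n ^+ 2) / (2 * n ^+ 2) - v / Num.sqrt (v + 1)) * f x
  / (1 / Num.sqrt (v + 1)).

Definition interior_integrand (w : R -> R -> R -> R) (f : 'cV[R]_3 -> R)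
    (r' alpha beta t theta phi : R) : R :=
  let q := Num.sqrt ((sin phi) ^+ 2 / t ^+ 2 + 1) in
  let rho := q - sin phi / t in
  w r' t phi * (rho ^+ 2 * sin phi / (t * q))
  * polar (rot_act (rotU alpha *m rotV beta) (ftilde f)) rho theta phi.

Definition interior_transform (w : R -> R -> R -> R) (f : 'cV[R]_3 -> R)
    (r' alpha beta : R) : R :=
  \int[leb]_(t in `]0, r'])
    \int[leb]_(theta in `[0, 2 * pi])
      \int[leb]_(phi in `[0, pi])
        interior_integrand w f r' alpha beta t theta phi.

(* A library integral is a total function with a default value; this says that
   the iterated integral [interior_transform w f r' alpha beta] exists: each of
   the two inner integrands is integrable for almost every value of the outer
   variables, and so is the outermost one. *)
Definition interior_transform_exists (w : R -> R -> R -> R)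
    (f : 'cV[R]_3 -> R) (r' alpha beta : R) : Prop :=
  let J := interior_integrand w f r' alpha beta in
  [/\ {ae leb, forall t, t \in `]0, r'] ->
        {ae leb, forall theta, theta \in `[0, 2 * pi] ->
          leb.-integrable `[0, pi] (fun phi => (J t theta phi)%:E)}},
      {ae leb, forall t, t \in `]0, r'] ->
        leb.-integrable `[0, 2 * pi]
          (fun theta => (\int[leb]_(phi in `[0, pi]) J t theta phi)%:E)} &
      leb.-integrable `]0, r']
        (fun t => (\int[leb]_(theta in `[0, 2 * pi])
                     \int[leb]_(phi in `[0, pi]) J t theta phi)%:E)].

End Transform.

Section Weights.
Context {R : realType}.

(* Derivative along [A]: two-sided inside [A], one-sided at its endpoints (and
   no condition when [x] is isolated in [A]). *)
Definition is_derive_within (A : set R) (g : R -> R) (x l : R) : Prop :=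
  (y - x)^-1 * (g y - g x) @[y --> within A x^'] --> l.

Definition triangle (a b : R) : set (R * R) :=
  [set p | a <= p.1 <= b /\ a <= p.2 <= p.1].

(* W and its partial derivative with respect to its first variable are
   continuous on D. *)
Definition continuous_with_partial1 (D : set (R * R)) (W : R -> R -> R) :
    Prop :=
  {within D, continuous (fun p : R * R => W p.1 p.2)} /\
  exists W' : R -> R -> R,
    (forall t rho, D (t, rho) ->
       is_derive_within [set s | D (s, rho)] (W ^~ rho) t (W' t rho)) /\
    {within D, continuous (fun p : R * R => W' p.1 p.2)}.

(* W_2(t, rho) = w_2(1/t, phi) with sin phi = rho / t.  The colatitude phi
   ranges over [0, pi], where this equation has the two solutions
   asin (rho / t) and pi - asin (rho / t); [far] selects the second one.  The
   two determinations agree at rho = t. *)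
Definition W2 (w2 : R -> R -> R) (far : bool) (t rho : R) : R :=
  w2 (1 / t) (if far then pi - asin (rho / t) else asin (rho / t)).

Definition w1_domain : set (R * R) := [set p | 0 <= p.2 <= p.1].

Definition bounded_with_partials (D : set (R * R)) (v : R -> R -> R) : Prop :=
  exists (v1 v2 : R -> R -> R) (M : R),
    forall r' t, D (r', t) ->
      [/\ is_derive_within [set s | D (s, t)] (v ^~ t) r' (v1 r' t),
          is_derive_within [set s | D (r', s)] (v r') t (v2 r' t) &
          [/\ `|v r' t| <= M, `|v1 r' t| <= M & `|v2 r' t| <= M]].

Definition delta (eps : R) : R := (1 - eps ^+ 2) / (2 * eps).

End Weights.

(* Main.v *)
Require Import Defs.
From HB Require Import structures.
From mathcomp Require Import all_boot all_order all_algebra.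
From mathcomp Require Import all_classical all_reals all_analysis.
From mathcomp Require Import measurable_realfun.
From mathcomp Require Import ring lra.

Set Implicit Arguments.
Unset Strict Implicit.
Unset Printing Implicit Defensive.

Import Order.TTheory GRing.Theory Num.Theory.
Import numFieldNormedType.Exports.

Local Open Scope classical_set_scope.
Local Open Scope ring_scope.
(** Write [u] for the difference of [ftilde f] and [ftilde g]: a continuous function supported in the
    part of the shell [eps1 < |x| < eps2] that lies in the upper half space.  On a torus of parameter
    [t] put [T = 1 / t] and [s = T sin phi].  The point of colatitude [phi] then has radius [rad s],
    where [rad] is inverse to [delta], and the weight [w2] becomes one of the two determinations of
    [W2] at [(T, s)], according to whether [phi] is before or after [pi / 2].

    The factor [w1 r' t] comes out of the inner integrals ([Rintegral_scale]), and what remains is a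
    Volterra equation of the first kind in [r'] for the integral over a single torus.  The kernel is
    Lipschitz and has no zero on the diagonal, so that this integral is determined by the transform,
    at every [t] at which it is continuous ([outer_volterra], [torus_integrals_eq]).  Volterra
    equations are solved for a merely integrable unknown ([volterra_first_kind]): subtracting the
    equations at two points bounds the increments of the primitive of [B s s * g s] by the norm of
    [g], and on short intervals Lebesgue differentiation makes the norm smaller than its own half.

    Now let [V s] be the function [u] on the sphere of radius [rad s], times the density of the
    transform.  All integrals of [V] over tori vanish, for every Euler frame, and hence for every
    orthogonal frame, since frames with the same axis differ by a rotation about it or by a reflection
    ([frame_same_axis], [torus_integral_rotate]).  Fix a direction [e] and average over the rotations
    around it: [V s] becomes a zonal function, depending on [s] and on the height [z] along [e] only.
    Testing the averaged equations against [z^(2n)], and using that circle averages are self-adjoint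
    on the sphere ([zonal_exchange]), gives equations between the even moments of the zonal functions.
    The circle average of [z^(2n)] is a polynomial in [z] of degree [2n] whose leading part has the
    coefficient [circle_coeff n (sin a)], a multiple of the Legendre polynomial of degree [2n].  By
    induction on [n] the lower moments vanish, and the moment [m] of degree [2n] satisfies
    [\int_0^(pi/2) A (T, T sin a) m (T sin a) da = 0], where [A (T, T)] does not vanish: at
    [a = pi / 2] the two weights agree and are nonzero, and so is the coefficient
    ([moment_equation], [circle_coeff1_neq0]).

    This is Abel's equation.  Both axes of an octant of the sphere play the same role
    ([octant_swap]), and for this reason integrating the equation over [T = x sqrt (1 - z^2)] produces
    a Volterra equation with a regular kernel ([abel_to_volterra]); so [m = 0] ([abel_vanish]).  As
    the weights [z^(2n)] concentrate at the two poles, the zonal functions have opposite values there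
    ([moments_eq0]), which says that [u (r e) + u (- r e) = 0] for all [r].  One of these two points
    is outside of the upper half space, so that [u] vanishes; and [ftilde f] is [f] times a positive
    function of the radius ([tilde_factor_gt0]). *)

(** * Continuity of composed functions *)

Lemma contC (T W : topologicalType) (c : W) : continuous (fun _ : T => c).
Proof. exact: cst_continuous. Qed.

Section Continuity.
Context {R : realType} {T : topologicalType}.
Implicit Types f g : T -> R.

Lemma contD f g : continuous f -> continuous g -> continuous (fun t => f t + g t).
Proof. by move=> cf cg t; apply: continuousD; [exact: cf|exact: cg]. Qed.

Lemma contN f : continuous f -> continuous (fun t => - f t).
Proof. by move=> cf t; apply: continuousN; exact: cf. Qed.

Lemma contM f g : continuous f -> continuous g -> continuous (fun t => f t * g t).
Proof. by move=> cf cg t; apply: continuousM; [exact: cf|exact: cg]. Qed.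

Lemma contcomp (h : R -> R) f : continuous h -> continuous f ->
  continuous (fun t => h (f t)).
Proof. by move=> ch cf t; apply: continuous_comp; [exact: cf|exact: ch]. Qed.

Lemma contX n f : continuous f -> continuous (fun t => f t ^+ n).
Proof. by move=> cf; apply: (contcomp (h := fun x => x ^+ n)) => //; exact: exprn_continuous. Qed.

Lemma contMn n f : continuous f -> continuous (fun t => f t *+ n).
Proof.
by move=> cf; under eq_fun do rewrite -mulr_natr; apply: contM => //; exact: contC.
Qed.

Lemma cont_sin f : continuous f -> continuous (fun t => sin (f t)).
Proof. by move=> cf; apply: contcomp => //; exact: continuous_sin. Qed.

Lemma cont_cos f : continuous f -> continuous (fun t => cos (f t)).
Proof. by move=> cf; apply: contcomp => //; exact: continuous_cos. Qed.

Lemma cont_sqrt f : continuous f -> continuous (fun t => Num.sqrt (f t)).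
Proof. by move=> cf; apply: contcomp => //; exact: sqrt_continuous. Qed.

Lemma contV f : (forall t, f t != 0) -> continuous f -> continuous (fun t => (f t)^-1).
Proof. by move=> f0 cf t; apply: continuousV; [exact: f0|exact: cf]. Qed.

Lemma cont_max f g : continuous f -> continuous g ->
  continuous (fun t => Num.max (f t) (g t)).
Proof. by move=> cf cg t; apply: continuous_max; [exact: cf|exact: cg]. Qed.

Lemma cont_min f g : continuous f -> continuous g ->
  continuous (fun t => Num.min (f t) (g t)).
Proof. by move=> cf cg t; apply: continuous_min; [exact: cf|exact: cg]. Qed.

Lemma cont_norm f : continuous f -> continuous (fun t => `|f t|).
Proof. by move=> cf; apply: contcomp => //; exact: norm_continuous. Qed.

Lemma cont_sum (I : Type) (r : seq I) (P : pred I) (F : I -> T -> R) :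
  (forall i, continuous (F i)) ->
  continuous (fun t => \sum_(i <- r | P i) F i t).
Proof.
move=> cF; elim: r => [|i r IH].
  by under eq_fun do rewrite big_nil; exact: contC.
under eq_fun do rewrite big_cons.
by case: (P i) => //; apply: contD.
Qed.

Lemma cont_pair (U W : topologicalType) (f : T -> U) (g : T -> W) :
  continuous f -> continuous g -> continuous (fun t => (f t, g t)).
Proof. by move=> cf cg t; apply: cvg_pair; [exact: cf|exact: cg]. Qed.

End Continuity.

Lemma cont_comp (T U W : topologicalType) (h : U -> W) (f : T -> U) :
  continuous h -> continuous f -> continuous (fun t => h (f t)).
Proof. by move=> ch cf t; apply: continuous_comp; [exact: cf|exact: ch]. Qed.

Lemma cont_id (T : topologicalType) : continuous (fun t : T => t).
Proof. by move=> t; exact: cvg_id. Qed.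

Lemma cont_fst (T U W : topologicalType) (f : T -> U * W) :
  continuous f -> continuous (fun t => (f t).1).
Proof. by move=> cf; apply: cont_comp cf => x; exact: cvg_fst. Qed.

Lemma cont_snd (T U W : topologicalType) (f : T -> U * W) :
  continuous f -> continuous (fun t => (f t).2).
Proof. by move=> cf; apply: cont_comp cf => x; exact: cvg_snd. Qed.

Lemma cont2 (T U W Z : topologicalType) (F : U -> W -> Z) (f : T -> U) (g : T -> W) :
  continuous (fun p : U * W => F p.1 p.2) -> continuous f -> continuous g ->
  continuous (fun t => F (f t) (g t)).
Proof.
move=> cF cf cg; exact: (@cont_comp _ _ _ (fun p : U * W => F p.1 p.2)
  (fun t => (f t, g t)) cF (cont_pair cf cg)).
Qed.

Arguments contC {T W} c.

Lemma cont_sec1 (U W Z : topologicalType) (F : U -> W -> Z) x :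
  continuous (fun p : U * W => F p.1 p.2) -> continuous (F x).
Proof. by move=> cF; exact: (cont2 cF (contC x) (@cont_id _)). Qed.

Lemma cont_sec2 (U W Z : topologicalType) (F : U -> W -> Z) y :
  continuous (fun p : U * W => F p.1 p.2) -> continuous (F ^~ y).
Proof. by move=> cF; exact: (cont2 cF (@cont_id _) (contC y)). Qed.

Arguments cont_sec1 {U W Z} F x _.
Arguments cont_sec2 {U W Z} F y _.

Ltac cont1 := lazymatch goal with
  | |- continuous (fun t => t) => exact: cont_id
  | |- continuous cos => exact: continuous_cos
  | |- continuous sin => exact: continuous_sin
  | |- continuous fst => exact: (cont_fst (@cont_id _))
  | |- continuous snd => exact: (cont_snd (@cont_id _))
  | |- continuous (fun _ => ?c) => exact: contC
  | |- continuous (fun t => (@?f t) + (@?g t)) => apply: (@contD _ _ f g)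
  | |- continuous (fun t => (@?f t) * (@?g t)) => apply: (@contM _ _ f g)
  | |- continuous (fun t => - (@?f t)) => apply: (@contN _ _ f)
  | |- continuous (fun t => (@?f t) ^+ _) => apply: (@contX _ _ _ f)
  | |- continuous (fun t => (@?f t) *+ _) => apply: (@contMn _ _ _ f)
  | |- continuous (fun t => sin (@?f t)) => apply: (@cont_sin _ _ f)
  | |- continuous (fun t => cos (@?f t)) => apply: (@cont_cos _ _ f)
  | |- continuous (fun t => Num.sqrt (@?f t)) => apply: (@cont_sqrt _ _ f)
  | |- continuous (fun t => Num.max (@?f t) (@?g t)) => apply: (@cont_max _ _ f g)
  | |- continuous (fun t => Num.min (@?f t) (@?g t)) => apply: (@cont_min _ _ f g)
  | |- continuous (fun t => `|@?f t|) => apply: (@cont_norm _ _ f)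
  | |- continuous (fun t => (@?f t, @?g t)) => apply: (@cont_pair _ _ _ f g)
  | |- continuous (fun t => (@?f t).1) => apply: (@cont_fst _ _ _ f)
  | |- continuous (fun t => (@?f t).2) => apply: (@cont_snd _ _ _ f)
  | |- _ => assumption
  end.
Ltac cont := repeat cont1.

(** * Integrals of continuous functions over segments *)

Section SegmentIntegral.
Context {R : realType}.
Notation mu := (@lebesgue_measure R).
Implicit Types (a b c : R) (F G : R -> R).

Definition segint (a b : R) (F : R -> R) : R := \int[mu]_(x in `[a, b]) F x.

Lemma segintE a b F : segint a b F = \int[mu]_(x in `[a, b]) F x.
Proof. by []. Qed.

Lemma segint_integrable a b F : continuous F -> mu.-integrable `[a, b] (EFin \o F).
Proof.
move=> cF; apply: continuous_compact_integrable; first exact: segment_compact.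
exact: continuous_subspaceT.
Qed.

Lemma eq_segint a b F G : (forall x, a <= x <= b -> F x = G x) ->
  segint a b F = segint a b G.
Proof.
by move=> FG; apply: eq_Rintegral => x; rewrite inE /= in_itv /=; exact: FG.
Qed.

Lemma segintD a b F G : continuous F -> continuous G ->
  segint a b (fun x => F x + G x) = segint a b F + segint a b G.
Proof. by move=> cF cG; apply: RintegralD => //; exact: segint_integrable. Qed.

Lemma segintB a b F G : continuous F -> continuous G ->
  segint a b (fun x => F x - G x) = segint a b F - segint a b G.
Proof. by move=> cF cG; apply: RintegralB => //; exact: segint_integrable. Qed.

Lemma segintZ a b c F : continuous F ->
  segint a b (fun x => c * F x) = c * segint a b F.
Proof. by move=> cF; apply: RintegralZl => //; exact: segint_integrable. Qed.

Lemma segintZr a b c F : continuous F ->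
  segint a b (fun x => F x * c) = segint a b F * c.
Proof. by move=> cF; apply: RintegralZr => //; exact: segint_integrable. Qed.

Lemma segint_cst a b c : a <= b -> segint a b (fun _ => c) = c * (b - a).
Proof.
move=> ab; rewrite /segint Rintegral_cst//=; congr (_ * _).
have /= -> := lebesgue_measure_itv `[a, b].
by rewrite lte_fin; case: ltgtP ab => //= [-> _]; rewrite subrr.
Qed.

Lemma segint0 a b : segint a b (fun _ => 0) = 0.
Proof. by rewrite /segint Rintegral_cst// mul0r. Qed.

Lemma segint_sum (I : Type) (r : seq I) (P : pred I) (F : I -> R -> R) a b :
  (forall i, continuous (F i)) ->
  segint a b (fun x => \sum_(i <- r | P i) F i x) = \sum_(i <- r | P i) segint a b (F i).
Proof.
move=> cF; elim: r => [|i r IH].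
  by rewrite big_nil -[RHS](segint0 a b); apply: eq_segint => x _; rewrite big_nil.
rewrite big_cons -IH; transitivity (segint a b (fun x =>
    (if P i then F i x else 0) + \sum_(i <- r | P i) F i x)).
  by apply: eq_segint => x _; rewrite big_cons; case: (P i); rewrite ?add0r.
case: (P i); first by rewrite segintD//; apply: cont_sum.
by apply: eq_segint => x _; rewrite add0r.
Qed.

Lemma segint_split a b c F : a <= c -> c <= b -> continuous F ->
  segint a b F = segint a c F + segint c b F.
Proof.
move=> ac cb cF; rewrite /segint; apply/eqP; rewrite addrC -subr_eq.
rewrite Rintegral_itvB ?bnd_simp//; last exact: segint_integrable.
rewrite Rintegral_itv_obnd_cbnd//.
apply: integrableS (segint_integrable c b cF) => //.
exact: subset_itv_oc_cc.
Qed.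

Lemma segint_ge0 a b F : (forall x, a <= x <= b -> 0 <= F x) -> 0 <= segint a b F.
Proof. by move=> F0; apply: Rintegral_ge0 => x /=; rewrite in_itv/=; exact: F0. Qed.

Lemma le_segint a b F G : continuous F -> continuous G ->
  (forall x, a <= x <= b -> F x <= G x) -> segint a b F <= segint a b G.
Proof.
move=> cF cG FG; apply: le_Rintegral => //; exact: segint_integrable.
Qed.

Lemma segint_norm_le a b c F : a <= b -> continuous F ->
  (forall x, a <= x <= b -> `|F x| <= c) -> `|segint a b F| <= c * (b - a).
Proof.
move=> ab cF Fc; apply: le_trans (le_normr_Rintegral _ _) _ => //.
  exact: segint_integrable.
rewrite -segint_cst//; apply: le_segint => //; [exact: cont_norm|exact: contC].
Qed.

Lemma segint_primitive a b F P : a <= b -> continuous F ->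
  (forall x, a <= x <= b -> is_derive x 1 P (F x)) -> segint a b F = P b - P a.
Proof.
rewrite le_eqVlt => /predU1P[-> _ _|ab cF dP].
  by rewrite /segint set_itv1 Rintegral_set1 subrr.
have dPx x : a <= x <= b -> derivable P x 1.
  by move=> /dP h; exact: (@ex_derive _ _ _ _ _ _ _ h).
have cPx x : a <= x <= b -> {for x, continuous P}.
  by move=> /dPx h; apply/differentiable_continuous/derivable1_diffP.
rewrite /segint /Rintegral (@continuous_FTC2 _ F P)//.
- exact: continuous_subspaceT.
- split.
  + move=> x; rewrite in_itv/= => /andP[ax xb]; apply: dPx.
    by rewrite (ltW ax) (ltW xb).
  + by apply: cvg_at_right_filter; apply: cPx; rewrite lexx (ltW ab).
  + by apply: cvg_at_left_filter; apply: cPx; rewrite lexx (ltW ab).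
- move=> x; rewrite in_itv/= => /andP[ax xb]; rewrite derive1E.
  by apply: (@derive_val _ _ _ _ _ _ _ (dP x _)); rewrite (ltW ax) (ltW xb).
Qed.

Lemma ex_primitive (l : R) F : continuous F ->
  exists P : R -> R, forall x, l < x -> is_derive x 1 P (F x).
Proof.
move=> cF; exists (fun x => segint l x F) => x lx.
have [//||//||dP vP] := @continuous_FTC1_closed R F l x (x + 1).
- by rewrite ltrDl.
- exact: segint_integrable.
- exact: cF.
by apply: DeriveDef; [exact: dP|rewrite -vP derive1E].
Qed.

Lemma segint_reflect a b c F : a <= b -> continuous F ->
  segint a b (fun x => F (c - x)) = segint (c - b) (c - a) F.
Proof.
move=> ab cF; have [P dP] := @ex_primitive (c - b - 1) F cF.
apply: (etrans (@segint_primitive a b _ (fun x => - P (c - x)) ab _ _)).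
- by apply: cont_comp cF _; cont.
- move=> x /andP[_ xb]; have -> : F (c - x) = - (F (c - x) * -1) by rewrite mulrN1 opprK.
  apply: is_deriveN; apply: (@is_derive1_comp _ P (fun x => c - x)).
    by apply: dP; lra.
  rewrite -[X in is_derive _ _ _ X]sub0r; exact: is_deriveB.
apply/esym; apply: (etrans (@segint_primitive _ _ _ P _ cF _)); first by rewrite lerB.
  by move=> x /andP[cx _]; apply: dP; lra.
by rewrite opprK addrC.
Qed.

Lemma segint_scale (k : R) a b F : 0 < k -> a <= b -> continuous F ->
  k * segint a b (fun x => F (k * x)) = segint (k * a) (k * b) F.
Proof.
move=> k0 ab cF; have [P dP] := @ex_primitive (k * a - 1) F cF.
have ckF : continuous (fun x => F (k * x)).
  by apply: (@cont_comp _ _ _ F (fun x => k * x)) => //; cont.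
rewrite -segintZ//.
apply: (etrans (@segint_primitive a b _ (fun x => P (k * x)) ab _ _)).
- by apply: contM => //; exact: contC.
- move=> x /andP[xb _]; rewrite mulrC.
  apply: (@is_derive1_comp _ P (fun x => k * x)).
    by apply: dP; have : k * a <= k * x by [rewrite ler_pM2l|]; lra.
  rewrite -[X in is_derive _ _ _ X]mulr1; exact: is_deriveZ.
apply/esym/segint_primitive => //; first by rewrite ler_pM2l.
by move=> x /andP[cx _]; apply: dP; lra.
Qed.

(** Uniform continuity along the compact segment, in the form of the tube lemma, makes the
    integrand uniformly close to the one at [t0]. *)
Lemma segint_cont (T : topologicalType) a b (F : T -> R -> R) :
  continuous (fun p : T * R => F p.1 p.2) -> continuous (fun t => segint a b (F t)).
Proof.
move=> cF t0; have cFt t : continuous (F t).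
  exact: (cont_sec1 F t cF).
have [ba|ab] := ltP b a.
  have s0 t : segint a b (F t) = 0.
    by rewrite /segint set_itv_ge ?bnd_simp -?ltNge// Rintegral_set0.
  rewrite /prop_for /continuous_at s0; under eq_fun do rewrite s0; exact: cvg_cst.
apply/cvgrPdist_le => e e0.
have h : \forall t \near t0, forall y, `[a, b]%classic y ->
    `|F t0 y - F t y| <= e / (b - a + 1).
  have := @segment_compact _ a b; move/compact_near_coveringP.
  apply => y _.
  have := cF (t0, y); move/cvgrPdist_le => /(_ (e / (b - a + 1) / 2)) /=.
  have p : 0 < e / (b - a + 1) / 2.
    by rewrite divr_gt0// divr_gt0// ltr_wpDl// subr_ge0.
  move=> /(_ p) [[A B] /= [nA nB] AB]; exists (B, A) => // -[y' t] /= [By' At].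
  have h1 := AB (t0, y') (conj (nbhs_singleton nA) By').
  have h2 := AB (t, y') (conj At By').
  rewrite /= in h1 h2; rewrite distrC in h1.
  have -> : F t0 y' - F t y' = (F t0 y' - F t0 y) + (F t0 y - F t y') by ring.
  by apply: le_trans (ler_normD _ _) _; rewrite [leRHS]splitr lerD.
near=> t; rewrite -segintB//.
have ab0 : 0 < b - a + 1 by rewrite ltr_wpDl// subr_ge0.
apply: (@le_trans _ _ (e / (b - a + 1) * (b - a))).
  apply: segint_norm_le => //; first by apply: contD => //; apply: contN.
  by move=> y yab; apply: (near h t) => //=; rewrite in_itv.
by rewrite -mulrA ler_piMr ?(ltW e0)// mulrC ler_pdivrMr// mul1r lerDl.
Unshelve. all: by end_near. Qed.

(** Open sets of the plane are countable unions of rational rectangles, so that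
    continuity implies measurability for the product sigma-algebra. *)
Lemma continuous_measurable2 (F : R * R -> R) :
  continuous F -> measurable_fun setT F.
Proof.
move=> cF; apply: (measurability _ (RGenOInfty.measurableE R)).
move=> _ [_ [c ->] <-]; rewrite setTI.
pose box (p : rat * rat * (rat * rat)) : set (R * R) :=
  `](ratr p.1.1), (ratr p.1.2)[%classic `*` `](ratr p.2.1), (ratr p.2.2)[%classic.
rewrite (_ : _ @^-1` _ = \bigcup_(p in [set p | box p `<=` [set z | c < F z]]) box p).
  rewrite bigcup_mkcond; apply: countable_bigcupT_measurable => [|p].
    exact: countableP.
  by case: ifP => // _; exact: measurableX.
apply/seteqP; split => [[x y]|[x y] [p /= bp pxy]]; last first.
  by have := bp _ pxy; rewrite /= in_itv/= andbT.
rewrite /= in_itv/= andbT => cxy.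
have [[A B] /= [/nbhs_ballP[e e0 eA] /nbhs_ballP[e' e'0 e'B]] AB] := cvgr_gt _ (cF (x, y)) _ cxy.
have [p1] := @rat_in_itvoo R (x - e) x ltac:(by rewrite ltrBlDr ltrDl).
have [p2] := @rat_in_itvoo R x (x + e) ltac:(by rewrite ltrDl).
have [q1] := @rat_in_itvoo R (y - e') y ltac:(by rewrite ltrBlDr ltrDl).
have [q2] := @rat_in_itvoo R y (y + e') ltac:(by rewrite ltrDl).
rewrite !in_itv/= => /andP[h1 h2] /andP[h3 h4] /andP[h5 h6] /andP[h7 h8].
exists (p1, p2, (q1, q2)); last by split; rewrite /= in_itv/= ?h5 ?h8 ?h4 ?h1.
move=> [u v] [/=]; rewrite !in_itv/= => /andP[pu up] /andP[qv vq].
apply: (AB (u, v)); split => /=.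
  by apply: eA; rewrite /ball/= ltr_norml; apply/andP; split; lra.
by apply: e'B; rewrite /ball/= ltr_norml; apply/andP; split; lra.
Qed.

Lemma segint_swap a b c d (F : R -> R -> R) :
  continuous (fun p : R * R => F p.1 p.2) ->
  segint a b (fun x => segint c d (F x)) = segint c d (fun y => segint a b (F ^~ y)).
Proof.
move=> cF.
(* Fubini's theorem is applied on the whole plane, to the restriction to the rectangle. *)
pose D : set (R * R) := `[a, b]%classic `*` `[c, d]%classic.
have mD : measurable D by exact: measurableX.
pose f : R * R -> \bar R := (fun p => (F p.1 p.2)%:E) \_ D.
have intf : (mu \x mu)%E.-integrable setT f.
  refine (proj1 (@integrable_mkcond _ _ R (mu \x mu)%E D (fun p => (F p.1 p.2)%:E) mD) _).
  apply: measurable_bounded_integrable => //.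
  - suff : (mu `[a, b]%classic * mu `[c, d]%classic < +oo)%E.
      apply: le_lt_trans; rewrite le_eqVlt; apply/orP; left; apply/eqP.
      exact: product_measure1E.
    have /= -> := lebesgue_measure_itv `[a, b]; have /= -> := lebesgue_measure_itv `[c, d].
    by case: ifP => _; case: ifP => _; rewrite ?mule0 ?mul0e ?ltry// -!EFinB -EFinM ltry.
  - by apply: measurable_funTS; exact: continuous_measurable2.
  - have cD : compact D by apply: compact_setX; exact: segment_compact.
    have [M [_ HM]] := compact_bounded (continuous_compact (continuous_subspaceT cF) cD).
    by exists M; split; rewrite ?num_real// => x Mx p Dp; apply: HM => //; exists p.
have cFx x : continuous (F x) := cont_sec1 F x cF.
have cFy y : continuous (F ^~ y) := cont_sec2 F y cF.
rewrite /segint {1}/Rintegral [RHS]/Rintegral; congr fine.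
have := Fubini intf; congr (_ = _).
  rewrite [RHS]integral_mkcond; apply: eq_integral => x _.
  rewrite patchE; case: ifPn => xab.
    rewrite /Rintegral fineK; last exact: integrable_fin_num (segint_integrable _ _ (cFx x)).
    rewrite [RHS]integral_mkcond; apply: eq_integral => y _; rewrite /f !patchE.
    by rewrite /D in_setX xab.
  by apply: integral0_eq => y _; rewrite /f patchE /D in_setX (negbTE xab).
rewrite [RHS]integral_mkcond; apply: eq_integral => y _.
rewrite patchE; case: ifPn => yab.
  rewrite /Rintegral fineK; last exact: integrable_fin_num (segint_integrable _ _ (cFy y)).
  rewrite [RHS]integral_mkcond; apply: eq_integral => x _; rewrite /f !patchE.
  by rewrite /D in_setX yab andbT.
by apply: integral0_eq => x _; rewrite /f patchE /D in_setX (negbTE yab) andbF.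
Qed.

End SegmentIntegral.

#[global] Opaque segint.

Arguments segint_cont {R T} a b F _.

(** * Periodic functions, and the octant of the sphere *)

Section Octant.
Context {R : realType}.
Notation mu := (@lebesgue_measure R).

Lemma segint_shift a b c (F : R -> R) : a <= b -> continuous F ->
  segint a b (fun x => F (c + x)) = segint (c + a) (c + b) F.
Proof.
move=> ab cF.
have cG : continuous (fun x => F (0 - x)).
  by apply: (@cont_comp _ _ _ F (fun x => 0 - x)) => //; cont.
transitivity (segint a b (fun x => F (0 - (- c - x)))).
  by apply: eq_segint => x _; congr F; ring.
rewrite (@segint_reflect _ a b (- c) (fun x => F (0 - x)))// segint_reflect//; last first.
  by rewrite lerB.
by rewrite !sub0r !opprB !opprK addrC [b + c]addrC.
Qed.

Lemma segint_periodic_reflect (c : R) (F : R -> R) : continuous F ->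
  (forall x, F (x + 2 * pi) = F x) -> 0 <= c <= 2 * pi ->
  segint 0 (2 * pi) (fun x => F (c - x)) = segint 0 (2 * pi) F.
Proof.
move=> cF pF /andP[c0 c2]; have p0 : 0 <= 2 * pi :> R by rewrite (le_trans c0).
rewrite segint_reflect// subr0.
rewrite (@segint_split _ _ _ 0) ?subr_le0//.
rewrite [RHS](@segint_split _ _ _ c)// addrC; congr (_ + _).
have [e1 e2] : c = 2 * pi + (c - 2 * pi) /\ 2 * pi = 2 * pi + 0 :> R by split; ring.
rewrite [RHS](_ : _ = segint (2 * pi + (c - 2 * pi)) (2 * pi + 0) F); last by rewrite -e1 -e2.
rewrite -segint_shift ?subr_le0//.
by apply: eq_segint => x _; rewrite addrC pF.
Qed.

Lemma segint_periodic_shift (c : R) (F : R -> R) : continuous F ->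
  (forall x, F (x + 2 * pi) = F x) -> 0 <= c <= 2 * pi ->
  segint 0 (2 * pi) (fun x => F (c + x)) = segint 0 (2 * pi) F.
Proof.
move=> cF pF /andP[c0 c2].
have cG : continuous (fun x => F (0 - x)).
  by apply: (@cont_comp _ _ _ F (fun x => 0 - x)) => //; cont.
have pG x : F (0 - (x + 2 * pi)) = F (0 - x).
  by rewrite -[LHS]pF; congr F; ring.
have p0 : 0 <= 2 * pi :> R by rewrite (le_trans c0).
rewrite -[RHS](@segint_periodic_reflect 0)// ?lexx//.
rewrite -(@segint_periodic_reflect (2 * pi - c) (fun x => F (0 - x)))//; last first.
  by rewrite subr_ge0 c2 lerBlDr lerDl.
by apply: eq_segint => x _; rewrite -[RHS]pF; congr F; ring.
Qed.

Lemma measurable_inv : measurable_fun setT (@GRing.inv R).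
Proof.
rewrite -(setUv [set 0 : R]); apply/measurable_funU => //; first exact: measurableC.
split; first exact: measurable_fun_set1.
apply: open_continuous_measurable_fun.
  exact/closed_openC/closed_eq.
by move=> x; rewrite inE /= => /eqP x0; exact: inv_continuous.
Qed.

Lemma ler_sin : {in `[- (pi / 2), pi / 2] &, {mono (@sin R) : x y / x <= y}}.
Proof. by apply: le_mono_in => x y hx hy xy; rewrite ltr_sin. Qed.

(** The substitution [y = c * sin t].  Its density blows up at [y = c], so that it is an identity of
    nonnegative integrals, obtained by exhausting [[0, pi / 2[] by the segments [[0, d n]]. *)
Lemma arcsine_substitution (h : R -> R) (c : R) :
  continuous h -> (forall y, 0 <= h y) -> 0 < c <= 1 ->
  (\int[mu]_(t in `[0%R, (pi / 2)%R]) (h (c * sin t))%:E =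
   \int[mu]_(y in `[0%R, 1%R[) (h y * (Num.sqrt (c ^+ 2 - y ^+ 2))^-1)%:E)%E.
Proof.
move=> ch h0 /andP[c0 c1].
pose g y := h y * (Num.sqrt (c ^+ 2 - y ^+ 2))^-1.
have p2 : 0 < pi / 2 :> R by rewrite divr_gt0// pi_gt0.
have mg : measurable_fun setT g.
  apply: measurable_funM; first exact: continuous_measurable_fun.
  apply: measurableT_comp; first exact: measurable_inv.
  by apply: continuous_measurable_fun; cont.
have chs : continuous (fun t => h (c * sin t)).
  by apply: (@cont_comp _ _ _ h (fun t => c * sin t)) => //; cont.
have sub (d : R) : 0 <= d < pi / 2 ->
    (\int[mu]_(t in `[0%R, d]) (h (c * sin t))%:E =
     \int[mu]_(y in `[0%R, (c * sin d)%R]) (g y)%:E)%E.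
  move=> /andP[d0 dp].
  have dF (t : R) : is_derive t (1 : R) (fun x : R => c * sin x) (c * cos t).
    exact: is_deriveZ.
  have dFE : derive1 (fun x : R => c * sin x) = (fun t : R => c * cos t).
    by apply/funext => t; rewrite derive1E; exact: (@derive_val _ _ _ _ _ _ _ (dF t)).
  have sd : sin d < 1.
    rewrite -sin_pihalf ltr_sin// in_itv/= ?lexx ?andbT ?(ltW dp) ?andbT; lra.
  have cc : continuous (fun t : R => c * cos t) by cont.
  have := @integration_by_substitution_increasing R (fun x => c * sin x) g 0 d d0.
  rewrite dFE sin0 mulr0 => -> //.
  - apply: eq_integral => t; rewrite inE/= in_itv/= => /andP[t0 td].
    congr (_%:E); rewrite !fctE /g -mulrA.
    have ct : 0 < cos t by apply: cos_gt0_pihalf; apply/andP; split; lra.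
    have -> : c ^+ 2 - (c * sin t) ^+ 2 = (c * cos t) ^+ 2.
      by rewrite !exprMn -[X in X - _]mulr1 -(cos2Dsin2 t); ring.
    rewrite sqrtr_sqr gtr0_norm; last exact: mulr_gt0.
    by rewrite mulVf ?mulr1// gt_eqF// mulr_gt0.
  - move=> x y; rewrite !in_itv/= => /andP[x0 xd] /andP[y0 yd] xy.
    by rewrite ltr_pM2l// ltr_sin// in_itv/=; apply/andP; split; lra.
  - apply/cvg_ex; exists (c * cos 0); apply: cvg_at_right_filter; exact: cc.
  - apply/cvg_ex; exists (c * cos d); apply: cvg_at_left_filter; exact: cc.
  - have cs : continuous (fun t : R => c * sin t) by cont.
    split.
    + by move=> x _; exact: (@ex_derive _ _ _ _ _ _ _ (dF x)).
    + by apply: cvg_at_right_filter; exact: cs.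
    + by apply: cvg_at_left_filter; exact: cs.
  - apply: continuous_in_subspaceT => y; rewrite inE/= in_itv/= => /andP[y0 yd].
    rewrite /continuous_at /g; apply: cvgM; first exact: ch.
    apply: cvgV; last first.
      have cs : continuous (fun z : R => Num.sqrt (c ^+ 2 - z ^+ 2)) by cont.
      exact: cs.
    rewrite sqrtr_eq0 -ltNge subr_gt0 ltr_pXn2r ?nnegrE ?(ltW c0)//.
    by apply: le_lt_trans yd _; rewrite gtr_pMr.
pose d n : R := pi / 2 - pi / 2 / n.+1%:R.
have dE n : 0 <= d n < pi / 2.
  rewrite /d subr_ge0 ltrBlDr ltrDl divr_gt0// andbT ler_pdivrMr//.
  by rewrite ler_peMr ?ler1n// ltW.
have dhomo n m : (n <= m)%N -> d n <= d m.
  by move=> nm; rewrite /d lerB// ler_pM2l// lef_pV2 ?posrE// ler_nat.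
have dcov x : x < pi / 2 -> exists n, x <= d n.
  move=> xp; have e0 : 0 < (pi / 2 - x) / (pi / 2) by rewrite divr_gt0// subr_gt0.
  have [n _ /(_ n (leqnn n)) /= hn] := near_infty_natSinv_lt (PosNum e0).
  exists n; rewrite /d lerBrDr -lerBrDl.
  by move: hn; rewrite ltr_pdivlMr// mulrC => /ltW.
have U1 : \bigcup_n `[0, d n]%classic = `[0, pi / 2[%classic.
  apply/seteqP; split=> [x [n _ /=]|x /=]; rewrite !in_itv/= => /andP[x0 xp].
    by rewrite x0 (le_lt_trans xp)//; have /andP[] := dE n.
  by have [n xn] := dcov _ xp; exists n => //=; rewrite in_itv/= x0.
have sd n m : (n <= m)%N -> sin (d n) <= sin (d m).
  move=> nm; have /andP[? ?] := dE n; have /andP[? ?] := dE m.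
  by rewrite ler_sin ?dhomo// in_itv/=; apply/andP; split; lra.
have sd1 n : sin (d n) < 1.
  have /andP[? ?] := dE n.
  by rewrite -sin_pihalf ltr_sin// in_itv/=; apply/andP; split; lra.
have U2 : \bigcup_n `[0, c * sin (d n)]%classic = `[0, c[%classic.
  apply/seteqP; split=> [x [n _ /=]|x /=]; rewrite !in_itv/= => /andP[x0 xp].
    by rewrite x0 (le_lt_trans xp)// gtr_pMr.
  have xc : 0 <= x / c < 1 by rewrite divr_ge0 ?(ltW c0)//= ltr_pdivrMr// mul1r.
  have /andP[xc0 xc1] := xc.
  have [|n xn] := dcov (asin (x / c)).
    by apply: asin_ltpi2; rewrite xc1 andbT; lra.
  exists n => //=; rewrite in_itv/= x0/= mulrC -ler_pdivrMr//.
  have /andP[? ?] := dE n.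
  rewrite -[leLHS]asinK; last by rewrite in_itv/=; apply/andP; split; lra.
  rewrite ler_sin// in_itv/=; apply/andP; split; try lra.
  all: try by [apply: asin_geNpi2; apply/andP; split; lra | apply: asin_lepi2; apply/andP; split; lra].
have mh : measurable_fun setT (fun t => (h (c * sin t))%:E).
  by apply/measurable_EFinP; exact: continuous_measurable_fun.
have g0 y : 0 <= g y by rewrite mulr_ge0// invr_ge0 sqrtr_ge0.
have c1' : (\int[mu]_(t in `[0%R, d n]) (h (c * sin t))%:E)%E @[n --> \oo] -->
    (\int[mu]_(t in `[0%R, (pi / 2)%R[) (h (c * sin t))%:E)%E.
  rewrite -U1; apply: ge0_nondecreasing_set_cvg_integral => //.
  - by move=> n m nm; apply/subsetPset => x /=; rewrite !in_itv/= => /andP[-> /le_trans]; apply; exact: dhomo.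
  - by move=> n; apply: measurable_funTS.
  - by move=> n x _; rewrite lee_fin.
have c2' : (\int[mu]_(t in `[0%R, (c * sin (d n))%R]) (g t)%:E)%E @[n --> \oo] -->
    (\int[mu]_(t in `[0%R, c[) (g t)%:E)%E.
  rewrite -U2; apply: ge0_nondecreasing_set_cvg_integral => //.
  - move=> n m nm; apply/subsetPset => x /=; rewrite !in_itv/= => /andP[-> /le_trans]; apply.
    by rewrite ler_pM2l// sd.
  - by move=> n; apply: measurable_funTS; apply/measurable_EFinP.
  - by move=> n x _; rewrite lee_fin.
have e : (\int[mu]_(t in `[0%R, (pi / 2)%R[) (h (c * sin t))%:E =
  \int[mu]_(y in `[0%R, c[) (g y)%:E)%E.
  apply: (cvg_unique (@ereal_hausdorff R) c1').
  apply: cvg_trans c2'; apply: near_eq_cvg; near=> n.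
  exact: esym (sub _ (dE n)).
(* For [y >= c] the square root is the default value [0], and so is its inverse; this extends the
   range of [y] to [[0, 1[], independently of [c]. *)
rewrite -integral_itv_bndo_bndc; last by apply: measurable_funTS.
rewrite e integral_mkcond [RHS]integral_mkcond; apply: eq_integral => y _.
rewrite !patchE; case: ifPn => [yc|/negP yc].
  rewrite mem_set//=; move: yc; rewrite inE/= !in_itv/= => /andP[-> /lt_le_trans]; exact.
case: ifPn => //; rewrite inE/= in_itv/= => /andP[y0 y1].
have cy : c <= y by rewrite leNgt; apply/negP => yc'; apply: yc; rewrite inE/= in_itv/= y0.
rewrite /g ler0_sqrtr ?invr0 ?mulr0// subr_le0 ler_pXn2r ?nnegrE//; lra.
Unshelve. all: by end_near. Qed.

(** The surface integral of [q y z] over the octant of the unit sphere, in cylindrical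
    coordinates around the [z]-axis. *)
Definition octant (q : R -> R -> R) : R :=
  segint 0 1 (fun z => segint 0 (pi / 2) (fun t => q (Num.sqrt (1 - z ^+ 2) * sin t) z)).

(** In the coordinates [(y, z)] the area element is [dy dz / x] with
    [x = sqrt (1 - z^2 - y^2)], which is symmetric in [y] and [z]. *)
Lemma octant_tonelli (q : R -> R -> R) :
  continuous (fun p : R * R => q p.1 p.2) -> (forall y z, 0 <= q y z) ->
  ((octant q)%:E = \int[mu]_(z in `[0%R, 1%R[) \int[mu]_(y in `[0%R, 1%R[)
     (q y z * (Num.sqrt (1 - z ^+ 2 - y ^+ 2))^-1)%:E)%E.
Proof.
move=> cq q0.
have cin : continuous (fun p : R * R => q (Num.sqrt (1 - p.1 ^+ 2) * sin p.2) p.1).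
  apply: (@cont2 _ _ _ _ q (fun p : R * R => Num.sqrt (1 - p.1 ^+ 2) * sin p.2)
    (fun p => p.1) cq); cont.
have cG := segint_cont 0 (pi / 2) (fun z t : R => q (Num.sqrt (1 - z ^+ 2) * sin t) z) cin.
rewrite /octant segintE /Rintegral fineK; last first.
  exact: (integrable_fin_num _ (segint_integrable 0 1 cG)).
rewrite -integral_itv_bndo_bndc; last first.
  by apply: measurable_funTS; apply/measurable_EFinP; exact: continuous_measurable_fun.
apply: eq_integral => z; rewrite inE/= in_itv/= => /andP[z0 z1].
have cz : continuous (fun y => q y z).
  exact: (cont_sec2 q z cq).
have z2 : 0 < 1 - z ^+ 2 by rewrite subr_gt0 expr_lt1.
have := @arcsine_substitution (q ^~ z) (Num.sqrt (1 - z ^+ 2)) cz (q0 ^~ z).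
rewrite sqrtr_gt0 z2/= sqr_sqrtr ?(ltW z2)// => <-.
  rewrite segintE /Rintegral fineK//.
  apply: (integrable_fin_num _ (segint_integrable 0 (pi / 2) _)) => //.
  by apply: (@cont_comp _ _ _ (q ^~ z) (fun t => Num.sqrt (1 - z ^+ 2) * sin t)) => //; cont.
by rewrite -[leRHS]sqrtr1 ler_wsqrtr// gerBl sqr_ge0.
Qed.

(** Tonelli's theorem for the symmetric form of [octant_tonelli]. *)
Lemma octant_swap_ge0 (q : R -> R -> R) :
  continuous (fun p : R * R => q p.1 p.2) -> (forall y z, 0 <= q y z) ->
  octant (fun y z => q z y) = octant q.
Proof.
move=> cq q0; apply: EFin_inj.
have cq' : continuous (fun p : R * R => q p.2 p.1).
  by apply: (@cont2 _ _ _ _ q (fun p : R * R => p.2) (fun p => p.1) cq); cont.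
rewrite (octant_tonelli cq q0).
rewrite (@octant_tonelli (fun y z => q z y) cq' (fun y z => q0 z y)).
pose D : set (R * R) := `[0, 1[%classic `*` `[0, 1[%classic.
have mD : measurable D by exact: measurableX.
pose k (p : R * R) := (q p.1 p.2 * (Num.sqrt (1 - p.2 ^+ 2 - p.1 ^+ 2))^-1)%:E.
have mk : measurable_fun setT k.
  apply/measurable_EFinP; apply: measurable_funM; first exact: continuous_measurable2.
  apply: measurableT_comp; first exact: measurable_inv.
  by apply: continuous_measurable2; cont.
pose f := k \_ D.
have mf : measurable_fun setT f.
  by apply/(measurable_restrictT _ mD); exact: measurable_funTS.
have f0 p : (0 <= f p)%E.
  rewrite /f patchE; case: ifP => // _; rewrite lee_fin mulr_ge0// invr_ge0; exact: sqrtr_ge0.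
etransitivity; last first.
  etransitivity; first exact: (fubini_tonelli (m1 := mu) (m2 := mu) f mf f0).
  rewrite [RHS]integral_mkcond; apply: eq_integral => y _.
  rewrite patchE; case: ifPn => yab.
    rewrite [RHS]integral_mkcond; apply: eq_integral => x _; rewrite /f !patchE.
    by rewrite /D in_setX yab andbT.
  by apply: integral0_eq => x _; rewrite /f patchE /D in_setX (negbTE yab) andbF.
rewrite integral_mkcond; apply: eq_integral => x _.
rewrite patchE; case: ifPn => xab.
  rewrite integral_mkcond; apply: eq_integral => y _; rewrite /f !patchE.
  rewrite /D in_setX xab/=; case: ifP => [_|//].
  by rewrite /k/= addrAC.
by apply/esym/integral0_eq => y _; rewrite /f patchE /D in_setX (negbTE xab).
Qed.

Lemma octant_swap (q : R -> R -> R) :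
  continuous (fun p : R * R => q p.1 p.2) ->
  octant (fun y z => q z y) = octant q.
Proof.
move=> cq.
have cD : compact (`[0, 1]%classic `*` `[0, 1]%classic : set (R * R)).
  by apply: compact_setX; exact: segment_compact.
have [M [_ HM]] := compact_bounded (continuous_compact (continuous_subspaceT cq) cD).
pose C := `|M| + 1.
have HC y z : 0 <= y <= 1 -> 0 <= z <= 1 -> 0 <= q y z + C.
  move=> hy hz; have : `|q y z| <= C.
    apply: HM; first by rewrite /C (le_lt_trans (ler_norm _))// ltrDl.
    by exists (y, z) => //=; rewrite !in_itv/=.
  by rewrite ler_norml => /andP[]; lra.
(* Adding a constant reduces to the nonnegative case; the maximum makes it hold outside the unit
   square as well. *)
pose q' y z := Num.max 0 (q y z + C).
have cq' : continuous (fun p : R * R => q' p.1 p.2).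
  by rewrite /q'; cont.
have oq (r : R -> R -> R) : continuous (fun p : R * R => r p.1 p.2) ->
    (forall y z, 0 <= y <= 1 -> 0 <= z <= 1 -> 0 <= r y z + C) ->
    octant (fun y z => Num.max 0 (r y z + C)) = octant r + C * (pi / 2).
  move=> cr rC.
  have cin : continuous (fun p : R * R => r (Num.sqrt (1 - p.1 ^+ 2) * sin p.2) p.1).
    apply: (@cont2 _ _ _ _ r (fun p : R * R => Num.sqrt (1 - p.1 ^+ 2) * sin p.2)
    (fun p => p.1) cr); cont.
  have cinz z : continuous (fun t => r (Num.sqrt (1 - z ^+ 2) * sin t) z).
    exact: (cont_sec1 (fun z t : R => r (Num.sqrt (1 - z ^+ 2) * sin t) z) z cin).
  have p2 : 0 <= pi / 2 :> R by rewrite divr_ge0// pi_ge0.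
  have -> : C * (pi / 2) = segint 0 1 (fun _ => C * (pi / 2)) by rewrite segint_cst// subr0 mulr1.
  rewrite /octant -segintD; [|exact: (segint_cont 0 (pi / 2) (fun z t : R => r (Num.sqrt (1 - z ^+ 2) * sin t) z) cin)|exact: contC].
  apply: eq_segint => z /andP[z0 z1].
  have -> : C * (pi / 2) = segint 0 (pi / 2) (fun _ => C) by rewrite segint_cst// subr0.
  rewrite -segintD; [|exact: cinz|exact: contC].
  apply: eq_segint => t /andP[t0 tp].
  have ht : 0 <= sin t <= 1.
    by rewrite sin_le1 andbT sin_ge0_pi//; lra.
  have hz : 0 <= Num.sqrt (1 - z ^+ 2) <= 1.
    by rewrite sqrtr_ge0/= -[leRHS]sqrtr1 ler_wsqrtr// gerBl sqr_ge0.
  rewrite max_r//; apply: rC; last by rewrite z0 z1.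
  have /andP[? ?] := ht; have /andP[? ?] := hz.
  by rewrite mulr_ge0//= mulr_ile1.
have q'0 y z : 0 <= q' y z by rewrite le_max lexx.
have cqT : continuous (fun p : R * R => q p.2 p.1).
  by apply: (@cont2 _ _ _ _ q (fun p : R * R => p.2) (fun p => p.1) cq); cont.
apply: (@addIr _ (C * (pi / 2))).
rewrite -(oq _ cq HC) -(oq (fun y z => q z y) cqT (fun y z hy hz => HC z y hz hy)).
exact: (octant_swap_ge0 cq' q'0).
Qed.

End Octant.

(** * Symmetries of the integral over the sphere *)

Section SphereSymmetry.
Context {R : realType}.

Lemma segint_quarters (G : R -> R -> R) : continuous (fun p : R * R => G p.1 p.2) ->
  segint 0 (2 * pi) (fun t => G (cos t) (sin t)) =
  segint 0 (pi / 2) (fun t => G (cos t) (sin t) + G (- cos t) (sin t)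
    + (G (- cos t) (- sin t) + G (cos t) (- sin t))).
Proof.
move=> cG.
have p2 : 0 < pi / 2 :> R by rewrite divr_gt0// pi_gt0.
have pE : pi = 2 * (pi / 2) :> R by rewrite mulrC divfK.
have cF (f g : R -> R) : continuous f -> continuous g -> continuous (fun t => G (f t) (g t)).
  by move=> cf cg; apply: (@cont2 _ _ _ _ G f g cG).
have cFF : continuous (fun t => G (cos t) (sin t)) by apply: cF; cont.
rewrite !segintD; try (by apply: cF; cont); last 2 first.
- by apply: contD; apply: cF; cont.
- by apply: contD; apply: cF; cont.
rewrite (@segint_split _ _ _ pi)//; try lra.
rewrite (@segint_split _ _ pi (pi / 2))//; try lra.
rewrite (@segint_split _ pi _ (pi + pi / 2))//; try lra.
congr (_ + _ + (_ + _)).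
- transitivity (segint (pi - pi / 2) (pi - 0) (fun t => G (cos t) (sin t))).
    have -> : pi - pi / 2 = pi / 2 :> R by lra.
    by rewrite subr0.
  rewrite -segint_reflect//; last exact: ltW.
  by apply: eq_segint => t _; rewrite cosB sinB cospi sinpi !mul0r !mulN1r addr0 sub0r opprK.
- transitivity (segint (pi + 0) (pi + pi / 2) (fun t => G (cos t) (sin t))).
    by rewrite addr0.
  rewrite -segint_shift//; last exact: ltW.
  by apply: eq_segint => t _; rewrite cosD sinD cospi sinpi !mul0r !mulN1r add0r subr0.
- transitivity (segint (2 * pi - pi / 2) (2 * pi - 0) (fun t => G (cos t) (sin t))).
    have -> : 2 * pi - pi / 2 = pi + pi / 2 :> R by lra.
    by rewrite subr0.
  rewrite -segint_reflect//; last exact: ltW.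
  apply: eq_segint => t _; rewrite cosB sinB [2 * pi]mulrC mulr_natr cos2pi sin2pi.
  by rewrite !mul0r !mul1r addr0 sub0r.
Qed.

(** The surface integral over the unit sphere, written with the height [z] and
    the azimuth [t]; by Archimedes, the area element is [dz dt]. *)
Definition sphere (Q : R -> R -> R -> R) : R :=
  segint (-1) 1 (fun z => segint 0 (2 * pi) (fun t =>
    Q (Num.sqrt (1 - z ^+ 2) * cos t) (Num.sqrt (1 - z ^+ 2) * sin t) z)).

Implicit Types Q : R -> R -> R -> R.
Let cont3 Q := continuous (fun p : R * R * R => Q p.1.1 p.1.2 p.2).

Lemma cont3_comp Q (T : topologicalType) (f g h : T -> R) : cont3 Q ->
  continuous f -> continuous g -> continuous h ->
  continuous (fun t => Q (f t) (g t) (h t)).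
Proof.
move=> cQ cf cg ch; apply: (@cont_comp _ _ _ (fun p : R * R * R => Q p.1.1 p.1.2 p.2)
  (fun t => (f t, g t, h t)) cQ); cont.
Qed.

(* The coordinates [y] and [z] of [octant] are nonnegative; the octants of the sphere are reached
   by changing signs. *)
Let signs Q x y z : R :=
  Q x y z + Q (- x) y z + (Q (- x) (- y) z + Q x (- y) z).

Lemma sphere_octants Q : cont3 Q ->
  sphere Q = octant (fun y z =>
    signs Q (Num.sqrt (1 - z ^+ 2 - y ^+ 2)) y z +
    signs Q (Num.sqrt (1 - z ^+ 2 - y ^+ 2)) y (- z)).
Proof.
move=> cQ; pose c (z : R) : R := Num.sqrt (1 - z ^+ 2).
pose A (z t : R) : R := signs Q (c z * cos t) (c z * sin t) z.
have cA : continuous (fun p : R * R => A p.1 p.2).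
  by rewrite /A /signs /c; do ![apply: contD]; apply: (cont3_comp cQ); cont.
have cAz (z : R) : continuous (A z) := cont_sec1 A z cA.
pose B (z : R) : R := segint 0 (pi / 2) (A z).
have cB : continuous B := segint_cont 0 (pi / 2) A cA.
transitivity (segint (-1) 1 B).
  apply: eq_segint => z _.
  have cG : continuous (fun p : R * R => Q (c z * p.1) (c z * p.2) z).
    by apply: (cont3_comp cQ); cont.
  rewrite (@segint_quarters (fun a b => Q (c z * a) (c z * b) z) cG).
  by apply: eq_segint => t _; rewrite /A /signs !mulrN.
rewrite (@segint_split _ _ _ 0)//.
transitivity (segint 0 1 (fun z => B z + B (- z))).
  have cBn : continuous (fun z => B (- z)) by apply: (@cont_comp _ _ _ B (fun z => - z)) => //; cont.
  rewrite (segintD 0 1 cB cBn) addrC; congr (_ + _); apply/esym.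
  transitivity (segint 0 1 (fun z => B (0 - z))).
    by apply: eq_segint => z _; rewrite sub0r.
  by rewrite segint_reflect// subr0 sub0r.
apply: eq_segint => z /andP[z0 z1].
rewrite -segintD//; apply: eq_segint => t /andP[t0 tp].
have -> : 1 - z ^+ 2 - (Num.sqrt (1 - z ^+ 2) * sin t) ^+ 2 = (c z * cos t) ^+ 2.
  rewrite !exprMn sqr_sqrtr; last by rewrite subr_ge0 exprn_ile1.
  by rewrite cos2sin2; ring.
rewrite sqrtr_sqr ger0_norm; last first.
  rewrite mulr_ge0 ?sqrtr_ge0//; apply: cos_ge0_pihalf; lra.
by rewrite /A /c sqrrN.
Qed.

(** Exchanging [y] and [z] is not visible in the cylindrical coordinates around the [z]-axis; on
    each octant it is [octant_swap]. *)
Lemma sphere_swap Q : cont3 Q -> sphere (fun x y z => Q x z y) = sphere Q.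
Proof.
move=> cQ.
have cQ' : cont3 (fun x y z => Q x z y).
  by apply: (@cont3_comp Q _ (fun p => p.1.1) (fun p => p.2) (fun p => p.1.2) cQ); cont.
rewrite (sphere_octants cQ) (sphere_octants cQ') -octant_swap; last first.
  by rewrite /signs; do ![apply: contD]; apply: (cont3_comp cQ); cont.
apply: eq_segint => z _; apply: eq_segint => t _.
rewrite /signs; set y := _ * sin t; rewrite [1 - y ^+ 2 - _]addrAC; ring.
Qed.

Lemma sphere_reflect Q c : cont3 Q -> 0 <= c <= 2 * pi ->
  sphere (fun x y z => Q (x * cos c + y * sin c) (x * sin c - y * cos c) z) = sphere Q.
Proof.
move=> cQ c2; apply: eq_segint => z _.
pose F t := Q (Num.sqrt (1 - z ^+ 2) * cos t) (Num.sqrt (1 - z ^+ 2) * sin t) z.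
rewrite -[RHS](@segint_periodic_reflect _ c F)//.
- by apply: eq_segint => t _; rewrite /F cosB sinB; congr (Q _ _ _); ring.
- by apply: (cont3_comp cQ); cont.
- by move=> t; rewrite /F [2 * _]mulrC mulr_natr cosD2pi sinD2pi.
Qed.

(** Self-adjointness of the circle averages: an orthogonal symmetry of the
    sphere exchanges the pole with a point at colatitude [a]. *)
Lemma zonal_exchange (p v : R -> R) (a : R) : continuous p -> continuous v -> 0 <= a <= pi ->
  sphere (fun x y z => p z * v (z * cos a - x * sin a)) =
  sphere (fun x y z => v z * p (z * cos a - x * sin a)).
Proof.
move=> cp cv /andP[a0 api].
have cc (f : R -> R) (T : topologicalType) (g : T -> R) :
    continuous f -> continuous g -> continuous (fun t => f (g t)).
  by move=> cf cg; apply: (@cont_comp _ _ _ f g).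
(* The reflection of the plane of [x] and [z] that exchanges the pole with the point at colatitude
   [a] is a reflection of the plane of [x] and [y], conjugated with the exchange of [y] and [z]. *)
rewrite -sphere_swap; last by apply: contM; apply: cc => //; cont.
rewrite -[RHS]sphere_swap; last by apply: contM; apply: cc => //; cont.
rewrite -(@sphere_reflect _ (pi + a)); last 2 first.
- by apply: contM; apply: cc => //; cont.
- by apply/andP; split; lra.
apply: eq_segint => z _; apply: eq_segint => t _.
set x := _ * cos t; set y := _ * sin t.
rewrite cosD sinD cospi sinpi !mulN1r !mul0r subr0 add0r.
rewrite mulrC; congr (v _ * p _); last by ring.
rewrite -[RHS]mulr1 -(cos2Dsin2 a); ring.
Qed.

End SphereSymmetry.

(** * Even moments of zonal functions *)

Section ZonalMoments.
Context {R : realType}.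
Implicit Types V : R -> R.

Definition moment V n : R := segint (-1) 1 (fun z => V z * (z ^+ 2) ^+ n).

(** When the even moments below [n] vanish, [1 - z^2] may be replaced by [- z^2] in degree [2n]. *)
Lemma moment_beta V n (a b : nat) : continuous V -> (forall j, (j < n)%N -> moment V j = 0) ->
  (a + b <= n)%N ->
  segint (-1) 1 (fun z => V z * ((z ^+ 2) ^+ a * (1 - z ^+ 2) ^+ b)) =
  if (a + b == n)%N then (-1) ^+ b * moment V n else 0.
Proof.
move=> cV m0; elim: b a => [|b IH] a.
  rewrite addn0 => an; transitivity (moment V a).
    by apply: eq_segint => z _; rewrite expr0 mulr1.
  by case: eqP => [->|/eqP na]; [rewrite mul1r|rewrite m0// ltn_neqAle na].
rewrite addnS => abn.
transitivity (segint (-1) 1 (fun z => V z * ((z ^+ 2) ^+ a * (1 - z ^+ 2) ^+ b)) -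
              segint (-1) 1 (fun z => V z * ((z ^+ 2) ^+ a.+1 * (1 - z ^+ 2) ^+ b))).
  rewrite -segintB; [|by cont|by cont].
  by apply: eq_segint => z _; rewrite !exprS; ring.
rewrite IH ?(ltnW abn)// IH ?addSn// (ltn_eqF abn) sub0r.
by case: ifP => _; rewrite ?oppr0// exprS mulN1r mulNr.
Qed.

Definition cos_moment k : R := segint 0 (2 * pi) (fun t => cos t ^+ k).

Lemma cos_moment_odd k : odd k -> cos_moment k = 0.
Proof.
move=> ok; have p0 : 0 <= pi :> R by exact: pi_ge0.
have e : cos_moment k = - cos_moment k.
  rewrite {1}/cos_moment -(@segint_periodic_reflect R pi); last 3 first.
  - by cont.
  - by move=> t; rewrite [2 * pi]mulrC mulr_natr cosD2pi.
  - by apply/andP; split; lra.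
  rewrite -mulN1r /cos_moment -segintZ; last by cont.
  apply: eq_segint => t _.
  by rewrite cosB cospi sinpi mul0r addr0 mulN1r exprNn -signr_odd ok expr1.
by apply/eqP; move/eqP: e; rewrite -addr_eq0 -mulr2n mulrn_eq0.
Qed.

Lemma cos_moment_even_gt0 n : 0 < cos_moment n.*2.
Proof.
have p0 : 0 < pi :> R by exact: pi_gt0.
have ce : continuous (fun t : R => cos t ^+ n.*2) by cont.
have e0 (t : R) : 0 <= cos t ^+ n.*2 by rewrite exprn_even_ge0// odd_double.
rewrite /cos_moment (@segint_split _ _ _ (pi / 4))//; try lra.
apply: ltr_wpDr; first by apply: segint_ge0.
apply: (@lt_le_trans _ _ (segint 0 (pi / 4) (fun _ => cos (pi / 4) ^+ n.*2))).
  rewrite segint_cst; last lra.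
  rewrite mulr_gt0//; last lra.
  rewrite exprn_gt0//; apply: cos_gt0_pihalf; apply/andP; split; lra.
apply: le_segint => //; first exact: contC.
move=> t /andP[t0 tp]; apply: lerXn2r; rewrite ?nnegrE.
- by apply: cos_ge0_pihalf; apply/andP; split; lra.
- by apply: cos_ge0_pihalf; apply/andP; split; lra.
- by rewrite leNgt ltr_cos -?leNgt// in_itv/=; apply/andP; split; lra.
Qed.

(** Up to a positive factor, the Legendre polynomial of degree [2n] at
    colatitude [phi], as a function of [s = sin phi] (Laplace's integral). *)
Definition circle_coeff n (s : R) : R :=
  \sum_(k < n.*2.+1 | ~~ odd k)
    (1 - s ^+ 2) ^+ (n - k./2) * (- s ^+ 2) ^+ k./2 * cos_moment k *+ 'C(n.*2, k).

(** At [s = 1] only the term [k = 2n] remains, an integral of a nonzero even power of [cos]. *)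
Lemma circle_coeff1_neq0 n : circle_coeff n 1 != 0.
Proof.
rewrite /circle_coeff (bigD1 ord_max) ?odd_double//= big1 => [|k /andP[ok kn]].
  rewrite addr0 binn mulr1n doubleK subnn expr0 mul1r expr1n mulf_neq0//.
    by rewrite expf_neq0// oppr_eq0 oner_eq0.
  by rewrite gt_eqF// cos_moment_even_gt0.
have kn' : (k < n.*2)%N by rewrite ltn_neqAle -ltnS ltn_ord andbT.
have kn2 : (k./2 < n)%N by rewrite ltn_half_double.
by rewrite expr1n subrr expr0n subn_eq0 leqNgt kn2 !mul0r mul0rn.
Qed.

(** A rotation of the sphere acts on the even moments by a triangular matrix: expanding the power
    and integrating over the azimuth, only the moment of degree [2n] survives. *)
Lemma zonal_moment V n (a : R) : continuous V -> (forall j, (j < n)%N -> moment V j = 0) ->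
  sphere (fun x y z => V z * (z * cos a - x * sin a) ^+ n.*2) =
  circle_coeff n (sin a) * moment V n.
Proof.
move=> cV m0.
pose c (z : R) : R := Num.sqrt (1 - z ^+ 2).
pose A (k : nat) (z : R) : R := V z * (z * cos a) ^+ (n.*2 - k) * (c z * - sin a) ^+ k *+ 'C(n.*2, k).
have cA k : continuous (A k).
  by rewrite /A /c; cont.
transitivity (segint (-1) 1 (fun z => \sum_(k < n.*2.+1) A k z * cos_moment k)).
  apply: eq_segint => z _.
  transitivity (segint 0 (2 * pi) (fun t => \sum_(k < n.*2.+1) A k z * cos t ^+ k)).
    apply: eq_segint => t _.
    have -> : z * cos a - Num.sqrt (1 - z ^+ 2) * cos t * sin a =
      z * cos a + (c z * - sin a) * cos t by rewrite /c; ring.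
    rewrite exprDn mulr_sumr; apply: eq_bigr => k _.
    by rewrite /A [(_ * cos t) ^+ _]exprMn mulrnAl mulrnAr !mulrA.
  rewrite segint_sum; last by move=> k; cont.
  by apply: eq_bigr => k _; rewrite segintZ//; cont.
rewrite segint_sum; last by move=> k; apply: contM => //; exact: contC.
rewrite (bigID (fun k : 'I__ => odd k))/= big1 ?add0r => [|k ok]; last first.
  rewrite cos_moment_odd// -[RHS](segint0 (-1) 1); apply: eq_segint => z _.
  by rewrite mulr0.
rewrite /circle_coeff mulr_suml; apply: eq_bigr => k ok.
have kE : (k : nat) = k./2.*2 by rewrite -[LHS]odd_double_half (negbTE ok).
set i := k./2 in kE *.
have i_n : (i <= n)%N by rewrite -leq_double -kE -ltnS ltn_ord.
have := @moment_beta V n (n - i) i cV m0; rewrite subnK// eqxx => /(_ (leqnn n)) mb.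
transitivity (segint (-1) 1 (fun z => ((cos a ^+ 2) ^+ (n - i) * (sin a ^+ 2) ^+ i * cos_moment k *+ 'C(n.*2, k)) *
    (V z * ((z ^+ 2) ^+ (n - i) * (1 - z ^+ 2) ^+ i)))).
  apply: eq_segint => z z1.
  rewrite /A; have -> : (n.*2 - k = (n - i).*2)%N by rewrite kE doubleB.
  have cz2 : c z ^+ 2 = 1 - z ^+ 2.
    by rewrite /c sqr_sqrtr// subr_ge0 -real_normK ?num_real// expr_le1// ler_norml.
  have -> : (z * cos a) ^+ (n - i).*2 = (z ^+ 2) ^+ (n - i) * (cos a ^+ 2) ^+ (n - i).
    by rewrite -mul2n [LHS]exprM [(z * cos a) ^+ 2]exprMn [LHS]exprMn.
  have -> : (c z * - sin a) ^+ k = (1 - z ^+ 2) ^+ i * (sin a ^+ 2) ^+ i.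
    by rewrite kE -mul2n [LHS]exprM [(c z * _) ^+ 2]exprMn sqrrN cz2 [LHS]exprMn.
  by rewrite !mulrnAl; congr (_ *+ _); ring.
rewrite segintZ; last by cont.
have -> : (- sin a ^+ 2) ^+ i = (-1) ^+ i * (sin a ^+ 2) ^+ i by rewrite [LHS]exprNn.
by rewrite mb cos2sin2 !mulrnAl; congr (_ *+ _); ring.
Qed.

(** The weights [z^(2n)] concentrate at [z = 1] and [z = -1]: if the even part were positive at
    [1], its contribution near [1] would outgrow the rest geometrically. *)
Lemma moments_eq0 V : continuous V -> (forall n, moment V n = 0) -> V 1 + V (-1) = 0.
Proof.
move=> cV m0.
have key (K : R -> R) : continuous K ->
    (forall n, segint 0 1 (fun z => K z * (z ^+ 2) ^+ n) = 0) -> K 1 <= 0.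
  move=> cK K0; rewrite leNgt; apply/negP => K1.
  have K2 : K 1 / 2 < K 1 by lra.
  have [r [r0 r1 Kr]] : exists r : R, [/\ 0 < r, r < 1 &
      forall z, r <= z <= 1 -> K 1 / 2 <= K z].
    have nK : \forall z \near (1 : R), K 1 / 2 < K z by apply: (cvgr_gt _ (cK 1)).
    have [e /= e0 eK] := (nbhs_ballP _ _).1 nK.
    exists (1 - Num.min (e / 2) (1 / 2)).
    have h1 : Num.min (e / 2) (1 / 2) <= e / 2 by rewrite ge_min lexx.
    have h2 : Num.min (e / 2) (1 / 2) <= 1 / 2 :> R by rewrite ge_min lexx orbT.
    have h3 : 0 < Num.min (e / 2) (1 / 2) by rewrite lt_min divr_gt0//=; lra.
    split; [lra|lra|move=> z /andP[z1 z2]].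
    by apply/ltW/eK; rewrite /ball/= ger0_norm; lra.
  have [M [_ HM]] := compact_bounded (continuous_compact
    (continuous_subspaceT cK) (@segment_compact _ 0 1)).
  pose C := `|M| + 1.
  have C0 : 0 < C by rewrite ltr_wpDl.
  have HC z : 0 <= z <= 1 -> `|K z| <= C.
    move=> hz; apply: HM; first by rewrite /C (le_lt_trans (ler_norm _))// ltrDl.
    by exists z => //=; rewrite in_itv.
  (* Comparing the contributions of [[0, r]] and [[s, 1]]; the one of [[r, s]] is nonnegative. *)
  pose s := (r + 1) / 2.
  have [rs s1] : r < s /\ s < 1 by rewrite /s; split; lra.
  pose d := K 1 / 2 * (1 - s).
  have d0 : 0 < d by rewrite mulr_gt0//; lra.
  have pw (x y : R) n : 0 <= x -> x <= y -> (x ^+ 2) ^+ n <= (y ^+ 2) ^+ n.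
    by move=> x0 xy; rewrite lerXn2r ?nnegrE ?sqr_ge0// lerXn2r ?nnegrE// (le_trans x0).
  have bound n : d <= C * ((r / s) ^+ 2) ^+ n.
    have cKn : continuous (fun z => K z * (z ^+ 2) ^+ n) by cont.
    have := K0 n; rewrite (@segint_split _ _ _ r)//; [|exact: ltW|exact: ltW].
    rewrite (@segint_split _ r _ s)//; [|exact: ltW|exact: ltW].
    have I1 : `|segint 0 r (fun z => K z * (z ^+ 2) ^+ n)| <= C * (r ^+ 2) ^+ n * (r - 0).
      apply: segint_norm_le => //; first exact: ltW.
      move=> z /andP[z0 zr]; rewrite normrM ler_pM//.
        by apply: HC; rewrite z0 (le_trans zr (ltW r1)).
      by rewrite ger0_norm ?exprn_ge0 ?sqr_ge0//; exact: pw.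
    have I2 : 0 <= segint r s (fun z => K z * (z ^+ 2) ^+ n).
      apply: segint_ge0 => z /andP[rz zs]; rewrite mulr_ge0//; last by rewrite exprn_ge0// sqr_ge0.
      by have := Kr z ltac:(apply/andP; split; lra); lra.
    have I3 : K 1 / 2 * (s ^+ 2) ^+ n * (1 - s) <= segint s 1 (fun z => K z * (z ^+ 2) ^+ n).
      rewrite -segint_cst; last exact: ltW.
      apply: le_segint => //; first exact: contC.
      move=> z /andP[sz z1]; rewrite ler_pM//; [lra|by rewrite exprn_ge0// sqr_ge0| |].
        by apply: Kr; apply/andP; split; lra.
      by apply: pw; lra.
    move=> Ksum; have I4 : K 1 / 2 * (s ^+ 2) ^+ n * (1 - s) <= C * (r ^+ 2) ^+ n * (r - 0).
      by move: I1; rewrite ler_norml => /andP[]; lra.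
    have s20 : 0 < (s ^+ 2) ^+ n by rewrite exprn_gt0// exprn_gt0//; lra.
    rewrite expr_div_n expr_div_n mulrA ler_pdivlMr//.
    apply: le_trans (_ : C * (r ^+ 2) ^+ n * (r - 0) <= _).
      by apply: le_trans I4; rewrite /d mulrAC.
    by rewrite subr0 ler_piMr ?(ltW r1)// mulr_ge0 ?(ltW C0)// exprn_ge0// sqr_ge0.
  have x1 : `|(r / s) ^+ 2| < 1.
    have s0 : 0 < s by lra.
    rewrite ger0_norm ?sqr_ge0// expr_lt1//; last by rewrite divr_ge0// ltW.
    by rewrite ltr_pdivrMr// mul1r.
  have lim : C * ((r / s) ^+ 2) ^+ n @[n --> \oo] --> C * 0.
    by apply: cvgM; [exact: cvg_cst|exact: cvg_expr].
  have : d <= C * 0.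
    by apply: (cvgr_to_ge lim); apply: nearW => n; exact: bound.
  by rewrite mulr0 leNgt d0.
pose K z := V z + V (- z).
have cVn : continuous (fun z => V (- z)) by apply: (@cont_comp _ _ _ V (fun z => - z)) => //; cont.
have cK : continuous K by rewrite /K; cont.
have K0 n : segint 0 1 (fun z => K z * (z ^+ 2) ^+ n) = 0.
  have cVz : continuous (fun z => V z * (z ^+ 2) ^+ n) by cont.
  have := m0 n; rewrite /moment (@segint_split _ _ _ 0)//; try lra.
  have -> : segint (-1) 0 (fun z => V z * (z ^+ 2) ^+ n) =
      segint 0 1 (fun z => V (- z) * (z ^+ 2) ^+ n).
    transitivity (segint 0 1 (fun z => V (0 - z) * ((0 - z) ^+ 2) ^+ n)).
      by rewrite (@segint_reflect _ 0 1 0 _ _ cVz) ?subr0 ?sub0r//.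
    by apply: eq_segint => z _; rewrite sub0r sqrrN.
  rewrite -segintD; [|by cont|by cont] => e0; etransitivity; last exact: e0.
  by apply: eq_segint => z _; rewrite /K; ring.
apply/eqP; rewrite eq_le (key _ cK K0)/= -oppr_le0.
apply: (key (fun z => - K z)); first by cont.
move=> n; transitivity (segint 0 1 (fun z => -1 * (K z * (z ^+ 2) ^+ n))).
  by apply: eq_segint => z _; ring.
by rewrite segintZ ?K0 ?mulr0//; cont.
Qed.

End ZonalMoments.

(** * Volterra equations of the first kind *)

Section Volterra.
Context {R : realType}.
Notation mu := (@lebesgue_measure R).

Lemma integrable_oc_sub (a b a' b' : R) (h : R -> R) : a <= a' -> b' <= b ->
  mu.-integrable `]a, b] (EFin \o h) -> mu.-integrable `]a', b'] (EFin \o h).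
Proof.
move=> aa bb; apply: integrableS => //; apply: subset_itv; rewrite bnd_simp//.
Qed.

Lemma Rintegral_oc_split (a x b : R) (h : R -> R) : a <= x -> x <= b ->
  mu.-integrable `]a, b] (EFin \o h) ->
  \int[mu]_(s in `]a, b]) h s = \int[mu]_(s in `]a, x]) h s + \int[mu]_(s in `]x, b]) h s.
Proof.
by move=> ax xb ih; rewrite -(@Rintegral_itvB _ h _ _ x ih) ?bnd_simp// addrC subrK.
Qed.

Lemma integrableB_real (D : set R) (f h : R -> R) : measurable D ->
  mu.-integrable D (EFin \o f) -> mu.-integrable D (EFin \o h) ->
  mu.-integrable D (EFin \o (fun s => f s - h s)).
Proof.
move=> mD jf jh; rewrite (_ : _ \o _ = (fun s => (f s)%:E - (h s)%:E)%E).
  exact: (integrableB (mu := mu) mD jf jh).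
by apply/funext => s; rewrite /= EFinB.
Qed.

(** A Lipschitz bound on the primitive bounds the integrand: this is where
    Lebesgue differentiation enters. *)
Lemma lipschitz_primitive_le (a b K : R) (h : R -> R) : a < b -> 0 <= K ->
  mu.-integrable `]a, b] (EFin \o h) ->
  (forall x y, a <= x -> x <= y -> y <= b ->
     `|\int[mu]_(s in `]x, y]) h s| <= K * (y - x)) ->
  \int[mu]_(s in `]a, b]) `|h s| <= K * (b - a).
Proof.
move=> ab K0 ih Lip.
pose H := h \_ `]a, b]%classic.
have iH : mu.-integrable setT (EFin \o H).
  by rewrite /H -restrict_EFin; apply: (integrable_mkcond _ _).1.
have HE x y : a <= x -> y <= b -> \int[mu]_(s in `]x, y]) H s = \int[mu]_(s in `]x, y]) h s.
  move=> ax yb; apply: eq_Rintegral => s; rewrite inE/= in_itv/= => /andP[xs sy].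
  by rewrite /H patchE mem_set//= in_itv/= (le_lt_trans ax xs) (le_trans sy yb).
pose F (x : R) : R := \int[mu]_(s in `]a, x]) H s.
have FB x y : a <= x -> x <= y -> y <= b -> `|F y - F x| <= K * (y - x).
  move=> ax xy yb; have -> : F y - F x = \int[mu]_(s in `]x, y]) h s.
    rewrite /F (@Rintegral_oc_split a x y)//; last by apply: integrableS iH.
    by rewrite addrC addKr HE.
  exact: Lip.
have FL x y : a <= x <= b -> a <= y <= b -> `|F y - F x| <= K * `|y - x|.
  move=> /andP[ax xb] /andP[ay yb]; have [xy|/ltW yx] := leP x y.
    by rewrite (ger0_norm (_ : 0 <= y - x)) ?subr_ge0// FB.
  by rewrite distrC (distrC y) (ger0_norm (_ : 0 <= x - y)) ?subr_ge0// FB.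
(* The difference quotients of [F] are bounded by [K], and almost everywhere they converge to [H]. *)
have aeH : {ae mu, forall x, `]a, b[%classic x -> `|H x| <= K}.
  have ii : forall y : R, mu.-integrable [set` Interval (BRight a) (BRight y)] (EFin \o H).
    by move=> y; apply: integrableS iH.
  have il : locally_integrable setT H by exact: integrable_locally.
  have := FTC1 ii il; apply: filterS; first exact: (ae_filter_ringOfSetsType mu).
  move=> x /= hx; rewrite in_itv/= => /andP[ax xb].
  have [dF F'] := hx ltac:(by rewrite lte_fin).
  have cF : `|h^-1 *: (F (h *: 1 + x) - F x)| @[h --> 0^'] --> `|H x|.
    by apply: cvg_norm; rewrite -F' derive1E; exact: dF.
  apply: (cvgr_to_le cF).
  near=> e.
  have e0 : e != 0 by near: e; exact: nbhs_dnbhs_neq.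
  have el : `|e| < Num.min (x - a) (b - x).
    near: e; apply: dnbhs0_lt; rewrite lt_min !subr_gt0 ax//.
  move: el; rewrite lt_min => /andP[e1 e2].
  have := ler_norm e; have := ler_norm (- e); rewrite normrN => e3 e4.
  have := @FL x (e *: 1 + x); rewrite -[e *: 1]/(e * 1) mulr1 addrK => fl.
  rewrite normrZ normfV ler_pdivrMl ?normr_gt0// mulrC; apply: fl.
    by rewrite (ltW ax) (ltW xb).
  apply/andP; split; lra.
have ihn : mu.-integrable `]a, b] (EFin \o (fun s => `|h s|)).
  exact: integrable_norm.
rewrite -Rintegral_itv_bndo_bndc; last first.
  by apply: integrableS ihn => //; apply: subset_itvl; rewrite bnd_simp.
have mh : measurable_fun `]a, b[ (fun s => `|h s|%:E).
  have /integrableP[mh _] := ihn.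
  by apply: measurable_funS mh => //; apply: subset_itvl; rewrite bnd_simp.
have intK : (\int[mu]_(s in `]a, b[) K%:E = (K * (b - a))%:E)%E.
  rewrite integral_cst//= EFinM; congr (_ * _)%E.
  by have /= -> := lebesgue_measure_itv `]a, b[; rewrite lte_fin ab EFinB.
have le1 : (\int[mu]_(s in `]a, b[) `|h s|%:E <= (K * (b - a))%:E)%E.
  rewrite -intK; apply: ae_ge0_le_integral => //.
  apply: filterS aeH; first exact: (ae_filter_ringOfSetsType mu).
  move=> x hx abx; have := hx abx.
  rewrite /H patchE mem_set ?lee_fin//.
  by move: abx; rewrite /= !in_itv/= => /andP[-> /ltW].
rewrite /Rintegral -[leRHS]/(fine (K * (b - a))%:E) fine_le//.
by rewrite ge0_fin_numE ?(le_lt_trans le1) ?ltry// integral_ge0.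
Unshelve. all: by end_near. Qed.

Lemma Rintegral_norm_le (D : set R) (f h : R -> R) (k : R) : measurable D ->
  mu.-integrable D (EFin \o f) -> mu.-integrable D (EFin \o h) ->
  (forall s, D s -> `|f s| <= k * `|h s|) ->
  `|\int[mu]_(s in D) f s| <= k * \int[mu]_(s in D) `|h s|.
Proof.
move=> mD jf jh fh; apply: le_trans; first exact: (le_normr_Rintegral (mu := mu) mD jf).
have jn : mu.-integrable D (EFin \o (fun s => `|h s|)) by exact: integrable_norm.
rewrite -RintegralZl//; apply: le_Rintegral => //; first exact: integrable_norm.
rewrite (_ : _ \o _ = (fun s => k%:E * (`|h s|%R)%:E)%E).
  exact: (integrableZl (mu := mu) mD k jn).
by apply/funext => s; rewrite /= EFinM.
Qed.

(** Volterra equations of the first kind have only the zero solution, for an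
    integrable unknown and a kernel that is merely Lipschitz in its first
    variable.  Subtracting the equations at [x] and [y] shows that the primitive
    of [B s s * g s] is Lipschitz with a constant controlled by the L1-norm of
    [g] itself; on short intervals this forces the norm to vanish, and finitely
    many short intervals cover the whole range. *)
Lemma volterra_first_kind (a b : R) (B : R -> R -> R) (g : R -> R) (L c M : R) :
  a < b -> 0 < c -> 0 <= L ->
  mu.-integrable `]a, b] (EFin \o g) ->
  measurable_fun `]a, b] (fun s => B s s) ->
  (forall s, a < s -> s <= b -> c <= `|B s s| <= M) ->
  (forall x, a < x -> x <= b -> mu.-integrable `]a, x] (EFin \o (fun s => B x s * g s))) ->
  (forall s x y, a < s -> s <= x -> x <= y -> y <= b -> `|B y s - B x s| <= L * (y - x)) ->
  (forall x, a < x -> x <= b -> \int[mu]_(s in `]a, x]) (B x s * g s) = 0) ->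
  \int[mu]_(s in `]a, b]) `|g s| = 0.
Proof.
move=> ab c0 L0 ig md cM iB Lip eqB.
pose h s := B s s * g s.
have ih : mu.-integrable `]a, b] (EFin \o h).
  rewrite (_ : _ \o _ = ((EFin \o (fun s => B s s)) \* (EFin \o g))%E); last first.
    by apply/funext => s; rewrite /h /= EFinM.
  apply: integrableMr => //; exists M; split; first exact: num_real.
  move=> y My s /=; rewrite in_itv/= => /andP[as' sb].
  by apply: le_trans (ltW My); have /andP[] := cM s as' sb.
have iab x y : a <= x -> y <= b -> mu.-integrable `]x, y] (EFin \o h).
  by move=> ax yb; apply: integrable_oc_sub ih.
have inab x y : a <= x -> y <= b -> mu.-integrable `]x, y] (EFin \o (fun s => `|h s|)).
  by move=> ax yb; apply: integrable_norm => //; exact: iab.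
have gh s : a < s -> s <= b -> `|g s| <= c^-1 * `|h s|.
  move=> ax sb; have /andP[cs _] := cM s ax sb.
  rewrite -ler_pdivrMl ?invr_gt0// invrK /h normrM; exact: ler_wpM2r.
pose psi x := \int[mu]_(s in `]a, x]) `|h s|.
have psi_split x y : a <= x -> x <= y -> y <= b ->
    psi y = psi x + \int[mu]_(s in `]x, y]) `|h s|.
  by move=> ax xy yb; apply: Rintegral_oc_split => //; apply: inab.
have psi_ge0 x : 0 <= psi x by apply: Rintegral_ge0.
have psi_mono x y : a <= x -> x <= y -> y <= b -> psi x <= psi y.
  by move=> ax xy yb; rewrite (psi_split x y)// lerDl Rintegral_ge0.
have prim x y : a <= x -> x <= y -> y <= b ->
    `|\int[mu]_(s in `]x, y]) h s| <= L / c * psi y * (y - x).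
  move=> ax xy yb.
  have iBs z u v : a <= u -> v <= z -> z <= b -> mu.-integrable `]u, v] (EFin \o (fun s => B z s * g s)).
    move=> au vz zb; have [uv|vu] := ltP u v; last by rewrite set_itv_ge ?bnd_simp -?leNgt//; exact: integrable_set0.
    apply: (@integrable_oc_sub a z) => //; apply: iB; lra.
  have ihB z u v : a <= u -> v <= z -> z <= b ->
      mu.-integrable `]u, v] (EFin \o (fun s => h s - B z s * g s)).
    by move=> au vz zb; apply: integrableB_real => //; [apply: iab; lra|exact: iBs].
  have total z : a <= z -> z <= b ->
      \int[mu]_(s in `]a, z]) h s = \int[mu]_(s in `]a, z]) (h s - B z s * g s).
    rewrite le_eqVlt => /predU1P[<- _|az zb].
      by rewrite !set_itv_ge ?bnd_simp ?ltxx// !Rintegral_set0.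
    by rewrite RintegralB ?eqB ?subr0//; [apply: iab|apply: iBs]; clear -az zb; lra.
  (* The equations at [x] and [y] are subtracted, after splitting the one at [y] at [x]. *)
  have -> : \int[mu]_(s in `]x, y]) h s =
      \int[mu]_(s in `]x, y]) (h s - B y s * g s) +
      \int[mu]_(s in `]a, x]) (B x s * g s - B y s * g s).
    have := Rintegral_oc_split ax xy (iab a y (lexx a) yb).
    rewrite (total y)//; last lra.
    rewrite (Rintegral_oc_split ax xy) ?ihB//.
    rewrite (total x)//; last lra.
    have ya : a <= y by apply: le_trans xy.
    have xb : x <= b by apply: le_trans yb.
    rewrite !RintegralB//; first last; try exact: iab; try exact: iBs.
    by move=> e; rewrite -[LHS](addKr (\int[mu]_(s in `]a, x]) h s - \int[mu]_(s in `]a, x]) (B x s * g s))) -e; ring.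
  have bnd z u v s : a < s -> s <= u -> u <= v -> v <= b -> v - u <= z ->
      `|B u s * g s - B v s * g s| <= L / c * z * `|h s|.
    move=> as' su uv vb vuz; rewrite -mulrBl normrM distrC.
    have -> : L / c * z * `|h s| = L * z * (c^-1 * `|h s|) by ring.
    apply: ler_pM => //; last by apply: gh; lra.
    apply: le_trans (Lip _ _ _ _ _ _ _) _ => //.
    exact: ler_wpM2l.
  have n1 : `|\int[mu]_(s in `]x, y]) (h s - B y s * g s)| <=
      L / c * (y - x) * \int[mu]_(s in `]x, y]) `|h s|.
    apply: Rintegral_norm_le => //; [exact: ihB|exact: iab|].
    move=> s /=; rewrite in_itv/= => /andP[xs sy].
    by apply: bnd; clear -ax xy yb xs sy; lra.
  have n2 : `|\int[mu]_(s in `]a, x]) (B x s * g s - B y s * g s)| <=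
      L / c * (y - x) * psi x.
    apply: Rintegral_norm_le => //; last 2 first.
    - by apply: iab => //; apply: le_trans yb.
    - by move=> s /=; rewrite in_itv/= => /andP[as' sx]; apply: bnd.
    by apply: integrableB_real => //; apply: iBs => //; apply: le_trans yb.
  apply: le_trans (ler_normD _ _) _; rewrite (psi_split x y)//.
  have -> : forall u v w : R, u * (v + w) * (y - x) = u * (y - x) * w + u * (y - x) * v.
    by move=> u v w; ring.
  exact: lerD.
have step x y : a <= x -> x <= y -> y <= b -> L / c * (y - x) <= 1 / 2 ->
    psi x = 0 -> psi y = 0.
  move=> ax xy yb small px; apply/eqP; rewrite eq_le psi_ge0 andbT.
  move: xy; rewrite [x <= y]le_eqVlt => /predU1P[<-|xy]; first by rewrite px.
  have K0 : 0 <= L / c * psi y by rewrite mulr_ge0// divr_ge0// ltW.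
  have := @lipschitz_primitive_le x y (L / c * psi y) h xy K0 (iab _ _ ax yb).
  have -> : \int[mu]_(s in `]x, y]) `|h s| = psi y.
    by rewrite (psi_split x y)// ?px ?add0r// ltW.
  move=> bound; have : psi y <= L / c * psi y * (y - x).
    apply: bound => u v xu uv vy; apply: le_trans (prim u v _ uv _) _; try by clear -ax xu vy yb; lra.
    apply: ler_wpM2r; first by rewrite subr_ge0.
    apply: ler_wpM2l; first by rewrite divr_ge0// ltW.
    by apply: psi_mono => //; clear -ax xu uv; lra.
  rewrite mulrAC; have := ler_wpM2r (psi_ge0 y) small; lra.
(* A length for which the bound of [prim] is at most half of the norm it bounds. *)
pose eta := c / (2 * (L + 1)).
have eta0 : 0 < eta by rewrite divr_gt0// mulr_gt0//; lra.
have etaL : L / c * eta <= 1 / 2.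
  rewrite /eta mulrA divfK ?gt_eqF// ler_pdivrMr; last by rewrite mulr_gt0//; lra.
  lra.
have all_k k : psi (Num.min (a + eta * k%:R) b) = 0.
  elim: k => [|k IH].
    by rewrite mulr0 addr0 min_l ?ltW// /psi set_itv_ge ?bnd_simp ?ltxx// Rintegral_set0.
  have e1 : a + eta * k.+1%:R = a + eta * k%:R + eta by rewrite -natr1; ring.
  have k0 : 0 <= eta * k%:R by rewrite mulr_ge0// ltW.
  apply: step IH.
  - by rewrite le_min (ltW ab) andbT lerDl.
  - by rewrite e1 le_min !ge_min lexx orbT andbT lerDl (ltW eta0).
  - by rewrite ge_min lexx orbT.
  - apply: le_trans etaL; apply: ler_wpM2l; first by rewrite divr_ge0// ltW.
    rewrite e1 lerBlDr; have [h1|h1] := leP (a + eta * k%:R) b.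
      by rewrite ge_min [eta + _]addrC lexx.
    by rewrite ge_min lerDr (ltW eta0) orbT.
have psib : psi b = 0.
  have := all_k (Num.bound ((b - a) / eta)); rewrite min_r// -lerBlDl mulrC -ler_pdivrMr//.
  by apply/ltW/archi_boundP; apply: divr_ge0; rewrite ?subr_ge0 ltW.
apply/eqP; rewrite eq_le; apply/andP; split; last exact: Rintegral_ge0.
have := @Rintegral_norm_le `]a, b] (fun s => `|g s|) h c^-1.
rewrite -/(psi b) psib mulr0 ger0_norm; last exact: Rintegral_ge0.
apply=> //; first exact: integrable_norm.
by move=> s; rewrite /= in_itv/= normr_id => /andP[ax sb]; exact: gh.
Qed.

End Volterra.

(** * Abel's equation *)

Section Abel.
Context {R : realType}.
Notation mu := (@lebesgue_measure R).

(** At a point of continuity the integrand is the derivative of its primitive. *)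
Lemma integral_norm_eq0 (a b x : R) (g : R -> R) : a < x -> x < b ->
  mu.-integrable `]a, b] (EFin \o g) -> {for x, continuous g} ->
  \int[mu]_(s in `]a, b]) `|g s| = 0 -> g x = 0.
Proof.
move=> ax xb ig cg g0.
have ign : mu.-integrable `]a, b] (EFin \o (fun s => `|g s|)) by exact: integrable_norm.
pose F (y : R) : R := \int[mu]_(s in `]a, y]) `|g s|.
have F0 y : a <= y -> y <= b -> F y = 0.
  move=> ay yb; apply/eqP; rewrite eq_le Rintegral_ge0// andbT -g0.
  by rewrite [leRHS](Rintegral_oc_split ay yb ign) lerDl Rintegral_ge0.
have cgn : {for x, continuous (fun s => `|g s|)} by apply: cvg_norm; exact: cg.
have [dF] := @continuous_FTC1 R (fun s => `|g s|) (BRight a) x b xb ign ltac:(by rewrite lte_fin) cgn.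
rewrite derive1E => F'; apply/normr0_eq0; rewrite -F'.
apply: (cvg_lim (@Rhausdorff R)).
have c0 : (fun=> 0 : R) @ (0 : R)^' --> (0 : R) by exact: cvg_cst.
apply: cvg_trans c0; apply: near_eq_cvg; near=> e.
have el : `|e| < Num.min (x - a) (b - x).
  by near: e; apply: dnbhs0_lt; rewrite lt_min !subr_gt0 ax.
move: el; rewrite lt_min => /andP[e1 e2].
have := ler_norm e; have := ler_norm (- e); rewrite normrN => e3 e4.
change (0 = e^-1 *: (F (e * 1 + x) - F x)).
by rewrite mulr1 !F0 ?subrr ?scaler0//; clear -ax xb e1 e2 e3 e4; lra.
Unshelve. all: by end_near. Qed.

Lemma subr_sqr_ge0 (u v : R) : 0 <= u -> u <= v -> 0 <= v ^+ 2 - u ^+ 2.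
Proof. by move=> u0 uv; rewrite subr_ge0 lerXn2r ?nnegrE// (le_trans u0). Qed.

Section AbelKernel.
Variable A : R -> R -> R.
Hypothesis cA : continuous (fun p : R * R => A p.1 p.2).

(** The kernel obtained by applying Abel's transform to an equation with kernel
    [A T s / sqrt (T^2 - s^2)]; the singularities cancel. *)
Definition abel_kernel (x s : R) : R :=
  segint 0 (pi / 2) (fun t => A (Num.sqrt (x ^+ 2 - (x ^+ 2 - s ^+ 2) * sin t ^+ 2)) s).

Lemma abel_kernel_cont : continuous (fun p : R * R => abel_kernel p.1 p.2).
Proof.
apply: (segint_cont 0 (pi / 2) (fun (p : R * R) (t : R) =>
  A (Num.sqrt (p.1 ^+ 2 - (p.1 ^+ 2 - p.2 ^+ 2) * sin t ^+ 2)) p.2)).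
apply: (@cont2 _ _ _ _ A (fun p : R * R * R => Num.sqrt (p.1.1 ^+ 2 - (p.1.1 ^+ 2 - p.1.2 ^+ 2) * sin p.2 ^+ 2))
  (fun p => p.1.2) cA); cont.
Qed.

Lemma abel_kernel_diag s : 0 <= s -> abel_kernel s s = pi / 2 * A s s.
Proof.
move=> s0; rewrite /abel_kernel -[RHS]mulrC -[pi / 2 in RHS]subr0 -segint_cst; last first.
  by rewrite divr_ge0// pi_ge0.
by apply: eq_segint => t _; rewrite subrr mul0r subr0 sqrtr_sqr ger0_norm.
Qed.

(** The square root under the integral lies between [s] and its value for [t = 0], hence in
    [[d2, d1]], where it is a Lipschitz function of [x]. *)
Lemma abel_kernel_lipschitz (d2 d1 L : R) : 0 < d2 -> 0 <= L ->
  (forall s T T', d2 <= s -> s <= T -> T <= T' -> T' <= d1 ->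
     `|A T' s - A T s| <= L * (T' - T)) ->
  forall s x y, d2 < s -> s <= x -> x <= y -> y <= d1 ->
    `|abel_kernel y s - abel_kernel x s| <= L * (d1 / d2) * (pi / 2) * (y - x).
Proof.
move=> d20 L0 Lip s x y d2s sx xy yd1.
have p2 : 0 <= pi / 2 :> R by rewrite divr_ge0// pi_ge0.
have cAt z : continuous (fun t => A (Num.sqrt (z ^+ 2 - (z ^+ 2 - s ^+ 2) * sin t ^+ 2)) s).
  by apply: (@cont2 _ _ _ _ A (fun t : R => Num.sqrt (z ^+ 2 - (z ^+ 2 - s ^+ 2) * sin t ^+ 2)) (fun=> s) cA); cont.
rewrite /abel_kernel -segintB//.
have -> : L * (d1 / d2) * (pi / 2) * (y - x) = L * (d1 / d2 * (y - x)) * (pi / 2 - 0) by ring.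
apply: segint_norm_le => //; first by apply: contD => //; apply: contN.
move=> t _.
have s0 : 0 < s by apply: lt_trans d2s.
have sin2 : 0 <= sin t ^+ 2 <= 1.
  by rewrite sqr_ge0/= -(cos2Dsin2 t) lerDr sqr_ge0.
pose tau (z : R) := Num.sqrt (z ^+ 2 - (z ^+ 2 - s ^+ 2) * sin t ^+ 2).
have arg_ge z : s <= z -> s ^+ 2 <= z ^+ 2 - (z ^+ 2 - s ^+ 2) * sin t ^+ 2.
  move=> sz; have h := subr_sqr_ge0 (ltW s0) sz.
  have /andP[h1 h2] := sin2; have := ler_wpM2l h h2; clear; lra.
have tau_ge z : s <= z -> s <= tau z.
  by move=> sz; rewrite -[leLHS](gtr0_norm s0) -sqrtr_sqr ler_wsqrtr// arg_ge.
have tauE z : s <= z -> tau z ^+ 2 = z ^+ 2 - (z ^+ 2 - s ^+ 2) * sin t ^+ 2.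
  by move=> sz; rewrite sqr_sqrtr// (le_trans (sqr_ge0 s))// arg_ge.
have sy : s <= y by apply: le_trans xy.
have tau_le z : s <= z -> tau z <= z.
  move=> sz; have z0 : 0 <= z by apply: le_trans sz; exact: ltW.
  have h := subr_sqr_ge0 (ltW s0) sz.
  rewrite -[leRHS](ger0_norm z0) -sqrtr_sqr ler_wsqrtr// gerBl mulr_ge0//.
  by have /andP[] := sin2.
have diff : tau y ^+ 2 - tau x ^+ 2 = (y ^+ 2 - x ^+ 2) * (1 - sin t ^+ 2).
  by rewrite !tauE//; ring.
have xy2 := subr_sqr_ge0 (le_trans (ltW s0) sx) xy.
have tau_mono : tau x <= tau y.
  apply: ler_wsqrtr; rewrite -subr_ge0 -tauE// -tauE// diff mulr_ge0//.
apply: le_trans (Lip s (tau x) (tau y) (ltW d2s) (tau_ge _ sx) tau_mono _) _.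
  by apply: le_trans (tau_le _ sy) _.
apply: ler_wpM2l => //.
have bx := tau_ge _ sx; have by' := tau_ge _ sy.
have h1 : (tau y - tau x) * (2 * d2) <= (y - x) * (2 * d1).
  apply: le_trans (_ : (tau y - tau x) * (tau y + tau x) <= _).
    by apply: ler_wpM2l; [rewrite subr_ge0|clear -bx by' d2s; lra].
  have -> : (tau y - tau x) * (tau y + tau x) = tau y ^+ 2 - tau x ^+ 2 by ring.
  rewrite diff; apply: le_trans (_ : y ^+ 2 - x ^+ 2 <= _).
    by rewrite ler_piMr// gerBl; have /andP[] := sin2.
  have -> : y ^+ 2 - x ^+ 2 = (y - x) * (y + x) by ring.
  by apply: ler_wpM2l; [rewrite subr_ge0|clear -xy yd1; lra].
have -> : d1 / d2 * (y - x) = (y - x) * d1 / d2 by ring.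
rewrite ler_pdivlMr//; clear -h1; lra.
Qed.

(** Abel's transform: averaging the equations over [T = x * sqrt (1 - z^2)] and
    exchanging the two axes of the octant turns the singular equation into a
    Volterra equation with the regular kernel [abel_kernel]. *)
Lemma abel_to_volterra (m : R -> R) (x : R) : continuous m -> 0 < x ->
  (forall T, 0 <= T -> T <= x ->
     segint 0 (pi / 2) (fun t => A T (T * sin t) * m (T * sin t)) = 0) ->
  segint 0 x (fun s => abel_kernel x s * m s) = 0.
Proof.
move=> cm x0 eqA.
pose q (y z : R) : R := A (x * Num.sqrt (1 - z ^+ 2)) (x * y) * m (x * y).
have cq : continuous (fun p : R * R => q p.1 p.2).
  apply: contM.
    by apply: (@cont2 _ _ _ _ A (fun p : R * R => x * Num.sqrt (1 - p.2 ^+ 2)) (fun p => x * p.1) cA); cont.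
  by apply: (@cont_comp _ _ _ m (fun p : R * R => x * p.1) cm); cont.
have q0 : octant q = 0.
  rewrite /octant -[RHS](segint0 0 1); apply: eq_segint => z /andP[z0 z1].
  have h : 0 <= Num.sqrt (1 - z ^+ 2) <= 1.
    by rewrite sqrtr_ge0/= -[leRHS]sqrtr1 ler_wsqrtr// gerBl sqr_ge0.
  have /andP[h1 h2] := h.
  rewrite -[RHS](eqA (x * Num.sqrt (1 - z ^+ 2))).
  - by apply: eq_segint => t _; rewrite /q mulrA.
  - by rewrite mulr_ge0// ltW.
  - by rewrite ler_piMr// ltW.
have cB : continuous (fun s => abel_kernel x s * m s).
  by apply: contM => //; exact: (cont_sec1 abel_kernel x abel_kernel_cont).
have sc := segint_scale x0 ler01 cB; rewrite mulr0 mulr1 in sc.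
etransitivity; first exact: (esym sc).
suff -> : segint 0 1 (fun z => abel_kernel x (x * z) * m (x * z)) = octant (fun y z => q z y).
  by rewrite (octant_swap cq) q0 mulr0.
apply: eq_segint => z /andP[z0 z1].
rewrite /abel_kernel -segintZr; last first.
  by apply: (@cont2 _ _ _ _ A (fun t : R => Num.sqrt (x ^+ 2 - (x ^+ 2 - (x * z) ^+ 2) * sin t ^+ 2)) (fun=> x * z) cA); cont.
apply: eq_segint => t _; rewrite /q; congr (A _ _ * _).
have z2 : 0 <= 1 - z ^+ 2 by rewrite subr_ge0 exprn_ile1.
rewrite [(Num.sqrt _ * _) ^+ 2]exprMn sqr_sqrtr//.
have -> : x ^+ 2 - (x ^+ 2 - (x * z) ^+ 2) * sin t ^+ 2 =
  x ^+ 2 * (1 - (1 - z ^+ 2) * sin t ^+ 2) by ring.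
by rewrite sqrtrM ?sqr_ge0// sqrtr_sqr gtr0_norm.
Qed.

(** On the diagonal the Volterra kernel is a positive multiple of [A s s]; its minimum modulus is
    attained on the segment [[d2, b]], where [b] lies between [s] and [d1]. *)
Lemma abel_vanish (d2 d1 L : R) (m : R -> R) : 0 < d2 -> 0 <= L ->
  (forall s T T', d2 <= s -> s <= T -> T <= T' -> T' <= d1 ->
     `|A T' s - A T s| <= L * (T' - T)) ->
  (forall s, d2 <= s -> s <= d1 -> A s s != 0) ->
  continuous m -> (forall s, s <= d2 -> m s = 0) ->
  (forall T, d2 < T -> T < d1 ->
     segint 0 (pi / 2) (fun t => A T (T * sin t) * m (T * sin t)) = 0) ->
  forall s, d2 < s -> s < d1 -> m s = 0.
Proof.
move=> d20 L0 Lip Ad cm m0 eqA s d2s sd1.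
have d10 : 0 < d1 by apply: lt_trans sd1; apply: lt_trans d2s.
have eqA' T : 0 <= T -> T < d1 ->
    segint 0 (pi / 2) (fun t => A T (T * sin t) * m (T * sin t)) = 0.
  move=> T0 Td1; have [Td2|d2T] := leP T d2; last exact: eqA.
  rewrite -[RHS](segint0 0 (pi / 2)); apply: eq_segint => t _.
  by rewrite m0 ?mulr0//; apply: le_trans Td2; rewrite ler_piMr// sin_le1.
pose b := (s + d1) / 2.
have [sb bd1] : s < b /\ b < d1 by rewrite /b; split; clear -sd1; lra.
have d2b : d2 < b by apply: lt_trans sb.
have cK := abel_kernel_cont.
have cKd : continuous (fun s => abel_kernel s s).
  by apply: (@cont2 _ _ _ _ abel_kernel id id cK); cont.
have cKn : continuous (fun s => `|abel_kernel s s|) by cont.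
have [s1 s1in s1min] := EVT_min (ltW d2b) (continuous_subspaceT cKn).
have [s2 s2in s2max] := EVT_max (ltW d2b) (continuous_subspaceT cKn).
have c0 : 0 < `|abel_kernel s1 s1|.
  move: s1in; rewrite in_itv/= => /andP[h1 h2].
  rewrite normr_gt0 abel_kernel_diag; last by apply: le_trans h1; exact: ltW.
  rewrite mulf_neq0//; first by rewrite gt_eqF// divr_gt0// pi_gt0.
  by apply: Ad => //; apply: le_trans (ltW bd1).
have sub_int (F : R -> R) (u v : R) : continuous F -> mu.-integrable `]u, v] (EFin \o F).
  move=> cF; apply: integrableS (segint_integrable u v cF) => //.
  exact: subset_itv_oc_cc.
have := @volterra_first_kind R d2 b abel_kernel m (L * (d1 / d2) * (pi / 2))
  `|abel_kernel s1 s1| `|abel_kernel s2 s2| d2b c0 _ (sub_int _ _ _ cm).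
move=> V; apply: (@integral_norm_eq0 d2 b) => //; [exact: sub_int|exact: cm|].
apply: V.
- by rewrite !mulr_ge0 ?invr_ge0 ?pi_ge0// ltW.
- by apply: measurable_funTS; exact: continuous_measurable_fun.
- move=> u d2u ub; apply/andP; split.
    by apply: s1min; rewrite in_itv/= ub ltW.
  by apply: s2max; rewrite in_itv/= ub ltW.
- move=> x d2x xb; apply: sub_int; apply: contM => //.
  exact: (cont_sec1 abel_kernel x cK).
- move=> u x y d2u ux xy yb; apply: (abel_kernel_lipschitz d20 L0 Lip) => //.
  by apply: le_trans (ltW bd1).
move=> x d2x xb.
have x0 : 0 < x by apply: lt_trans d2x.
have xd1 : x < d1 by apply: le_lt_trans bd1.
have cKm : continuous (fun u => abel_kernel x u * m u).
  by apply: contM => //; exact: (cont_sec1 abel_kernel x cK).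
have := @abel_to_volterra m x cm x0 (fun T T0 Tx => eqA' T T0 (le_lt_trans Tx xd1)).
rewrite (segint_split (ltW d20) (ltW d2x) cKm).
have -> : segint 0 d2 (fun u => abel_kernel x u * m u) = 0.
  rewrite -[RHS](segint0 0 d2); apply: eq_segint => u /andP[_ ud].
  by rewrite m0// mulr0.
rewrite add0r segintE -Rintegral_itv_obnd_cbnd//; exact: sub_int.
Qed.

End AbelKernel.

End Abel.

(** * Polar angles, and the regularity of the zonal coefficients *)

Section PolarAngle.
Context {R : realType}.

Lemma polar_angle (p q r : R) : 0 <= r -> p ^+ 2 + q ^+ 2 = r ^+ 2 ->
  exists c : R, [/\ 0 <= c <= 2 * pi, p = r * cos c & q = r * sin c].
Proof.
move=> r0 pqr; have pi0 : 0 <= pi :> R by exact: pi_ge0.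
have [r1|r1] := eqVneq r 0.
  move: pqr; rewrite r1 expr0n/= => /eqP.
  rewrite paddr_eq0 ?sqr_ge0// !sqrf_eq0 => /andP[/eqP-> /eqP->].
  by exists 0; rewrite !mul0r lexx/=; split => //; rewrite mulr_ge0.
have rp : 0 < r by rewrite lt_def r1.
have pr : -1 <= p / r <= 1.
  rewrite -ler_norml -(@ler_pXn2r _ 2)// ?nnegrE// expr1n real_normK ?num_real//.
  rewrite expr_div_n ler_pdivrMr ?exprn_gt0// mul1r -pqr lerDl; exact: sqr_ge0.
have a0 := acos_ge0 pr; have api := acos_lepi pr.
have ca : cos (acos (p / r)) = p / r by apply: acosK; rewrite in_itv.
have sa : r * sin (acos (p / r)) = `|q|.
  rewrite sin_acos// -[X in X * _](gtr0_norm rp) -[X in X * _]sqrtr_sqr -sqrtrM ?sqr_ge0//.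
  rewrite mulrBr mulr1 expr_div_n mulrCA divff ?mulr1 ?sqrf_eq0//.
  by rewrite -pqr addrC addKr sqrtr_sqr.
have [q0|q0] := leP 0 q.
  exists (acos (p / r)); split.
  - by apply/andP; split=> //; clear -a0 api pi0; lra.
  - by rewrite ca mulrC divfK.
  - by rewrite sa ger0_norm.
exists (2 * pi - acos (p / r)); split.
- by apply/andP; split; clear -a0 api pi0; lra.
- by rewrite cosB [2 * pi]mulrC mulr_natr cos2pi sin2pi mul1r mul0r addr0 ca mulrC divfK.
- rewrite sinB [2 * pi]mulrC mulr_natr cos2pi sin2pi mul0r mul1r sub0r mulrN sa ltr0_norm//.
  by rewrite opprK.
Qed.

End PolarAngle.

Section Lipschitz01.
Context {R : realType}.

(* Products of Lipschitz functions are Lipschitz because the interval is bounded; this covers the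
   polynomials [circle_coeff n]. *)
Let lip (f : R -> R) := exists2 L : R, 0 <= L &
  forall u v, 0 <= u <= 1 -> 0 <= v <= 1 -> `|f u - f v| <= L * `|u - v|.

Let lip_cst c : lip (fun=> c).
Proof. by exists 0 => // u v _ _; rewrite subrr normr0 mul0r. Qed.

Let lip_id : lip id.
Proof. by exists 1 => // u v _ _; rewrite mul1r. Qed.

Let lipD f g : lip f -> lip g -> lip (fun x => f x + g x).
Proof.
move=> [L L0 Lf] [K K0 Kg]; exists (L + K); first exact: addr_ge0.
move=> u v hu hv; have -> : f u + g u - (f v + g v) = (f u - f v) + (g u - g v) by ring.
by rewrite mulrDl; apply: le_trans (ler_normD _ _) _; apply: lerD; [exact: Lf|exact: Kg].
Qed.

Let lip_bounded f : lip f -> exists2 M : R, 0 <= M & forall u, 0 <= u <= 1 -> `|f u| <= M.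
Proof.
move=> [L L0 Lf]; exists (`|f 0| + L); first exact: addr_ge0.
move=> u hu; have -> : f u = f 0 + (f u - f 0) by ring.
apply: le_trans (ler_normD _ _) _; rewrite lerD2l.
apply: le_trans (Lf u 0 hu _) _; first by rewrite lexx ler01.
by rewrite subr0; case/andP: hu => u0 u1; rewrite ler_piMr// ger0_norm.
Qed.

Let lipM f g : lip f -> lip g -> lip (fun x => f x * g x).
Proof.
move=> lf lg; have [M M0 Mf] := lip_bounded lf; have [N N0 Ng] := lip_bounded lg.
move: lf lg => [L L0 Lf] [K K0 Kg]; exists (L * N + M * K); first by rewrite addr_ge0// mulr_ge0.
move=> u v hu hv.
have -> : f u * g u - f v * g v = (f u - f v) * g u + f v * (g u - g v) by ring.
rewrite [leRHS]mulrDl; apply: le_trans (ler_normD _ _) _; rewrite !normrM; apply: lerD.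
  by rewrite mulrAC; apply: ler_pM => //; [exact: Lf|exact: Ng].
by rewrite -mulrA; apply: ler_pM => //; [exact: Mf|exact: Kg].
Qed.

Let lipX f n : lip f -> lip (fun x => f x ^+ n).
Proof.
move=> lf; elim: n => [|n IH]; first exact: lip_cst.
by under eq_fun do rewrite exprS; exact: lipM.
Qed.

Let lip_sum (I : Type) (r : seq I) (P : pred I) (F : I -> R -> R) :
  (forall i, lip (F i)) -> lip (fun t => \sum_(i <- r | P i) F i t).
Proof.
move=> lF; elim: r => [|i r IH].
  by under eq_fun do rewrite big_nil; exact: lip_cst.
under eq_fun do rewrite big_cons.
by case: (P i) => //; apply: lipD.
Qed.

Lemma circle_coeff_lipschitz n : exists2 L : R, 0 <= L &
  forall u v, 0 <= u <= 1 -> 0 <= v <= 1 ->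
    `|circle_coeff n u - circle_coeff n v| <= L * `|u - v|.
Proof.
apply: lip_sum => k; under eq_fun do rewrite -mulr_natr.
apply: lipM (lip_cst _); apply: lipM (lip_cst _); apply: lipM; apply: lipX.
  have l1 : lip (fun x => -1 * x ^+ 2) by apply: lipM (lip_cst _) _; exact: lipX lip_id.
  rewrite (_ : (fun x => _) = (fun x => 1 + -1 * x ^+ 2)); first exact: lipD.
  by apply/funext => x; rewrite mulN1r.
have l1 : lip (fun x => -1 * x ^+ 2) by apply: lipM (lip_cst _) _; exact: lipX lip_id.
by rewrite (_ : (fun x => _) = (fun x => -1 * x ^+ 2))//; apply/funext => x; rewrite mulN1r.
Qed.

Lemma circle_coeff_bounded n : exists2 M : R, 0 <= M &
  forall u, 0 <= u <= 1 -> `|circle_coeff n u| <= M.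
Proof. exact: lip_bounded (circle_coeff_lipschitz n). Qed.

Lemma circle_coeff_cont n (T : topologicalType) (f : T -> R) : continuous f ->
  continuous (fun t => circle_coeff n (f t)).
Proof. by move=> cf; rewrite /circle_coeff; apply: cont_sum => k; cont. Qed.

End Lipschitz01.

(** * Weighted circle integrals determine the even part along an axis *)

Section Core.
Context {R : realType}.
Variables (d2 d1 : R) (V : R -> R -> R -> R -> R) (W0 W1 : R -> R -> R) (L M : R).
Hypothesis (d20 : 0 < d2).
Hypothesis cV : continuous (fun p : R * R * R * R => V p.1.1.1 p.1.1.2 p.1.2 p.2).
Hypothesis V0 : forall s x y z, s <= d2 \/ d1 <= s -> x ^+ 2 + y ^+ 2 + z ^+ 2 = 1 -> V s x y z = 0.
Hypothesis (cW0 : continuous (fun p : R * R => W0 p.1 p.2)).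
Hypothesis (cW1 : continuous (fun p : R * R => W1 p.1 p.2)).
Hypothesis (L0 : 0 <= L) (M0 : 0 <= M).

(* [W y s] is only controlled for [s <= y], that is on the triangle of the weights. *)
Let regular (W : R -> R -> R) :=
  (forall s x y, d2 <= s -> s <= x -> x <= y -> y <= d1 -> `|W y s - W x s| <= L * (y - x)) /\
  (forall s x, d2 <= s -> s <= x -> x <= d1 -> `|W x s| <= M).

Hypothesis (rW0 : regular W0) (rW1 : regular W1).
Hypothesis Wdiag : forall s, d2 <= s -> s <= d1 -> W1 s s = W0 s s /\ W0 s s != 0.

Let c (z : R) : R := Num.sqrt (1 - z ^+ 2).

(** [circle_point F z a t] evaluates [F] at the point of the circle of angular
    radius [a] around the unit vector of height [z] and azimuth [0]. *)
Definition circle_point (F : R -> R -> R -> R) (z a t : R) : R :=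
  F (z * (sin a * cos t) + c z * cos a) (sin a * sin t) (z * cos a - c z * (sin a * cos t)).

Definition turn (al : R) (F : R -> R -> R -> R) (x y z : R) : R :=
  F (cos al * x - sin al * y) (sin al * x + cos al * y) z.

Hypothesis circles : forall T al z, d2 < T -> T < d1 -> 0 <= al <= 2 * pi -> -1 <= z <= 1 ->
  segint 0 (2 * pi) (fun t => segint 0 (pi / 2) (fun a =>
    W0 T (T * sin a) * circle_point (turn al (V (T * sin a))) z a t +
    W1 T (T * sin a) * circle_point (turn al (V (T * sin a))) z (pi - a) t)) = 0.

Lemma cont4 (T : topologicalType) (f g h k : T -> R) :
  continuous f -> continuous g -> continuous h -> continuous k ->
  continuous (fun t => V (f t) (g t) (h t) (k t)).
Proof.
move=> cf cg ch ck.
apply: (@cont_comp _ _ _ (fun p : R * R * R * R => V p.1.1.1 p.1.1.2 p.1.2 p.2)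
  (fun t => (f t, g t, h t, k t)) cV); cont.
Qed.

(** The average of [V s] over the parallel at height [z], up to the factor [1 / (2 pi)]. *)
Definition zonal (s z : R) : R :=
  segint 0 (2 * pi) (fun al => V s (c z * cos al) (c z * sin al) z).

Lemma zonal_cont : continuous (fun p : R * R => zonal p.1 p.2).
Proof.
apply: (segint_cont 0 (2 * pi) (fun (p : R * R) (al : R) =>
  V p.1 (c p.2 * cos al) (c p.2 * sin al) p.2)).
by apply: cont4; rewrite /c; cont.
Qed.

Lemma zonal_comp (T : topologicalType) (f g : T -> R) : continuous f -> continuous g ->
  continuous (fun t => zonal (f t) (g t)).
Proof. by move=> cf cg; exact: (cont2 zonal_cont cf cg). Qed.

(** The average only depends on the height, since the azimuth is absorbed by a shift of the angle. *)
Lemma turn_average (s x y z : R) : x ^+ 2 + y ^+ 2 + z ^+ 2 = 1 ->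
  segint 0 (2 * pi) (fun al => turn al (V s) x y z) = zonal s z.
Proof.
move=> xyz; have cz2 : c z ^+ 2 = 1 - z ^+ 2.
  by rewrite sqr_sqrtr// -xyz addrK addr_ge0// sqr_ge0.
have [|g [g2 -> ->]] := @polar_angle R x y (c z) (sqrtr_ge0 _).
  by rewrite cz2 -xyz addrK.
pose F (al : R) := V s (c z * cos al) (c z * sin al) z.
have cF : continuous F by apply: cont4; cont.
have pF al : F (al + 2 * pi) = F al.
  by rewrite /F [2 * pi]mulrC mulr_natr cosD2pi sinD2pi.
rewrite -[RHS](segint_periodic_shift cF pF g2).
by apply: eq_segint => al _; rewrite /turn /F cosD sinD; congr V; ring.
Qed.

Lemma circle_average (s z a t : R) : -1 <= z <= 1 ->
  segint 0 (2 * pi) (fun al => circle_point (turn al (V s)) z a t) =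
  zonal s (z * cos a - c z * (sin a * cos t)).
Proof.
move=> z1; rewrite -(@turn_average s (z * (sin a * cos t) + c z * cos a) (sin a * sin t))//.
have cz2 : c z ^+ 2 = 1 - z ^+ 2.
  by rewrite sqr_sqrtr// subr_ge0 -real_normK ?num_real// expr_le1// ler_norml.
transitivity ((z ^+ 2 + c z ^+ 2) * (cos a ^+ 2 + sin a ^+ 2 * cos t ^+ 2) + sin a ^+ 2 * sin t ^+ 2); first by ring.
by rewrite cz2 (cos2sin2 a) (cos2sin2 t); ring.
Qed.

(** The equations for the turned functions are averaged over the angle [al]. *)
Lemma averaged_circles T z : d2 < T -> T < d1 -> -1 <= z <= 1 ->
  segint 0 (2 * pi) (fun t => segint 0 (pi / 2) (fun a =>
    W0 T (T * sin a) * zonal (T * sin a) (z * cos a - c z * (sin a * cos t)) +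
    W1 T (T * sin a) * zonal (T * sin a) (z * cos (pi - a) - c z * (sin (pi - a) * cos t)))) = 0.
Proof.
move=> d2T Td1 z1.
pose F (al t a : R) : R :=
  W0 T (T * sin a) * circle_point (turn al (V (T * sin a))) z a t +
  W1 T (T * sin a) * circle_point (turn al (V (T * sin a))) z (pi - a) t.
have cWT (W : R -> R -> R) (S : topologicalType) (f : S -> R) :
    continuous (fun p : R * R => W p.1 p.2) -> continuous f -> continuous (fun x => W T (f x)).
  by move=> cW cf; exact: (cont2 cW (contC T) cf).
have cF (S : topologicalType) (f g h : S -> R) : continuous f -> continuous g -> continuous h ->
    continuous (fun x => F (f x) (g x) (h x)).
  move=> cf cg ch; rewrite /F /circle_point /turn; apply: contD; apply: contM.
  - by apply: cWT => //; cont.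
  - by apply: cont4; cont.
  - by apply: cWT => //; cont.
  - by apply: cont4; cont.
transitivity (segint 0 (2 * pi) (fun t => segint 0 (2 * pi) (fun al =>
    segint 0 (pi / 2) (fun a => F al t a)))); last first.
  have c2 : continuous (fun p : R * R => segint 0 (pi / 2) (fun a => F p.2 p.1 a)).
    by apply: (segint_cont 0 (pi / 2) (fun (p : R * R) a => F p.2 p.1 a)); apply: cF; cont.
  rewrite (segint_swap _ _ _ _ (F := fun t al => segint 0 (pi / 2) (fun a => F al t a)) c2).
  rewrite -[RHS](segint0 0 (2 * pi)); apply: eq_segint => al al2; exact: circles.
apply: eq_segint => t _.
rewrite (segint_swap _ _ _ _ (F := fun al a => F al t a)); last by apply: cF; cont.
apply: eq_segint => a _; rewrite /F segintD; last 2 first.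
- by apply: contM; [exact: contC|rewrite /circle_point /turn; apply: cont4; cont].
- by apply: contM; [exact: contC|rewrite /circle_point /turn; apply: cont4; cont].
rewrite !segintZ; last 2 first.
- by rewrite /circle_point /turn; apply: cont4; cont.
- by rewrite /circle_point /turn; apply: cont4; cont.
by rewrite !circle_average.
Qed.

(** The averaged equations are tested against [z^(2n)].  By [zonal_exchange] the circle integral
    moves from [zonal] to the power, where [zonal_moment] evaluates it; the circles of angular radii
    [a] and [pi - a] give the same coefficient, so that the two weights add up. *)
Lemma moment_equation n T : d2 < T -> T < d1 ->
  (forall j, (j < n)%N -> forall s, moment (zonal s) j = 0) ->
  segint 0 (pi / 2) (fun a => (W0 T (T * sin a) + W1 T (T * sin a)) *
    circle_coeff n (sin a) * moment (zonal (T * sin a)) n) = 0.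
Proof.
move=> d2T Td1 m0.
pose D (z t a : R) : R :=
  W0 T (T * sin a) * zonal (T * sin a) (z * cos a - c z * (sin a * cos t)) +
  W1 T (T * sin a) * zonal (T * sin a) (z * cos (pi - a) - c z * (sin (pi - a) * cos t)).
pose G (z t a : R) : R := (z ^+ 2) ^+ n * D z t a.
have cWT (W : R -> R -> R) (S : topologicalType) (f : S -> R) :
    continuous (fun p : R * R => W p.1 p.2) -> continuous f -> continuous (fun x => W T (f x)).
  by move=> cW cf; exact: (cont2 cW (contC T) cf).
have cD (S : topologicalType) (f g h : S -> R) : continuous f -> continuous g -> continuous h ->
    continuous (fun x => D (f x) (g x) (h x)).
  move=> cf cg ch; rewrite /D /c; apply: contD; apply: contM.
  - by apply: cWT => //; cont.
  - by apply: zonal_comp; cont.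
  - by apply: cWT => //; cont.
  - by apply: zonal_comp; cont.
have cG (S : topologicalType) (f g h : S -> R) : continuous f -> continuous g -> continuous h ->
    continuous (fun x => G (f x) (g x) (h x)).
  by move=> cf cg ch; rewrite /G; apply: contM; [cont|exact: cD].
have tot : segint (-1) 1 (fun z => segint 0 (2 * pi) (fun t => segint 0 (pi / 2) (fun a => G z t a))) = 0.
  rewrite -[RHS](segint0 (-1) 1); apply: eq_segint => z z1.
  transitivity ((z ^+ 2) ^+ n * segint 0 (2 * pi) (fun t => segint 0 (pi / 2) (fun a => D z t a))); last first.
    by rewrite (averaged_circles d2T Td1 z1) mulr0.
  rewrite -segintZ; last first.
    by apply: (segint_cont 0 (pi / 2) (fun t a : R => D z t a)); apply: cD; cont.
  by apply: eq_segint => t _; rewrite -segintZ//; apply: cD; cont.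
rewrite -[RHS]tot.
transitivity (segint (-1) 1 (fun z => segint 0 (pi / 2) (fun a => segint 0 (2 * pi) (fun t => G z t a)))); last first.
  apply: eq_segint => z _; rewrite (segint_swap _ _ _ _ (F := fun a t => G z t a))//.
  by apply: cG; cont.
rewrite (segint_swap _ _ _ _ (F := fun z a => segint 0 (2 * pi) (fun t => G z t a))); last first.
  by apply: (segint_cont 0 (2 * pi) (fun (p : R * R) t => G p.1 t p.2)); apply: cG; cont.
apply: eq_segint => a /andP[a0 ap].
have cz s : continuous (zonal s) by apply: (@zonal_comp _ (fun=> s) id); cont.
have sph b : 0 <= b <= pi -> sin b = sin a ->
   segint (-1) 1 (fun z => segint 0 (2 * pi) (fun t =>
     (z ^+ 2) ^+ n * zonal (T * sin a) (z * cos b - c z * (sin b * cos t)))) =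
   circle_coeff n (sin a) * moment (zonal (T * sin a)) n.
  move=> bpi sb.
  have cp : continuous (fun z : R => z ^+ n.*2) by cont.
  have := @zonal_exchange R (fun z => z ^+ n.*2) (zonal (T * sin a)) b cp (cz _) bpi.
  rewrite zonal_moment// ?sb; last by move=> j jn; exact: m0.
  move=> <-; apply: eq_segint => z _; apply: eq_segint => t _.
  by rewrite -mul2n exprM; congr (_ * zonal _ _); rewrite /c; ring.
have pi0 : 0 < pi :> R by exact: pi_gt0.
have e1 := sph a ltac:(by apply/andP; split; lra) erefl.
have e2 : sin (pi - a) = sin a by rewrite sinB sinpi cospi mul0r mulN1r sub0r opprK.
have {}e2 := sph (pi - a) ltac:(by apply/andP; split; lra) e2.
have cI b : continuous (fun p : R * R => (p.1 ^+ 2) ^+ n * zonal (T * sin a) (p.1 * cos b - c p.1 * (sin b * cos p.2))).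
  by rewrite /c; apply: contM; [|apply: zonal_comp]; cont.
have cIz b z := cont_sec1 (fun z t : R => (z ^+ 2) ^+ n * zonal (T * sin a) (z * cos b - c z * (sin b * cos t))) z (cI b).
have cIt b := segint_cont 0 (2 * pi) (fun z t : R => (z ^+ 2) ^+ n * zonal (T * sin a) (z * cos b - c z * (sin b * cos t))) (cI b).
rewrite -mulrA mulrDl -{1}e1 -e2 -!segintZ//.
rewrite -segintD; last 2 first.
- by apply: contM => //; exact: contC.
- by apply: contM => //; exact: contC.
apply: eq_segint => z _.
rewrite -!segintZ//.
rewrite -segintD; last 2 first.
- by apply: contM => //; exact: contC.
- by apply: contM => //; exact: contC.
by apply: eq_segint => t _; rewrite /G /D; ring.
Qed.

Lemma zonal_out s z : s <= d2 \/ d1 <= s -> -1 <= z <= 1 -> zonal s z = 0.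
Proof.
move=> so z1; rewrite -[RHS](segint0 0 (2 * pi)); apply: eq_segint => t _.
apply: V0 => //; rewrite !exprMn -mulrDr cos2Dsin2 mulr1 sqr_sqrtr ?subrK//.
by rewrite subr_ge0 -real_normK ?num_real// expr_le1// ler_norml.
Qed.

Lemma moment_zonal_cont n : continuous (fun s => moment (zonal s) n).
Proof.
apply: (segint_cont (-1) 1 (fun s z => zonal s z * (z ^+ 2) ^+ n)).
by apply: contM; [apply: zonal_comp|]; cont.
Qed.

(** By induction on [n], the moment satisfies an Abel equation whose coefficient does not vanish on
    the diagonal: there both weights agree, and [sin a = 1]. *)
Lemma zonal_moments_eq0 n s : moment (zonal s) n = 0.
Proof.
elim/ltn_ind: n s => n IH s.
have out u : u <= d2 \/ d1 <= u -> moment (zonal u) n = 0.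
  move=> uo; rewrite -[RHS](segint0 (-1) 1); apply: eq_segint => z z1.
  by rewrite zonal_out// mul0r.
have [sd2|d2s] := leP s d2; first by apply: out; left.
have [d1s|sd1] := leP d1 s; first by apply: out; right.
have [P P0 Plip] := @circle_coeff_lipschitz R n.
have [N N0 Nb] := @circle_coeff_bounded R n.
(* On the region of interest [u / Num.max T d2] is [sin a]; the maximum keeps [A] continuous
   for small [T]. *)
pose A (T u : R) : R := (W0 T u + W1 T u) * circle_coeff n (u / Num.max T d2).
have max_gt0 T : 0 < Num.max T d2 by rewrite lt_max d20 orbT.
have cA : continuous (fun p : R * R => A p.1 p.2).
  apply: contM; first by cont.
  apply: circle_coeff_cont; apply: contM; first by cont.
  by apply: contV; [move=> t; rewrite gt_eqF|cont].
pose K := (L + L) * N + (M + M) * (P * d2^-1).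
have K0 : 0 <= K by rewrite addr_ge0// mulr_ge0// ?addr_ge0// mulr_ge0// invr_ge0 ltW.
apply: (@abel_vanish R A cA d2 d1 K (fun u => moment (zonal u) n) d20 K0) => //.
- move=> u T T' d2u uT TT' T'd1.
  have u0 : 0 < u by apply: lt_le_trans d2u.
  have T0 : 0 < T by apply: lt_le_trans uT.
  have T'0 : 0 < T' by apply: lt_le_trans TT'.
  have uT' : u <= T' by apply: le_trans TT'.
  have Td1 : T <= d1 by apply: le_trans T'd1.
  rewrite /A (max_l (le_trans d2u uT)) (max_l (le_trans d2u uT')).
  have q1 x : u <= x -> 0 <= u / x <= 1.
    move=> ux; have x0 : 0 < x by apply: lt_le_trans ux.
    by rewrite divr_ge0 ?(ltW u0) ?(ltW x0)//= ler_pdivrMr// mul1r.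
  set a' := W0 T' u + W1 T' u; set a := W0 T u + W1 T u.
  set b' := circle_coeff n (u / T'); set b := circle_coeff n (u / T).
  have ha : `|a' - a| <= (L + L) * (T' - T).
    have -> : a' - a = (W0 T' u - W0 T u) + (W1 T' u - W1 T u) by rewrite /a /a'; ring.
    rewrite mulrDl; apply: le_trans (ler_normD _ _) _; apply: lerD.
      exact: rW0.1.
    exact: rW1.1.
  have ha2 : `|a| <= M + M.
    by apply: le_trans (ler_normD _ _) _; apply: lerD; [exact: rW0.2|exact: rW1.2].
  have hb : `|b' - b| <= P * d2^-1 * (T' - T).
    apply: le_trans (Plip _ _ (q1 _ uT') (q1 _ uT)) _.
    rewrite -mulrA; apply: ler_wpM2l => //.
    have -> : u / T' - u / T = - ((u / T) * ((T' - T) / T')) by field; rewrite !gt_eqF.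
    have TT0 : 0 <= (T' - T) / T' by rewrite divr_ge0 ?subr_ge0// ltW.
    have /andP[q2 q3] := q1 _ uT.
    rewrite normrN (ger0_norm (mulr_ge0 q2 TT0)).
    apply: (@le_trans _ _ ((T' - T) / T')); first by rewrite ler_piMl.
    rewrite mulrC ler_wpM2r ?subr_ge0// lef_pV2 ?posrE//; exact: le_trans uT'.
  have -> : a' * b' - a * b = (a' - a) * b' + a * (b' - b) by ring.
  apply: le_trans (ler_normD _ _) _; rewrite !normrM /K mulrDl; apply: lerD.
    by rewrite mulrAC; apply: ler_pM => //; exact: Nb (q1 _ uT').
  by rewrite -mulrA; apply: ler_pM.
- move=> u d2u ud1; rewrite /A max_l// divff; last by rewrite gt_eqF// (lt_le_trans d20).
  have [-> W0n] := Wdiag d2u ud1.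
  by rewrite mulf_neq0 ?circle_coeff1_neq0// -mulr2n mulrn_eq0 negb_or.
- exact: moment_zonal_cont.
- by move=> u ud2; apply: out; left.
move=> T d2T Td1; rewrite -[RHS](@moment_equation n T)//.
apply: eq_segint => a _; rewrite /A (max_l (ltW d2T)) [T * sin a / T]mulrAC divff ?mul1r//.
by rewrite gt_eqF// (lt_trans d20).
Qed.

(** At the poles the parallels degenerate to points, so that [zonal] is a multiple of [V]. *)
Lemma axis_even_part_eq0 s : V s 0 0 1 + V s 0 0 (-1) = 0.
Proof.
have czs : continuous (zonal s) by apply: (@zonal_comp _ (fun=> s) id); cont.
have := moments_eq0 czs (fun n => zonal_moments_eq0 n s).
have pole z : z ^+ 2 = 1 -> zonal s z = 2 * pi * V s 0 0 z.
  move=> z2; rewrite /zonal /c z2 subrr sqrtr0.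
  have -> : (fun al : R => V s (0 * cos al) (0 * sin al) z) = (fun=> V s 0 0 z).
    by apply/funext => al; rewrite !mul0r.
  have pi2 : 0 <= 2 * pi :> R by apply: mulr_ge0 => //; exact: pi_ge0.
  by rewrite (segint_cst (V s 0 0 z) pi2) subr0 mulrC.
have pi2 : 2 * pi != 0 :> R by rewrite mulf_neq0// gt_eqF// pi_gt0.
rewrite (pole 1 (expr1n _ 2)) (pole (-1)); last by rewrite sqrrN expr1n.
by rewrite -mulrDr => /eqP; rewrite mulf_eq0 (negbTE pi2) => /eqP.
Qed.

End Core.

(** * Homogeneity of the integral *)

Section IntegralScale.
Context d (T : measurableType d) (R : realType) (mu : {measure set T -> \bar R}).
Import HBNNSimple.
Local Open Scope ereal_scope.

Let scale_le (c : R) (f : T -> \bar R) : (0 < c)%R -> (forall x, 0 <= f x) ->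
  c%:E * \int[mu]_x f x <= \int[mu]_x (c%:E * f x).
Proof.
move=> c0 f0; have cf0 x : 0 <= c%:E * f x by rewrite mule_ge0// lee_fin ltW.
rewrite !ge0_integralTE// -lee_pdivlMl//.
apply: ge_ereal_sup => _ [h /= hf <-]; rewrite lee_pdivlMl// -sintegralrM.
apply: ereal_sup_ubound; exists (scale_nnsfun h (ltW c0)) => //= x.
by rewrite EFinM lee_pmul2l// lte_fin.
Qed.

(** The integral of a nonnegative function is a supremum over the simple functions below it, and
    these can be rescaled; the converse inequality is the same one for [c^-1]. *)
Lemma ge0_integral_scale (c : R) (D : set T) (f : T -> \bar R) : (0 < c)%R ->
  (forall x, 0 <= f x) ->
  \int[mu]_(x in D) (c%:E * f x) = c%:E * \int[mu]_(x in D) f x.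
Proof.
move=> c0 f0; have ci0 : (0 < c^-1)%R by rewrite invr_gt0.
have g0 x : 0 <= (f \_ D) x by apply: erestrict_ge0.
rewrite integral_mkcond [in RHS]integral_mkcond.
have -> : (fun x => c%:E * f x) \_ D = (fun x => c%:E * (f \_ D) x).
  by apply/funext => x; rewrite !patchE; case: ifP => // _; rewrite mule0.
apply/eqP; rewrite eq_le scale_le// andbT.
rewrite -lee_pdivrMl//; apply: le_trans (scale_le ci0 _) _.
  by move=> x; rewrite mule_ge0// lee_fin ltW.
rewrite le_eqVlt; apply/orP; left; apply/eqP; apply: eq_integral => x _.
by rewrite muleA -EFinM mulVf ?gt_eqF// mul1e.
Qed.

(** An identity between total functions: it also covers integrands that have no integral, where
    both sides take the default value.  This allows a factor to be taken out of the inner integrals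
    of the transform at every value of the outer variable. *)
Lemma Rintegral_scale (c : R) (D : set T) (f : T -> R) :
  (\int[mu]_(x in D) (c * f x) = c * \int[mu]_(x in D) f x)%R.
Proof.
have [->|c0] := eqVneq c 0%R.
  rewrite mul0r -[RHS](mul0r (fine (mu D))) /Rintegral.
  by rewrite integral0_eq ?mul0r// => x _; rewrite mul0r.
rewrite /Rintegral integralE [in RHS]integralE.
set P := \int[mu]_(x in D) ((fun x => (f x)%:E) ^\+ x); set N := \int[mu]_(x in D) ((fun x => (f x)%:E) ^\- x).
have P0 : 0 <= P by apply: integral_ge0.
have N0 : 0 <= N by apply: integral_ge0.
have -> : (fun x => (c * f x)%:E) = (fun x => c%:E * (f x)%:E).
  by apply/funext => x; rewrite EFinM.
have [cp|cn] : ((0 < c) \/ (0 < - c))%R.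
  by rewrite oppr_gt0; move: c0; rewrite neq_lt => /orP[]; [right|left].
- rewrite ge0_funeposM ?ltW// ge0_funenegM ?ltW// !ge0_integral_scale// -/P -/N.
  case: (P) P0 => [p| |]// _; case: (N) N0 => [n| |]// _.
  - by rewrite /= -mulrBr.
  - by rewrite /= mulr_infty gtr0_sg// mul1e/= mulr0.
  - by rewrite /= mulr_infty gtr0_sg// mul1e/= mulr0.
  - by rewrite /= mulr_infty gtr0_sg// mul1e/= mulr0.
have cn' : (c <= 0)%R by rewrite -oppr_ge0 ltW.
rewrite le0_funeposM// le0_funenegM// -EFinN !ge0_integral_scale// -/P -/N.
case: (P) P0 => [p| |]// _; case: (N) N0 => [n| |]// _.
- by rewrite /= !mulNr opprK mulrBr addrC.
- by rewrite /= mulr_infty gtr0_sg// mul1e/= mulr0.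
- by rewrite /= mulr_infty gtr0_sg// mul1e/= mulr0.
- by rewrite /= mulr_infty gtr0_sg// mul1e/= mulr0.
Qed.

End IntegralScale.
(** * One-sided derivatives at the endpoints of an interval *)

Section WithinDerivative.
Context {R : realType}.
Implicit Types (A : set R) (v : R -> R).

Lemma within_derive_dist A v x l e : is_derive_within A v x l -> 0 < e ->
  exists2 r : R, 0 < r & forall y, A y -> y != x -> `|y - x| < r ->
    `|l - (y - x)^-1 * (v y - v x)| < e.
Proof.
move=> /cvgrPdist_lt /(_ e) H e0; have := H e0.
rewrite !near_withinE => -[r /= r0 Hr]; exists r => // y Ay yx yr.
by apply: Hr => //=; rewrite distrC.
Qed.

Lemma within_derive_is_derive A v x l : nbhs x A -> is_derive_within A v x l ->
  is_derive x 1 v l.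
Proof.
move=> [r0 /= r00 Hr0] dv.
have D : h^-1 *: (v (h *: 1 + x) - v x) @[h --> 0^'] --> l.
  apply/cvgrPdist_lt => e e0; have [r rp Hr] := within_derive_dist dv e0.
  rewrite near_withinE; exists (Num.min r r0); first by rewrite /= lt_min rp.
  move=> h; rewrite /= sub0r normrN lt_min => /andP[hr hr0] h0.
  have hE : h *: 1 + x - x = h by rewrite addrK; exact: mulr1.
  have -> : h^-1 *: (v (h *: 1 + x) - v x) =
    (h *: 1 + x - x)^-1 * (v (h *: 1 + x) - v x) by rewrite hE.
  apply: Hr; rewrite ?hE//.
    by apply: Hr0; rewrite /= distrC hE.
  by rewrite -subr_eq0 hE.
by apply: DeriveDef; [apply/cvg_ex; exists l|exact: cvg_lim].
Qed.

Lemma within_derive_cvg A v x l e : is_derive_within A v x l -> 0 < e ->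
  exists2 r : R, 0 < r & forall y, A y -> `|y - x| < r -> `|v x - v y| < e.
Proof.
move=> dv e0; have [r r0 Hr] := within_derive_dist dv (@ltr01 R).
have l1 : 0 < `|l| + 1 by rewrite ltr_wpDl.
exists (Num.min r (e / (`|l| + 1))); first by rewrite lt_min r0 divr_gt0.
move=> y Ay; rewrite lt_min => /andP[yr ye].
have [->|yx] := eqVneq y x; first by rewrite subrr normr0.
have yx0 : y - x != 0 by rewrite subr_eq0.
set q := (y - x)^-1 * (v y - v x).
have vE : v x - v y = - ((y - x) * q) by rewrite /q mulrA divff// mul1r opprB.
have ql : `|q| <= `|l| + 1.
  have -> : q = l - (l - q) by rewrite opprB addrC subrK.
  by apply: le_trans (ler_normB _ _) _; rewrite lerD2l ltW// Hr.
rewrite vE normrN normrM; apply: le_lt_trans (ler_wpM2l (normr_ge0 _) ql) _.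
by rewrite -ltr_pdivlMr.
Qed.

(** The mean value theorem, where the derivatives along [A] are two-sided in the interior of the
    interval and give continuity at its endpoints. *)
Lemma within_derive_lipschitz A v v' M a b : a <= b ->
  (forall x, a <= x -> x <= b -> A x) ->
  (forall x, a <= x -> x <= b -> is_derive_within A v x (v' x)) ->
  (forall x, a <= x -> x <= b -> `|v' x| <= M) ->
  `|v b - v a| <= M * (b - a).
Proof.
rewrite le_eqVlt => /orP[/eqP->|ab] sA dv Mv; first by rewrite !subrr normr0 mulr0.
have nA x : x \in `]a, b[ -> nbhs x A.
  move=> xab; have := near_in_itvoo xab; apply: filterS => y.
  by rewrite in_itv/= => /andP[? ?]; apply: sA; exact: ltW.
have vd x : x \in `]a, b[ -> is_derive x 1 v (v' x).
  move=> xab; apply: within_derive_is_derive (nA x xab) _.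
  by move: xab; rewrite in_itv/= => /andP[? ?]; apply: dv; exact: ltW.
have cv : {within `[a, b], continuous v}.
  apply/continuous_within_itvP => //; split.
  - by move=> x xab; apply/differentiable_continuous/derivable1_diffP;
      case: (vd x xab).
  - apply/cvgrPdist_lt => e e0.
    have [r r0 Hr] := within_derive_cvg (dv a (lexx _) (ltW ab)) e0.
    near=> y; apply: Hr; first by apply: sA; near: y;
      [exact: nbhs_right_ge|exact: nbhs_right_le].
    rewrite distrC; near: y.
    by apply: cvg_within; exact: (@nbhsx_ballx _ R a r r0).
  - apply/cvgrPdist_lt => e e0.
    have [r r0 Hr] := within_derive_cvg (dv b (ltW ab) (lexx _)) e0.
    near=> y; apply: Hr; first by apply: sA; near: y;
      [exact: nbhs_left_ge|exact: nbhs_left_le].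
    rewrite distrC; near: y.
    by apply: cvg_within; exact: (@nbhsx_ballx _ R b r r0).
have [c /[!in_itv]/= /andP[ac cb] ->] := MVT ab vd cv.
rewrite normrM (gtr0_norm (_ : 0 < b - a)) ?subr_gt0//.
by apply: ler_wpM2r; [rewrite subr_ge0 ltW|apply: Mv; exact: ltW].
Unshelve. all: by end_near. Qed.

End WithinDerivative.

(** * The outer integral equation *)

Section OuterVolterra.
Context {R : realType}.
Local Notation mu := (@lebesgue_measure R).

Lemma lipschitz_cont (f : R -> R) (K : R) : 0 <= K ->
  (forall x y, x <= y -> `|f y - f x| <= K * (y - x)) -> continuous f.
Proof.
move=> K0 Kf x; apply/cvgrPdist_lt => e e0.
have K1 : 0 < K + 1 by rewrite ltr_wpDl.
have Kf' y : `|f x - f y| <= K * `|x - y|.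
  have [xy|/ltW yx] := leP x y.
    by rewrite distrC (distrC x) (ger0_norm (_ : 0 <= y - x)) ?subr_ge0// Kf.
  by rewrite (ger0_norm (_ : 0 <= x - y)) ?subr_ge0// Kf.
exists (e / (K + 1)); first by rewrite /= divr_gt0.
move=> y; rewrite /= ltr_pdivlMr// => xy; apply: le_lt_trans (Kf' y) (le_lt_trans _ xy).
by rewrite mulrC ler_wpM2l// lerDl.
Qed.

Lemma integrable_oc_cat (a x b : R) (h : R -> R) : a <= x -> x <= b ->
  mu.-integrable `]a, x] (EFin \o h) -> mu.-integrable `]x, b] (EFin \o h) ->
  mu.-integrable `]a, b] (EFin \o h).
Proof.
move=> ax xb /integrableP[m1 i1] /integrableP[m2 i2].
have E : `]a, b]%classic = `]a, x] `|` `]x, b] :> set R.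
  by rewrite -itv_bndbnd_setU ?bnd_simp.
rewrite E; apply/integrableP.
have mU : measurable_fun (`]a, x] `|` `]x, b]) (EFin \o h) by apply/measurable_funU.
split=> //; rewrite ge0_integral_setU//=.
- by rewrite lte_add_pinfty.
- apply/measurable_EFinP; apply: measurableT_comp; first exact: normr_measurable.
  exact/measurable_EFinP.
- apply/disj_setPS => y [] /=; rewrite !in_itv/= => /andP[_ yx] /andP[xy _].
  by move: xy; rewrite ltNge yx.
Qed.

Section Kernel.
Variables (w1 : R -> R -> R) (M : R).
Hypothesis M0 : 0 <= M.
Hypothesis lip1 : forall t x y, 0 <= t -> t <= x -> x <= y ->
  `|w1 y t - w1 x t| <= M * (y - x).
Hypothesis lip2 : forall r s t, 0 <= s -> s <= t -> t <= r ->
  `|w1 r t - w1 r s| <= M * (t - s).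
Hypothesis w1M : forall r t, 0 <= t -> t <= r -> `|w1 r t| <= M.
Hypothesis diag : forall r, 0 <= r -> w1 r r != 0.

(* The kernel is given for [0 <= t <= r]; continuous extensions are obtained by truncation. *)
Let pos (x : R) : R := Num.max 0 x.

Let pos_le (x y : R) : x <= y -> pos x <= pos y.
Proof. by move=> xy; rewrite /pos ge_max !le_max lexx/= xy orbT. Qed.

Let pos_lip (x y : R) : x <= y -> pos y - pos x <= y - x.
Proof.
move=> xy; rewrite /pos; case: (leP 0 x) => x0; case: (leP 0 y) => y0; lra.
Qed.

Let dcont : continuous (fun s => w1 (pos s) (pos s)).
Proof.
apply: (@lipschitz_cont _ (M + M)); first exact: addr_ge0.
move=> x y xy; rewrite -(subrK (w1 (pos y) (pos x)) (w1 (pos y) (pos y))) -addrA.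
have p0 : 0 <= pos x by rewrite /pos le_max lexx.
have pxy := pos_le xy.
apply: le_trans (ler_normD _ _) _; rewrite mulrDl.
apply: lerD.
  by apply: le_trans (lip2 p0 pxy (lexx _)) _; rewrite ler_wpM2l// pos_lip.
by apply: le_trans (lip1 p0 (lexx _) pxy) _; rewrite ler_wpM2l// pos_lip.
Qed.

Lemma diag_lower_bound (b : R) : 0 <= b ->
  exists2 c : R, 0 < c & forall s, 0 <= s -> s <= b -> c <= `|w1 s s|.
Proof.
move=> b0.
have cn : continuous (fun s => `|w1 (pos s) (pos s)|) by apply: cont_norm; exact: dcont.
have [s _ smin] := EVT_min b0 (continuous_subspaceT cn).
exists `|w1 (pos s) (pos s)|.
  by rewrite normr_gt0; apply: diag; rewrite /pos le_max lexx.
move=> t t0 tb; have := smin t; rewrite in_itv/= t0 tb => /(_ isT).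
by rewrite /pos (max_r t0).
Qed.

Let sec_measurable (r : R) : 0 <= r -> measurable_fun `]0, r] (w1 r).
Proof.
move=> r0; pose cl s := pos (Num.min s r).
have cl0 s : 0 <= cl s by rewrite /cl /pos le_max lexx.
have clr s : cl s <= r by rewrite /cl /pos ge_max r0/= ge_min lexx orbT.
have : continuous (fun s => w1 r (cl s)).
  apply: (@lipschitz_cont _ M) => // x y xy.
  have mxy : Num.min x r <= Num.min y r by rewrite le_min !ge_min xy lexx orbT.
  apply: le_trans (lip2 (cl0 x) (pos_le mxy) (clr y)) _; rewrite ler_wpM2l//.
  apply: le_trans (pos_lip mxy) _.
  by case: (leP x r) => xr; case: (leP y r) => yr; lra.
move=> /continuous_measurable_fun ms.
apply: (eq_measurable_fun (fun s => w1 r (cl s))); last exact: measurable_funTS.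
move=> s /set_mem/=; rewrite in_itv/= => /andP[s0 sr].
by rewrite /cl /pos min_l// max_r// ltW.
Qed.

Variable D : R -> R.
Hypothesis iD : forall r, 0 <= r -> mu.-integrable `]0, r] (EFin \o (fun t => w1 r t * D t)).

(** Near the diagonal the kernel is bounded away from zero, uniformly on a bounded
    interval, so that dividing by it on intervals of a fixed length shows that the
    unknown itself is integrable. *)
Lemma unknown_integrable (b : R) : 0 <= b -> mu.-integrable `]0, b] (EFin \o D).
Proof.
move=> b0; have [c c0 cmin] := diag_lower_bound b0.
have M1 : 0 < M + 1 by rewrite ltr_wpDl.
(* Over this distance a function with Lipschitz constant [M] changes by at most [c / 2]. *)
pose eta := c / 2 / (M + 1).
have eta0 : 0 < eta by rewrite !divr_gt0.
have Meta : M * eta <= c / 2.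
  rewrite /eta mulrCA ger_pMr ?divr_gt0// ler_pdivrMr// mul1r.
  by rewrite lerDl.
have near_diag r t : 0 <= t -> t <= r -> r <= b -> r - eta <= t -> c / 2 <= `|w1 r t|.
  move=> t0 tr rb rt; have := cmin _ (le_trans t0 tr) rb.
  have := lip2 t0 tr (lexx r).
  have : M * (r - t) <= c / 2 by apply: le_trans Meta; rewrite ler_wpM2l//; lra.
  have := lerB_dist (w1 r r) (w1 r t).
  move: (w1 r r) (w1 r t) (M * _) => p q z; lra.
have piece r : 0 <= r -> r <= b ->
    mu.-integrable `]pos (r - eta), r] (EFin \o D).
  move=> r0 rb; have p0 : 0 <= pos (r - eta) by rewrite /pos le_max lexx.
  have pr : r - eta <= pos (r - eta) by rewrite /pos le_max lexx orbT.
  have ir := integrable_oc_sub p0 (lexx r) (iD r0).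
  have DE : {in `]pos (r - eta), r]%classic, (fun t => (w1 r t)^-1 * (w1 r t * D t)) =1 D}.
    move=> t /set_mem/=; rewrite in_itv/= => /andP[t1 t2].
    have w0 : w1 r t != 0.
      rewrite -normr_gt0; apply: lt_le_trans (near_diag r t _ t2 rb _).
      - by rewrite divr_gt0.
      - by apply: le_trans p0 _; exact: ltW.
      - by apply: le_trans pr _; exact: ltW.
    by rewrite mulrA mulVf// mul1r.
  apply: (@le_integrable _ _ _ mu _ _ _
    (EFin \o (fun t => (2 / c) * (w1 r t * D t)))) => //.
  - apply/measurable_EFinP; apply: (eq_measurable_fun _ DE).
    apply: measurable_funM; last by apply/measurable_EFinP; case/integrableP: ir.
    apply: (measurable_comp (F := setT)) => //; first exact: measurable_inv.
    apply: measurable_funS (sec_measurable r0) => //.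
    by apply: subset_itv; rewrite bnd_simp.
  - move=> t; rewrite /= in_itv/= => /andP[t1 t2]; rewrite lee_fin !normrM.
    rewrite (gtr0_norm (_ : 0 < 2)) ?normfV// (gtr0_norm c0) mulrA.
    have : c / 2 <= `|w1 r t|.
      apply: near_diag => //; first by apply: le_trans p0 _; exact: ltW.
      by apply: le_trans pr _; exact: ltW.
    move=> h; rewrite -[leLHS]mul1r; apply: ler_wpM2r => //.
    by move: h; rewrite ler_pdivrMr// [2 / c * _]mulrC mulrA ler_pdivlMr// mul1r.
  - rewrite (_ : _ \o _ = (fun t => (2 / c)%:E * (w1 r t * D t)%:E)%E).
      exact: integrableZl.
    by apply/funext => t; rewrite /= EFinM.
(* The interval is covered step by step, from the origin, by intervals of length [eta]. *)
have H k r : 0 <= r -> r <= b -> r <= k%:R * eta -> mu.-integrable `]0, r] (EFin \o D).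
  elim: k r => [|k IH] r r0 rb.
    rewrite mul0r => r0'; have -> : r = 0 by apply/eqP; rewrite eq_le r0 r0'.
    by rewrite set_itv_ge ?bnd_simp ?ltxx//; exact: integrable_set0.
  rewrite -natr1 mulrDl mul1r => rk.
  apply: (@integrable_oc_cat _ (pos (r - eta))).
  - by rewrite /pos le_max lexx.
  - by rewrite /pos ge_max r0/=; lra.
  - apply: IH.
    + by rewrite /pos le_max lexx.
    + by rewrite /pos ge_max (le_trans r0 rb)/=; lra.
    + by rewrite /pos ge_max lerBlDr rk andbT mulr_ge0// ltW.
  - exact: piece.
apply: (H (Num.truncn (b / eta)).+1) => //.
rewrite -ler_pdivrMr//; apply: ltW; exact: truncnS_gt.
Qed.

Hypothesis zD : forall r, 0 <= r -> \int[mu]_(t in `]0, r]) (w1 r t * D t) = 0.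

Lemma volterra_unique (x : R) : 0 < x -> {for x, continuous D} -> D x = 0.
Proof.
move=> x0 cD; pose b := x + 1.
have b0 : 0 < b by rewrite ltr_wpDl// ltW.
have xb : x < b by rewrite ltrDl.
have iDb := unknown_integrable (ltW b0).
apply: (integral_norm_eq0 x0 xb iDb cD).
have [c c0 cmin] := diag_lower_bound (ltW b0).
apply: (@volterra_first_kind _ 0 b w1 D M c M) => //.
- apply: (eq_measurable_fun (fun s => w1 (pos s) (pos s))).
    move=> s /set_mem/=; rewrite in_itv/= => /andP[s0 _].
    by rewrite /pos max_r// ltW.
  by apply: measurable_funTS; exact: continuous_measurable_fun.
- by move=> s s0 sb; rewrite cmin ?w1M// ltW.
- by move=> y y0 _; apply: iD; exact: ltW.
- by move=> s y z s0 sy yz _; apply: lip1 => //; exact: ltW.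
- by move=> y y0 _; apply: zD; exact: ltW.
Qed.

End Kernel.

(** The bounds on the partial derivatives are Lipschitz bounds in each variable; at a point of
    continuity, vanishing almost everywhere becomes vanishing. *)
Lemma outer_volterra (w1 : R -> R -> R) (D : R -> R) :
  bounded_with_partials w1_domain w1 -> (forall r, 0 <= r -> w1 r r != 0) ->
  (forall r, 0 <= r -> mu.-integrable `]0, r] (EFin \o (fun t => w1 r t * D t))) ->
  (forall r, 0 <= r -> \int[mu]_(t in `]0, r]) (w1 r t * D t) = 0) ->
  forall x, 0 < x -> {for x, continuous D} -> D x = 0.
Proof.
move=> [v1 [v2 [M hM]]] diag iD zD.
have M0 : 0 <= M.
  have [] := hM 0 0; first by rewrite /w1_domain /= lexx.
  by move=> _ _ [+ _ _]; apply: le_trans.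
apply: (@volterra_unique w1 M M0 _ _ _ diag D iD zD).
- move=> t x y t0 tx xy; apply: (within_derive_lipschitz (v := fun s => w1 s t)
    (A := [set s | w1_domain (s, t)]) (v' := fun s => v1 s t) xy).
  + by move=> s xs _; rewrite /w1_domain /= t0 (le_trans tx).
  + move=> s xs _; have [|] // := hM s t.
    by rewrite /w1_domain /= t0 (le_trans tx).
  + move=> s xs _; have [|_ _ []//] := hM s t.
    by rewrite /w1_domain /= t0 (le_trans tx).
- move=> r s t s0 st tr; apply: (within_derive_lipschitz (v := w1 r)
    (A := [set u | w1_domain (r, u)]) (v' := v2 r) st).
  + by move=> u su ut; rewrite /w1_domain /= (le_trans s0 su) (le_trans ut).
  + move=> u su ut; have [|] // := hM r u.
    by rewrite /w1_domain /= (le_trans s0 su) (le_trans ut).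
  + move=> u su ut; have [|_ _ []//] := hM r u.
    by rewrite /w1_domain /= (le_trans s0 su) (le_trans ut).
- move=> r t t0 tr; have [|_ _ []//] := hM r t.
  by rewrite /w1_domain /= t0.
Qed.

End OuterVolterra.

(** * Orthogonal frames *)

Section Frames.
Context {R : realType}.
Implicit Types (h : 'M[R]_3) (x : 'cV[R]_3).

Lemma vec3E x : x = vec3 (x 0 0) (x 1 0) (x 2 0).
Proof.
apply/matrixP => i j; rewrite ord1 mxE.
by case: i => [[|[|[|//]]] ?] /=; congr (x _ _); apply: val_inj.
Qed.

Lemma mulmx_vec3 h (a b c : R) : h *m vec3 a b c =
  vec3 (h 0 0 * a + h 0 1 * b + h 0 2 * c)
       (h 1 0 * a + h 1 1 * b + h 1 2 * c)
       (h 2 0 * a + h 2 1 * b + h 2 2 * c).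
Proof.
apply/matrixP => i j; rewrite ord1 !mxE !big_ord_recl big_ord0 !mxE/= addr0 addrA.
have E1 : lift ord0 ord0 = 1 :> 'I_3 by apply: val_inj.
have E2 : lift ord0 (lift ord0 ord0) = 2 :> 'I_3 by apply: val_inj.
rewrite E1 E2.
case: i => [[|[|[|//]]] ?] /=; congr (h _ _ * _ + h _ _ * _ + h _ _ * _); exact: val_inj.
Qed.

Lemma enorm_vec3 (a b c : R) : enorm (vec3 a b c) = Num.sqrt (a ^+ 2 + b ^+ 2 + c ^+ 2).
Proof. by rewrite /enorm !big_ord_recl big_ord0 !mxE/= addr0 addrA. Qed.

Lemma enorm_orthogonal h x : h^T *m h = 1%:M -> enorm (h *m x) = enorm x.
Proof.
move=> hh; have E (y : 'cV[R]_3) : \sum_i (y i 0) ^+ 2 = (y^T *m y) 0 0 :> R.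
  by rewrite mxE; apply: eq_bigr => i _; rewrite mxE.
by rewrite /enorm !E trmx_mul mulmxA -(mulmxA _ _ h) hh mulmx1.
Qed.

Lemma rotU_vec3 (al a b c : R) : rotU al *m vec3 a b c =
  vec3 (cos al * a - sin al * b) (sin al * a + cos al * b) c.
Proof.
by rewrite mulmx_vec3 !mxE/= !mul0r !mul1r !add0r !addr0 mulNr.
Qed.

Lemma rotV_vec3 (be a b c : R) : rotV be *m vec3 a b c =
  vec3 (cos be * a + sin be * c) b (- sin be * a + cos be * c).
Proof.
by rewrite mulmx_vec3 !mxE/= !mul0r !mul1r !add0r !addr0.
Qed.

Lemma rotU_orthogonal (al : R) : (rotU al)^T *m rotU al = 1%:M.
Proof.
have := cos2Dsin2 al => cs.
apply/matrixP => i j; rewrite !mxE !big_ord_recl big_ord0 !mxE/=.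
case: i => [[|[|[|i]]] hi] //; case: j => [[|[|[|j]]] hj] //=; rewrite ?mulr1n ?mulr0n; (ring || (rewrite -cs; ring)).
Qed.

Lemma rotV_orthogonal (be : R) : (rotV be)^T *m rotV be = 1%:M.
Proof.
have := cos2Dsin2 be => cs.
apply/matrixP => i j; rewrite !mxE !big_ord_recl big_ord0 !mxE/=.
case: i => [[|[|[|i]]] hi] //; case: j => [[|[|[|j]]] hj] //=; rewrite ?mulr1n ?mulr0n; (ring || (rewrite -cs; ring)).
Qed.

Lemma orthogonal_mul h h' : h^T *m h = 1%:M -> h'^T *m h' = 1%:M ->
  (h *m h')^T *m (h *m h') = 1%:M.
Proof. by move=> hh hh'; rewrite trmx_mul mulmxA -(mulmxA _ _ h) hh mulmx1. Qed.

Lemma euler_frame (al be : R) :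
  (rotU al *m rotV be) *m vec3 0 0 1 = vec3 (sin be * cos al) (sin be * sin al) (cos be).
Proof.
rewrite -mulmxA rotV_vec3 rotU_vec3 !mulr0 !mulr1 !add0r subr0 addr0.
by rewrite mulrC (mulrC (sin al)).
Qed.

Lemma spherical_coordinates (a b c : R) : a ^+ 2 + b ^+ 2 + c ^+ 2 = 1 ->
  exists al be : R, [/\ 0 <= al <= 2 * pi, 0 <= be <= pi &
    (rotU al *m rotV be) *m vec3 0 0 1 = vec3 a b c].
Proof.
move=> abc; have c1 : -1 <= c <= 1.
  have : c ^+ 2 <= 1 by rewrite -abc lerDr addr_ge0 ?sqr_ge0.
  by rewrite -ler_norml -(ler_sqr (normr_ge0 _) ler01) real_normK ?num_real ?expr1n.
have s0 : 0 <= sin (acos c).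
  by apply: sin_ge0_pi; rewrite acos_ge0// acos_lepi.
have ab : a ^+ 2 + b ^+ 2 = sin (acos c) ^+ 2.
  rewrite sin_acos// sqr_sqrtr; first by rewrite -abc addrK.
  by rewrite -abc addrK addr_ge0 ?sqr_ge0.
have [al [al0 ae be]] := polar_angle s0 ab.
exists al, (acos c); split => //; first by rewrite acos_ge0// acos_lepi.
by rewrite euler_frame -ae -be acosK// in_itv.
Qed.

(** Two frames with the same axis differ by a rotation about this axis or by a reflection
    in a plane containing it. *)
Lemma frame_same_axis h h' : h^T *m h = 1%:M -> h'^T *m h' = 1%:M ->
  h *m vec3 0 0 1 = h' *m vec3 0 0 1 ->
  exists2 ga : R, 0 <= ga <= 2 * pi &
    (forall a b c, h' *m vec3 a b c =
       h *m vec3 (cos ga * a - sin ga * b) (sin ga * a + cos ga * b) c) \/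
    (forall a b c, h' *m vec3 a b c =
       h *m vec3 (cos ga * a + sin ga * b) (sin ga * a - cos ga * b) c).
Proof.
move=> hh hh' he; pose K := h^T *m h'.
have hhT : h *m h^T = 1%:M by exact: mulmx1C.
have hK : h' = h *m K by rewrite /K mulmxA hhT mul1mx.
have KK : K^T *m K = 1%:M.
  by rewrite /K trmx_mul trmxK mulmxA -(mulmxA _ h) hhT mulmx1.
have Ke : K *m vec3 0 0 1 = vec3 0 0 1 by rewrite /K -mulmxA -he mulmxA hh mul1mx.
clearbody K.
have [K02 K12 K22] : [/\ K 0 2 = 0, K 1 2 = 0 & K 2 2 = 1].
  move: Ke; rewrite mulmx_vec3 !mulr0 !mulr1 !add0r => Ke.
  by split; [have := congr1 (fun M : 'cV[R]_3 => M 0 0) Ke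
    |have := congr1 (fun M : 'cV[R]_3 => M 1 0) Ke
    |have := congr1 (fun M : 'cV[R]_3 => M 2 0) Ke]; rewrite !mxE.
have E i j : K 0 i * K 0 j + K 1 i * K 1 j + K 2 i * K 2 j = (i == j)%:R.
  have := congr1 (fun M : 'M[R]_3 => M i j) KK.
  rewrite !mxE !big_ord_recl big_ord0 !mxE addr0 addrA => <-.
  have E1 : lift ord0 ord0 = 1 :> 'I_3 by apply: val_inj.
  have E2 : lift ord0 (lift ord0 ord0) = 2 :> 'I_3 by apply: val_inj.
  by rewrite E1 E2.
have K20 : K 2 0 = 0 by have := E 2 0; rewrite K02 K12 K22 !mul0r !add0r mul1r.
have K21 : K 2 1 = 0 by have := E 2 1; rewrite K02 K12 K22 !mul0r !add0r mul1r.
have := E 0 0; have := E 1 1; have := E 0 1.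
rewrite K20 K21 !mul0r !addr0 /= ?mulr1n ?mulr0n -!expr2.
move: (K 0 0) (K 1 0) (K 0 1) (K 1 1) (mulmx_vec3 K) => p q r t KE pr rt pq.
have [|ga [ga0 pE qE]] := @polar_angle R p q 1 ler01; first by rewrite expr1n.
rewrite !mul1r in pE qE.
have HE a b c : h' *m vec3 a b c = h *m vec3 (p * a + r * b) (q * a + t * b) c.
  by rewrite hK -mulmxA KE K02 K12 K20 K21 K22 !mul0r !addr0 !add0r mul1r.
(* The determinant, equal to [1] for a rotation and to [-1] for a reflection. *)
pose k := p * t - q * r.
have k2 : k ^+ 2 = 1.
  have -> : k ^+ 2 = (p ^+ 2 + q ^+ 2) * (r ^+ 2 + t ^+ 2) - (p * r + q * t) ^+ 2.
    by rewrite /k; ring.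
  by rewrite pq rt pr expr0n subr0 mulr1.
have rE : r = - (k * q).
  rewrite -[LHS](mulr1 r) -pq mulrDr; have -> : r * p ^+ 2 = - (p * q * t).
    by transitivity (p * (p * r)); [ring|rewrite -[p * r](addrK (q * t)) pr; ring].
  by rewrite /k; ring.
have tE : t = k * p.
  rewrite -[LHS](mulr1 t) -pq mulrDr; have -> : t * q ^+ 2 = - (p * q * r).
    by transitivity (q * (q * t)); [ring|rewrite -[q * t](addKr (p * r)) pr; ring].
  by rewrite /k; ring.
exists ga => //; move/eqP: k2; rewrite sqrf_eq1 => /orP[/eqP k1|/eqP k1].
- left=> a b c; rewrite HE rE tE k1 pE qE; congr (h *m vec3 _ _ _); ring.
- right=> a b c; rewrite HE rE tE k1 pE qE; congr (h *m vec3 _ _ _); ring.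
Qed.

End Frames.

Lemma cont_vec3 (R : realType) (T : topologicalType) (a b c : T -> R) :
  continuous a -> continuous b -> continuous c -> continuous (fun t => vec3 (a t) (b t) (c t)).
Proof.
move=> ca cb cc.
have -> : (fun t => vec3 (a t) (b t) (c t)) =
  (fun t => a t *: vec3 1 0 0 + b t *: vec3 0 1 0 + c t *: vec3 0 0 1).
  apply/funext => t; apply/matrixP => i j; rewrite !mxE.
  by case: i => [[|[|[|//]]] ?] /=; rewrite !(mulr0, mulr1, addr0, add0r).
have cZ (u : T -> R) (v : 'cV[R]_3) : continuous u -> continuous (fun t => u t *: v).
  by move=> cu t; exact: (@continuousZr_tmp R ('cV[R]_3 : normedModType R) T u v t (cu t)).
have cD (u v : T -> 'cV[R]_3) : continuous u -> continuous v -> continuous (fun t => u t + v t).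
  by move=> cu cv t; exact: (@continuousD R ('cV[R]_3 : normedModType R) T u v t (cu t) (cv t)).
by apply: (cD) (cZ _ _ cc); apply: (cD); exact: cZ.
Qed.

(** * Weights on the triangle *)

Section ClampedWeights.
Context {R : realType}.
Variables (a b : R).
Hypothesis ab : a <= b.
Implicit Type W : R -> R -> R.

Let cut (T : R) : R := Num.max a (Num.min T b).

(** The weight is only given on a triangle; composing with a retraction onto the
    triangle extends it to a continuous function on the plane. *)
Definition clamped W (T s : R) : R := W (cut T) (Num.max a (Num.min s (cut T))).

Let cut_ge T : a <= cut T. Proof. by rewrite /cut le_max lexx. Qed.
Let cut_le T : cut T <= b. Proof. by rewrite /cut ge_max ab/= ge_min lexx orbT. Qed.

Lemma clamp_triangle T s : triangle a b (cut T, Num.max a (Num.min s (cut T))).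
Proof.
rewrite /triangle /= cut_ge cut_le; split => //.
by rewrite le_max lexx ge_max cut_ge/= ge_min lexx orbT.
Qed.

Lemma clampedE W T s : a <= s -> s <= T -> T <= b -> clamped W T s = W T s.
Proof.
move=> as' sT Tb; have cT : cut T = T.
  by rewrite /cut min_l// max_r// (le_trans as').
by rewrite /clamped cT min_l// max_r.
Qed.

Lemma clamped_cont W : {within triangle a b, continuous (fun p : R * R => W p.1 p.2)} ->
  continuous (fun p : R * R => clamped W p.1 p.2).
Proof.
move=> /subspace_continuousP cW.
pose r (p : R * R) : R * R := (cut p.1, Num.max a (Num.min p.2 (cut p.1))).
have cr : continuous r by rewrite /r /cut; cont.
move=> p; have := cW (r p) (clamp_triangle p.1 p.2); apply: cvg_trans.
have : r x @[x --> p] --> within (triangle a b) (nbhs (r p)).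
  move=> P; rewrite /within /= => /(cr p) nP.
  by apply: (@filterS _ (nbhs p) _ (r @^-1` _) (r @^-1` P) _ nP) => q /= Pq; exact: (Pq (clamp_triangle q.1 q.2)).
move=> rp P /rp; exact.
Qed.

Lemma triangle_bounded W : {within triangle a b, continuous (fun p : R * R => W p.1 p.2)} ->
  exists2 M : R, 0 <= M & forall T s, a <= s -> s <= T -> T <= b -> `|W T s| <= M.
Proof.
move=> /clamped_cont cW.
have cn : continuous (fun p : R * R => `|clamped W p.1 p.2|) by apply: cont_norm.
have K : compact (`[a, b] `*` `[a, b] : set (R * R)).
  by apply: compact_setX; exact: segment_compact.
have ne : (`[a, b] `*` `[a, b] : set (R * R)) !=set0.
  by exists (a, a); rewrite /= in_itv/= lexx ab.
have [p _ pmax] := compact_EVT_max ne K (continuous_subspaceT cn).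
exists `|clamped W p.1 p.2| => // T s as' sT Tb.
have /= := pmax (T, s); rewrite clampedE//; apply.
by rewrite inE /= !in_itv/= as' Tb (le_trans as' sT) (le_trans sT Tb).
Qed.

Lemma triangle_lipschitz W : continuous_with_partial1 (triangle a b) W ->
  exists2 L : R, 0 <= L &
    forall s x y, a <= s -> s <= x -> x <= y -> y <= b -> `|W y s - W x s| <= L * (y - x).
Proof.
move=> [_ [W' [dW cW']]]; have [L L0 HL] := triangle_bounded cW'.
exists L => // s x y as' sx xy yb.
have tri u : x <= u -> u <= y -> triangle a b (u, s).
  move=> xu uy; have su : s <= u by apply: le_trans sx xu.
  by split; rewrite /= ?as' ?su ?(le_trans as' su) ?(le_trans uy).
apply: (within_derive_lipschitz (v := W ^~ s) (A := [set t | triangle a b (t, s)])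
  (v' := W' ^~ s) xy) => [u xu uy|u xu uy|u xu uy].
- exact: tri.
- by apply: dW; exact: tri.
- by apply: HL => //; [apply: le_trans sx xu|apply: le_trans uy yb].
Qed.

End ClampedWeights.

(** * The radial change of variables *)

Section Radial.
Context {R : realType}.

(** The radius at which the spindle torus with parameter [t] meets the direction of
    colatitude [phi], where [s = sin phi / t]; it is inverse to [delta]. *)
Definition rad (s : R) : R := Num.sqrt (s ^+ 2 + 1) - s.

(** With [s = sin phi / t] as in [rad], the factor [rho^2 sin phi / (t sqrt (sin^2 phi / t^2 + 1))]
    of the transform. *)
Definition density (s : R) : R := rad s ^+ 2 * s / Num.sqrt (s ^+ 2 + 1).

Lemma sqr1_gt0 (s : R) : 0 < s ^+ 2 + 1.
Proof. by rewrite ltr_wpDl ?sqr_ge0. Qed.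

Lemma sqrt1_gt0 (s : R) : 0 < Num.sqrt (s ^+ 2 + 1).
Proof. by rewrite sqrtr_gt0 sqr1_gt0. Qed.

Lemma rad_mul (s : R) : rad s * (Num.sqrt (s ^+ 2 + 1) + s) = 1.
Proof.
rewrite /rad; transitivity (Num.sqrt (s ^+ 2 + 1) ^+ 2 - s ^+ 2); first by ring.
by rewrite sqr_sqrtr ?ltW ?sqr1_gt0// addrC addKr.
Qed.

Lemma rad_gt0 (s : R) : 0 < rad s.
Proof.
rewrite subr_gt0; have [s0|s0] := leP s 0; first by apply: le_lt_trans s0 (sqrt1_gt0 s).
rewrite -[ltLHS]gtr0_norm// -sqrtr_sqr ltr_sqrt ?sqr1_gt0//.
by rewrite ltrDl.
Qed.

Lemma delta_rad (s : R) : delta (rad s) = s.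
Proof.
have r0 : rad s != 0 by rewrite gt_eqF// rad_gt0.
rewrite /delta -[X in X - _](rad_mul s) expr2 -mulrBr.
have -> : Num.sqrt (s ^+ 2 + 1) + s - rad s = 2 * s by rewrite /rad; ring.
by field.
Qed.

Lemma rad_delta (e : R) : 0 < e -> rad (delta e) = e.
Proof.
move=> e0; rewrite /rad; have -> : delta e ^+ 2 + 1 = ((1 + e ^+ 2) / (2 * e)) ^+ 2.
  by rewrite /delta; field; rewrite gt_eqF.
rewrite sqrtr_sqr ger0_norm; last by rewrite divr_ge0 ?addr_ge0 ?sqr_ge0 ?mulr_ge0 ?ltW.
by rewrite /delta; field; rewrite gt_eqF.
Qed.

Lemma delta_lt (e e' : R) : 0 < e -> e < e' -> delta e' < delta e.
Proof.
move=> e0 ee; have e'0 := lt_trans e0 ee.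
have dE (u : R) : 0 < u -> delta u = (u^-1 - u) / 2.
  by move=> u0; rewrite /delta; field; rewrite gt_eqF.
rewrite !dE// ltr_pM2r ?invr_gt0//; apply: ltrB => //.
by rewrite ltf_pV2.
Qed.

Lemma delta_gt0 (e : R) : 0 < e -> e < 1 -> 0 < delta e.
Proof.
by move=> e0 e1; rewrite divr_gt0 ?mulr_gt0// subr_gt0 expr_lt1// ltW.
Qed.

Lemma rad_cont (T : topologicalType) (f : T -> R) : continuous f ->
  continuous (fun t => rad (f t)).
Proof. by move=> cf; rewrite /rad; cont. Qed.

Lemma density_cont (T : topologicalType) (f : T -> R) : continuous f ->
  continuous (fun t => density (f t)).
Proof.
move=> cf; rewrite /density; apply: contM; last first.
  by apply: contV; [move=> t; rewrite gt_eqF// sqrt1_gt0|cont].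
by apply: contM => //; apply: contX; exact: rad_cont.
Qed.

Lemma density_gt0 (s : R) : 0 < s -> 0 < density s.
Proof. by move=> s0; rewrite divr_gt0 ?sqrt1_gt0// mulr_gt0// exprn_gt0// rad_gt0. Qed.

Definition tilde_factor (n : R) : R :=
  let v := (1 - n ^+ 2) ^+ 2 / (4 * n ^+ 4) in
  ((1 - n ^+ 2) / (2 * n ^+ 2) - v / Num.sqrt (v + 1)) / (1 / Num.sqrt (v + 1)).

Lemma ftildeE (f : 'cV[R]_3 -> R) x : ftilde f x = tilde_factor (enorm x) * f x.
Proof. by rewrite /ftilde /tilde_factor mulrAC. Qed.

(** With [q = (1 - n^2) / (2 n^2)] the factor is [q * rad q]. *)
Lemma tilde_factor_gt0 (n : R) : 0 < n -> n < 1 -> 0 < tilde_factor n.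
Proof.
move=> n0 n1; rewrite /tilde_factor; set q := (1 - n ^+ 2) / (2 * n ^+ 2).
have q0 : 0 < q by rewrite divr_gt0 ?mulr_gt0 ?exprn_gt0// subr_gt0 expr_lt1// ltW.
have -> : (1 - n ^+ 2) ^+ 2 / (4 * n ^+ 4) = q ^+ 2 by rewrite /q; field; rewrite gt_eqF.
have S0 := sqrt1_gt0 q.
rewrite divr_gt0 ?divr_gt0// subr_gt0 ltr_pdivrMr// expr2 ltr_pM2l//.
by have := rad_gt0 q; rewrite subr_gt0.
Qed.

Lemma tilde_factor_cont (T : topologicalType) (f : T -> R) : (forall t, f t != 0) ->
  continuous f -> continuous (fun t => tilde_factor (f t)).
Proof.
move=> f0 cf; rewrite /tilde_factor.
have v0 t : 0 <= (1 - f t ^+ 2) ^+ 2 / (4 * f t ^+ 4).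
  by rewrite divr_ge0 ?sqr_ge0// mulr_ge0// exprn_even_ge0.
have cv : continuous (fun t => (1 - f t ^+ 2) ^+ 2 / (4 * f t ^+ 4)).
  apply: contM; first by cont.
  by apply: contV; [move=> t; rewrite mulf_neq0// ?expf_neq0// pnatr_eq0|cont].
have cs : continuous (fun t => Num.sqrt ((1 - f t ^+ 2) ^+ 2 / (4 * f t ^+ 4) + 1)).
  by apply: cont_sqrt; apply: contD => //; exact: contC.
have s0 t : Num.sqrt ((1 - f t ^+ 2) ^+ 2 / (4 * f t ^+ 4) + 1) != 0.
  by rewrite gt_eqF// sqrtr_gt0 ltr_wpDl.
apply: contM.
  apply: contD; last by apply: contN; apply: contM => //; exact: contV.
  apply: contM; first by cont.
  by apply: contV; [move=> t; rewrite mulf_neq0// ?expf_neq0// pnatr_eq0|cont].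
apply: contV; last by apply: contM; [exact: contC|exact: contV].
by move=> t; rewrite mulf_neq0 ?oner_eq0// invr_eq0.
Qed.

Lemma enorm_cont : continuous (@enorm R).
Proof.
have cc (i : 'I_3) : continuous (fun x : 'cV[R]_3 => x i 0).
  exact: coord_continuous.
by apply: cont_sqrt; apply: cont_sum => i; apply: contX.
Qed.

Section Support.
Variables (e1 e2 : R) (f : 'cV[R]_3 -> R).
Hypothesis e10 : 0 < e1.
Hypothesis Cf : C0_infty (hollow_ball e1 e2 `&` upper_half_space) f.

Lemma support_bounds x : f x != 0 -> [/\ e1 < enorm x, enorm x < e2 & 0 < x 2 0].
Proof.
move=> fx; have [_ _ sub] := Cf.
have : closure [set x | f x != 0] x by exact: subset_closure.
by move=> /sub[/andP[]].
Qed.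

Lemma ftilde_cont : continuous (ftilde f).
Proof.
have cf : continuous f by have [sm _ _] := Cf; have [] := sm [::].
(* The factor is singular at the origin, but [f] vanishes near it. *)
have -> : ftilde f = (fun x => tilde_factor (Num.max (enorm x) e1) * f x).
  apply/funext => x; rewrite ftildeE; have [->|fx] := eqVneq (f x) 0.
    by rewrite !mulr0.
  by have [e1x _ _] := support_bounds fx; rewrite max_l// ltW.
apply: contM => //; apply: tilde_factor_cont.
  by move=> x; rewrite gt_eqF// lt_max e10 orbT.
by apply: cont_max; [exact: enorm_cont|exact: contC].
Qed.

Lemma ftilde_eq0 x : ~ [/\ e1 < enorm x, enorm x < e2 & 0 < x 2 0] -> ftilde f x = 0.
Proof.
move=> H; rewrite ftildeE; have [->|/support_bounds//] := eqVneq (f x) 0.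
by rewrite mulr0.
Qed.

End Support.
End Radial.

(** * Integrals over single tori *)

Section TorusIntegral.
Context {R : realType}.
Local Notation mu := (@lebesgue_measure R).
Variables (w2 : R -> R -> R) (d2 d1 : R).
Hypothesis d20 : 0 < d2.
Hypothesis d21 : d2 <= d1.
Hypothesis cW2 : forall far,
  {within triangle d2 d1, continuous (fun p : R * R => W2 w2 far p.1 p.2)}.

Let W far := clamped d2 d1 (W2 w2 far).

Let cW far : continuous (fun p : R * R => W far p.1 p.2).
Proof. exact: clamped_cont. Qed.

Let contW far (T : topologicalType) (f g : T -> R) : continuous f -> continuous g ->
  continuous (fun t => W far (f t) (g t)).
Proof. exact: (cont2 (F := W far) (@cW far)). Qed.

(** The integral over the spindle torus of parameter [1 / T], folded along the equator;
    on the two halves the weight is given by the two determinations of [W2]. *)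
Definition torus_integral (F : R -> R -> R -> R -> R) (T : R) : R :=
  segint 0 (2 * pi) (fun t => segint 0 (pi / 2) (fun a =>
    W false T (T * sin a) * F (T * sin a) (sin a * cos t) (sin a * sin t) (cos a) +
    W true T (T * sin a) *
      F (T * sin a) (sin (pi - a) * cos t) (sin (pi - a) * sin t) (cos (pi - a)))).

Section OneFunction.
Variable F : R -> R -> R -> R -> R.
Hypothesis cF : continuous (fun p : R * R * R * R => F p.1.1.1 p.1.1.2 p.1.2 p.2).
Hypothesis F0 : forall s x y z, s <= d2 \/ d1 <= s -> x ^+ 2 + y ^+ 2 + z ^+ 2 = 1 ->
  F s x y z = 0.

Let cont4F (T : topologicalType) (f g h k : T -> R) :
  continuous f -> continuous g -> continuous h -> continuous k ->
  continuous (fun t => F (f t) (g t) (h t) (k t)).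
Proof.
move=> cf cg ch ck.
apply: (@cont_comp _ _ _ (fun p : R * R * R * R => F p.1.1.1 p.1.1.2 p.1.2 p.2)
  (fun t => (f t, g t, h t, k t)) cF); cont.
Qed.

Lemma torus_integrand_cont (T : topologicalType) (T' t a : T -> R) :
  continuous T' -> continuous t -> continuous a ->
  continuous (fun p => W false (T' p) (T' p * sin (a p)) *
    F (T' p * sin (a p)) (sin (a p) * cos (t p)) (sin (a p) * sin (t p)) (cos (a p)) +
    W true (T' p) (T' p * sin (a p)) *
      F (T' p * sin (a p)) (sin (pi - a p) * cos (t p)) (sin (pi - a p) * sin (t p))
        (cos (pi - a p))).
Proof.
move=> cT ct ca; apply: contD; apply: contM.
- by apply: contW; cont.
- by apply: cont4F; cont.
- by apply: contW; cont.
- by apply: cont4F; cont.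
Qed.

Lemma torus_integral_cont : continuous (torus_integral F).
Proof.
apply: segint_cont; apply: (segint_cont _ _ (fun (p : R * R) a =>
  W false p.1 (p.1 * sin a) *
    F (p.1 * sin a) (sin a * cos p.2) (sin a * sin p.2) (cos a) +
    W true p.1 (p.1 * sin a) *
      F (p.1 * sin a) (sin (pi - a) * cos p.2) (sin (pi - a) * sin p.2)
        (cos (pi - a)))).
by apply: torus_integrand_cont; cont.
Qed.

Let direction_unit (a t : R) :
  (sin a * cos t) ^+ 2 + (sin a * sin t) ^+ 2 + cos a ^+ 2 = 1.
Proof. by rewrite !exprMn -mulrDr cos2Dsin2 mulr1 addrC cos2Dsin2. Qed.

(** In terms of [T = 1 / t] and [s = T sin phi], the weight is [W2 w2 false T s] for
    [phi <= pi / 2] and [W2 w2 true T s] beyond; where [(T, s)] leaves the triangle, [F] vanishes. *)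
Lemma torus_integralE (t : R) : 0 < t -> d2 < t^-1 -> t^-1 < d1 ->
  \int[mu]_(theta in `[0, 2 * pi]) \int[mu]_(phi in `[0, pi])
    (w2 t phi * F (sin phi / t) (sin phi * cos theta) (sin phi * sin theta) (cos phi)) =
  torus_integral F t^-1.
Proof.
move=> t0 tl tu; rewrite -segintE; apply: eq_segint => th _; rewrite -segintE.
set T := t^-1; have T0 : 0 < T by rewrite invr_gt0.
have pi0 : 0 <= pi :> R by exact: pi_ge0.
have pih : 0 <= pi / 2 :> R by rewrite divr_ge0.
have hpi : pi / 2 <= pi :> R by rewrite ler_pdivrMr// mulr_natr mulr2n lerDl.
pose P0 a := W false T (T * sin a) *
  F (T * sin a) (sin a * cos th) (sin a * sin th) (cos a).
pose P1 a := W true T (T * sin a) *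
  F (T * sin a) (sin (pi - a) * cos th) (sin (pi - a) * sin th) (cos (pi - a)).
have cP0 : continuous P0.
  by apply: contM; [apply: contW; cont|apply: cont4F; cont].
have cP1 : continuous P1.
  by apply: contM; [apply: contW; cont|apply: cont4F; cont].
pose I phi := w2 t phi * F (sin phi / t) (sin phi * cos th) (sin phi * sin th) (cos phi).
have asinK' a : 0 <= a -> a <= pi / 2 -> asin (T * sin a / T) = a.
  move=> a0 ah; rewrite mulrC mulKf ?gt_eqF// sinK// in_itv/= ah andbT.
  by rewrite (le_trans _ a0)// lerNl oppr0.
have sT a : T * sin a <= T by rewrite ger_pMr// sin_le1.
have Fz (c s : R) : s <= d2 -> F s (sin c * cos th) (sin c * sin th) (cos c) = 0.
  by move=> sd; apply: F0; [left|exact: direction_unit].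
have IP0 a : 0 <= a -> a <= pi / 2 -> I a = P0 a.
  move=> a0 ah; rewrite /I /P0 (mulrC _ t^-1) -/T.
  have [s2|s2] := leP (T * sin a) d2.
    by rewrite Fz// !mulr0.
  rewrite /W clampedE// ?ltW// /W2 asinK'// div1r invrK//.
have IP1 a : 0 <= a -> a <= pi / 2 -> I (pi - a) = P1 a.
  move=> a0 ah; rewrite /I /P1 (mulrC _ t^-1) -/T.
  have sE : sin (pi - a) = sin a by rewrite addrC sinDpi sinN opprK.
  have [s2|s2] := leP (T * sin a) d2.
    by rewrite sE -sE Fz ?sE// !mulr0.
  by rewrite {1}sE /W clampedE// ?ltW// /W2 asinK'// div1r invrK.
(* A continuous function that agrees with [P0] before [pi / 2] and with [P1 (pi - phi)] after. *)
pose Q phi := P0 (Num.min phi (pi / 2)) + P1 (pi - Num.max phi (pi / 2)) - P0 (pi / 2).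
have cQ : continuous Q.
  apply: contD; last exact: contC.
  by apply: contD; [apply: (cont_comp cP0)|apply: (cont_comp cP1)]; cont.
have half : pi - pi / 2 = pi / 2 :> R by field.
have meet : P0 (pi / 2) = P1 (pi / 2) by rewrite -IP0// -IP1// half.
transitivity (segint 0 pi Q).
  apply: eq_segint => a /andP[a0 a1]; rewrite -/(I a) /Q.
  have [ah|/ltW ah] := leP a (pi / 2).
    by rewrite half -meet addrK IP0.
  rewrite addrAC subrr add0r -IP1; first by rewrite opprB addrC subrK.
    by rewrite subr_ge0.
  by rewrite lerBlDr -lerBlDl half.
have cP1' : continuous (fun a => P1 (pi - a)) by apply: (cont_comp cP1); cont.
rewrite (segint_split pih hpi cQ).
rewrite (_ : segint 0 (pi / 2) Q = segint 0 (pi / 2) P0); last first.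
  apply: eq_segint => a /andP[a0 ah]; rewrite /Q.
  by rewrite min_l// max_r// half -meet addrK.
rewrite (_ : segint (pi / 2) pi Q = segint (pi / 2) pi (fun a => P1 (pi - a))); last first.
  apply: eq_segint => a /andP[ah _]; rewrite /Q.
  by rewrite min_r// max_l// addrAC subrr add0r.
by rewrite (segint_reflect _ hpi cP1) subrr half -segintD.
Qed.

(** Turning the circles of a torus around its axis, or reflecting them, only changes the
    parametrization. *)
Lemma torus_integral_rotate (F' : R -> R -> R -> R -> R) (ga T : R) : 0 <= ga <= 2 * pi ->
  (forall s x y z, F' s x y z =
     F s (cos ga * x - sin ga * y) (sin ga * x + cos ga * y) z) \/
  (forall s x y z, F' s x y z =
     F s (cos ga * x + sin ga * y) (sin ga * x - cos ga * y) z) ->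
  torus_integral F' T = torus_integral F T.
Proof.
move=> ga0 E.
pose P (t : R) := segint 0 (pi / 2) (fun a =>
    W false T (T * sin a) * F (T * sin a) (sin a * cos t) (sin a * sin t) (cos a) +
    W true T (T * sin a) *
      F (T * sin a) (sin (pi - a) * cos t) (sin (pi - a) * sin t) (cos (pi - a))).
have cP : continuous P.
  apply: segint_cont; apply: torus_integrand_cont; cont.
have pP t : P (t + 2 * pi) = P t.
  by rewrite /P [2 * pi]mulrC mulr_natr cosD2pi sinD2pi.
rewrite /torus_integral -/P; case: E => E.
- rewrite -(segint_periodic_shift cP pP ga0); apply: eq_segint => t _.
  apply: eq_segint => a _; rewrite !E (cosD ga t) (sinD ga t); congr (_ * F _ _ _ _ + _ * F _ _ _ _); ring.
- rewrite -(segint_periodic_reflect cP pP ga0); apply: eq_segint => t _.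
  apply: eq_segint => a _; rewrite !E (cosB ga t) (sinB ga t); congr (_ * F _ _ _ _ + _ * F _ _ _ _); ring.
Qed.

End OneFunction.

Lemma torus_integralB (F G : R -> R -> R -> R -> R) T :
  continuous (fun p : R * R * R * R => F p.1.1.1 p.1.1.2 p.1.2 p.2) ->
  continuous (fun p : R * R * R * R => G p.1.1.1 p.1.1.2 p.1.2 p.2) ->
  torus_integral (fun s x y z => F s x y z - G s x y z) T =
  torus_integral F T - torus_integral G T.
Proof.
move=> cF cG.
have cI (H : R -> R -> R -> R -> R) :
    continuous (fun p : R * R * R * R => H p.1.1.1 p.1.1.2 p.1.2 p.2) ->
    continuous (fun p : R * R => W false T (T * sin p.2) *
      H (T * sin p.2) (sin p.2 * cos p.1) (sin p.2 * sin p.1) (cos p.2) +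
      W true T (T * sin p.2) * H (T * sin p.2) (sin (pi - p.2) * cos p.1)
        (sin (pi - p.2) * sin p.1) (cos (pi - p.2))).
  by move=> cH; apply: (torus_integrand_cont cH); cont.
rewrite /torus_integral -segintB; [|exact: segint_cont (cI F cF)|exact: segint_cont (cI G cG)].
apply: eq_segint => t _.
rewrite -segintB; [|by apply: (torus_integrand_cont cF); cont|by apply: (torus_integrand_cont cG); cont].
by apply: eq_segint => a _; ring.
Qed.

End TorusIntegral.

(** * From the transform to circle integrals *)

Section Along.
Context {R : realType}.
Implicit Types (h : 'M[R]_3) (u f : 'cV[R]_3 -> R).

Definition shell_supported (e1 e2 : R) u := forall x,
  ~ (e1 < enorm x /\ enorm x < e2) -> u x = 0.

(** The values of [u] on the sphere of radius [rad s], seen from the frame [h] and carrying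
    the density of the transform. *)
Definition along h u (s x y z : R) : R :=
  density s * u (h *m vec3 (rad s * x) (rad s * y) (rad s * z)).

Lemma along_cont h u : continuous u ->
  continuous (fun p : R * R * R * R => along h u p.1.1.1 p.1.1.2 p.1.2 p.2).
Proof.
move=> cu; apply: contM; first by apply: density_cont; cont.
have -> : (fun p : R * R * R * R => u (h *m vec3 (rad p.1.1.1 * p.1.1.2)
    (rad p.1.1.1 * p.1.2) (rad p.1.1.1 * p.2))) = (fun p => u (vec3
    (h 0 0 * (rad p.1.1.1 * p.1.1.2) + h 0 1 * (rad p.1.1.1 * p.1.2) + h 0 2 * (rad p.1.1.1 * p.2))
    (h 1 0 * (rad p.1.1.1 * p.1.1.2) + h 1 1 * (rad p.1.1.1 * p.1.2) + h 1 2 * (rad p.1.1.1 * p.2))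
    (h 2 0 * (rad p.1.1.1 * p.1.1.2) + h 2 1 * (rad p.1.1.1 * p.1.2) + h 2 2 * (rad p.1.1.1 * p.2)))).
  by apply/funext => p; rewrite mulmx_vec3.
have cr : continuous (fun p : R * R * R * R => rad p.1.1.1) by apply: rad_cont; cont.
apply: (cont_comp cu); apply: cont_vec3; cont.
Qed.

Lemma alongB h u1 u2 (s x y z : R) :
  along h (fun v => u1 v - u2 v) s x y z = along h u1 s x y z - along h u2 s x y z.
Proof. by rewrite /along mulrBr. Qed.

Lemma along_eq0 (e1 e2 : R) h u : 0 < e1 -> e1 < e2 -> h^T *m h = 1%:M ->
  shell_supported e1 e2 u ->
  forall s x y z : R, s <= delta e2 \/ delta e1 <= s -> x ^+ 2 + y ^+ 2 + z ^+ 2 = 1 ->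
  along h u s x y z = 0.
Proof.
move=> e10 e12 hh u0 s x y z sE xyz; rewrite /along u0 ?mulr0//.
rewrite enorm_orthogonal// enorm_vec3 !exprMn -!mulrDr xyz mulr1 sqrtr_sqr.
rewrite gtr0_norm ?rad_gt0// => -[rl ru].
have := delta_lt (rad_gt0 s) ru; have := delta_lt e10 rl; rewrite delta_rad.
by case: sE => sE; rewrite !ltNge ?sE//= => _; rewrite sE.
Qed.

Lemma interior_integrandE w f (r' al be t th phi : R) :
  interior_integrand w f r' al be t th phi = w r' t phi *
  along (rotU al *m rotV be) (ftilde f) (sin phi / t) (sin phi * cos th) (sin phi * sin th)
    (cos phi).
Proof.
rewrite /interior_integrand /along /polar /rot_act -mulrA; congr (_ * _).
have -> : sin phi ^+ 2 / t ^+ 2 = (sin phi / t) ^+ 2 by rewrite exprMn exprVn.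
rewrite -/(rad (sin phi / t)) !mulrA; congr (_ * _).
by rewrite /density invfM !mulrA.
Qed.

End Along.

(** * Injectivity of the transform *)

Section Injectivity.
Context {R : realType}.
Local Notation mu := (@lebesgue_measure R).
Variables (eps1 eps2 : R).
Hypotheses (heps1 : 0 < eps1) (heps12 : eps1 < eps2) (heps2 : eps2 < 1).
Variables (w : R -> R -> R -> R) (w1 w2 : R -> R -> R).
Hypothesis hw : forall r' t phi, 0 < t <= r' -> 0 <= phi <= pi ->
  w r' t phi = w1 r' t * w2 t phi.
Hypothesis hW2 : forall far : bool,
  continuous_with_partial1 (triangle (delta eps2) (delta eps1)) (W2 w2 far).
Hypothesis hW2diag : forall rho, delta eps2 <= rho <= delta eps1 ->
  W2 w2 false rho rho != 0.
Hypothesis hw1 : bounded_with_partials w1_domain w1.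
Hypothesis hw1diag : forall r', 0 <= r' -> w1 r' r' != 0.

Let d2 := delta eps2.
Let d1 := delta eps1.
Let d20 : 0 < d2. Proof. by rewrite delta_gt0// (lt_trans heps1). Qed.
Let d21 : d2 < d1. Proof. exact: delta_lt. Qed.
Let cW2 far : {within triangle d2 d1, continuous (fun p : R * R => W2 w2 far p.1 p.2)}.
Proof. by have [] := hW2 far. Qed.

Let G (h : 'M[R]_3) (u : 'cV[R]_3 -> R) (t : R) : R :=
  \int[mu]_(theta in `[0, 2 * pi]) \int[mu]_(phi in `[0, pi])
    (w2 t phi * along h u (sin phi / t) (sin phi * cos theta) (sin phi * sin theta) (cos phi)).

Let inner_integralE f al be r' t : 0 < t -> t <= r' ->
  \int[mu]_(theta in `[0, 2 * pi]) \int[mu]_(phi in `[0, pi])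
    interior_integrand w f r' al be t theta phi =
  w1 r' t * G (rotU al *m rotV be) (ftilde f) t.
Proof.
move=> t0 tr; rewrite /G -Rintegral_scale; apply: eq_Rintegral => th _.
rewrite -Rintegral_scale; apply: eq_Rintegral => phi.
rewrite inE /= in_itv/= => phi0.
by rewrite interior_integrandE hw ?t0// mulrA.
Qed.

(** The transform separates into the outer Volterra equation in [r'], whose solution is
    unique, and the integrals over single tori. *)
Lemma torus_integrals_eq (f g : 'cV[R]_3 -> R) al be :
  continuous (ftilde f) -> continuous (ftilde g) ->
  shell_supported eps1 eps2 (ftilde f) -> shell_supported eps1 eps2 (ftilde g) ->
  (forall r', 0 <= r' -> interior_transform_exists w f r' al be) ->
  (forall r', 0 <= r' -> interior_transform_exists w g r' al be) ->
  (forall r', 0 <= r' -> interior_transform w f r' al be = interior_transform w g r' al be) ->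
  forall T, d2 < T -> T < d1 ->
    torus_integral w2 d2 d1 (along (rotU al *m rotV be) (ftilde f)) T =
    torus_integral w2 d2 d1 (along (rotU al *m rotV be) (ftilde g)) T.
Proof.
move=> cf cg sf sg ef eg fg T dT Td; pose h := rotU al *m rotV be.
have hh : h^T *m h = 1%:M.
  by apply: orthogonal_mul; [exact: rotU_orthogonal|exact: rotV_orthogonal].
have T0 : 0 < T by exact: lt_trans dT.
have tor u t : continuous u -> shell_supported eps1 eps2 u -> 0 < t -> d2 < t^-1 -> t^-1 < d1 ->
    G h u t = torus_integral w2 d2 d1 (along h u) t^-1.
  move=> cu su t0 tl tu; apply: torus_integralE => //.
  - exact: ltW.
  - exact: along_cont.
  - exact: along_eq0 hh su.
pose D t := G h (ftilde f) t - G h (ftilde g) t.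
have iwG f' r : 0 <= r -> interior_transform_exists w f' r al be ->
    mu.-integrable `]0, r] (EFin \o (fun t => w1 r t * G h (ftilde f') t)).
  move=> r0 [_ _]; apply: eq_integrable => // t.
  by rewrite inE /= in_itv/= => /andP[t0 tr]; rewrite inner_integralE.
have wGE f' r : 0 <= r -> interior_transform w f' r al be =
    \int[mu]_(t in `]0, r]) (w1 r t * G h (ftilde f') t).
  move=> r0; apply: eq_Rintegral => t.
  by rewrite inE /= in_itv/= => /andP[t0 tr]; rewrite inner_integralE.
have DE r : (fun t => w1 r t * D t) =
    (fun t => w1 r t * G h (ftilde f) t - w1 r t * G h (ftilde g) t).
  by apply/funext => t; rewrite /D mulrBr.
suff : D T^-1 = 0.
  by move/eqP; rewrite subr_eq0 => /eqP; rewrite !tor ?invrK// invr_gt0.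
apply: (outer_volterra hw1 hw1diag) => [r r0|r r0||].
- by rewrite DE; apply: integrableB_real => //; apply: iwG => //; [exact: ef|exact: eg].
- rewrite DE RintegralB//.
  + have IE := etrans (esym (wGE f r r0)) (etrans (fg r r0) (wGE g r r0)).
    by apply/eqP; rewrite subr_eq0; apply/eqP; exact: IE.
  + by apply: iwG => //; exact: ef.
  + by apply: iwG => //; exact: eg.
- by rewrite invr_gt0.
(* Near [T^-1] the unknown coincides with a difference of torus integrals, which is continuous. *)
pose E t := torus_integral w2 d2 d1 (along h (ftilde f)) t^-1 -
  torus_integral w2 d2 d1 (along h (ftilde g)) t^-1.
have cE : E t @[t --> T^-1] --> E T^-1.
  have Tn : T^-1 != 0 by rewrite invr_eq0 gt_eqF.
  have ci : {for T^-1, continuous (@GRing.inv R)} by exact: inv_continuous.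
  by apply: cvgB; apply: (continuous_comp ci);
    apply: torus_integral_cont => //; [exact: ltW|exact: along_cont|exact: ltW|exact: along_cont].
have nDE : \forall t \near T^-1, E t = D t.
  have b1 : d1^-1 < T^-1 by rewrite ltf_pV2// posrE// (lt_trans T0).
  have b2 : T^-1 < d2^-1 by rewrite ltf_pV2// posrE.
  have d10 : 0 < d1 by exact: lt_trans d21.
  near=> t; have t0 : d1^-1 < t by near: t; exact: lt_nbhsr.
  have t1 : t < d2^-1 by near: t; exact: lt_nbhsl.
  have tp : 0 < t by apply: lt_trans t0; rewrite invr_gt0.
  rewrite /E /D !tor//.
  - by rewrite -[ltLHS]invrK ltf_pV2// posrE ?invr_gt0.
  - by rewrite -[ltRHS]invrK ltf_pV2// posrE ?invr_gt0.
  - by rewrite -[ltLHS]invrK ltf_pV2// posrE ?invr_gt0.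
  - by rewrite -[ltRHS]invrK ltf_pV2// posrE ?invr_gt0.
change (D t @[t --> T^-1] --> D T^-1); rewrite -(nbhs_singleton nDE).
by apply: cvg_trans cE; apply: near_eq_cvg.
Unshelve. all: by end_near. Qed.

(** The circles around a direction [h' e3] of a turned frame [h'] are seen by an Euler frame with the
    same axis, up to a rotation or reflection that does not change the integrals. *)
Lemma even_part_eq0 (u : 'cV[R]_3 -> R) : continuous u -> shell_supported eps1 eps2 u ->
  (forall al be T, 0 <= al <= 2 * pi -> 0 <= be <= pi -> d2 < T -> T < d1 ->
     torus_integral w2 d2 d1 (along (rotU al *m rotV be) u) T = 0) ->
  forall h s, h^T *m h = 1%:M -> along h u s 0 0 1 + along h u s 0 0 (-1) = 0.
Proof.
move=> cu su tor0 h s hh.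
have [L0 L00 lip0] := triangle_lipschitz (ltW d21) (hW2 false).
have [L1 L10 lip1] := triangle_lipschitz (ltW d21) (hW2 true).
have [M0 M00 bd0] := triangle_bounded (ltW d21) (@cW2 false).
have [M1 M10 bd1] := triangle_bounded (ltW d21) (@cW2 true).
apply: (@axis_even_part_eq0 R d2 d1 (along h u) (clamped d2 d1 (W2 w2 false))
  (clamped d2 d1 (W2 w2 true)) (Num.max L0 L1) (Num.max M0 M1)) => //.
- exact: along_cont.
- exact: along_eq0 hh su.
- by apply: clamped_cont => //; exact: ltW.
- by apply: clamped_cont => //; exact: ltW.
- by rewrite le_max L00.
- by rewrite le_max M00.
- split=> [t x y dt tx xy yd|t x dt tx xd].
    have xd := le_trans xy yd; have ty := le_trans tx xy.
    rewrite !clampedE//.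
    apply: le_trans (lip0 _ _ _ dt tx xy yd) _.
    by rewrite ler_wpM2r ?subr_ge0// le_max lexx.
  rewrite clampedE//.
  by apply: le_trans (bd0 _ _ dt tx xd) _; rewrite le_max lexx.
- split=> [t x y dt tx xy yd|t x dt tx xd].
    have xd := le_trans xy yd; have ty := le_trans tx xy.
    rewrite !clampedE//.
    apply: le_trans (lip1 _ _ _ dt tx xy yd) _.
    by rewrite ler_wpM2r ?subr_ge0// le_max lexx orbT.
  rewrite clampedE//.
  by apply: le_trans (bd1 _ _ dt tx xd) _; rewrite le_max lexx orbT.
- move=> t dt td; rewrite !clampedE//.
  split; last by rewrite hW2diag// dt.
  have t0 : t != 0 by rewrite gt_eqF// (lt_le_trans d20).
  have asin1 : asin (1 : R) = pi / 2.
    rewrite -{1}sin_pihalf sinK// in_itv/= lexx andbT lerNl.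
    by rewrite (le_trans (y := 0)) ?oppr_le0 ?divr_ge0 ?pi_ge0.
  by rewrite /W2 divff// asin1; congr (w2 _ _); field.
move=> T al z dT Td al0 z1.
pose h' := h *m (rotU al *m rotV (acos z)).
have hh' : h'^T *m h' = 1%:M.
  by apply: orthogonal_mul => //; apply: orthogonal_mul;
    [exact: rotU_orthogonal|exact: rotV_orthogonal].
have [a0 [b0 [a00 b00 hE]]] : exists a b : R, [/\ 0 <= a <= 2 * pi, 0 <= b <= pi &
    (rotU a *m rotV b) *m vec3 0 0 1 = h' *m vec3 0 0 1].
  move: (enorm_orthogonal (vec3 0 0 1) hh'); move: (h' *m vec3 0 0 1) => v.
  rewrite (vec3E v) !enorm_vec3 !expr0n/= expr1n !add0r sqrtr1 => v1.
  apply: spherical_coordinates; move/(congr1 (fun r : R => r ^+ 2)): v1.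
  by rewrite expr1n sqr_sqrtr// !addr_ge0 ?sqr_ge0.
have hh0 : (rotU a0 *m rotV b0)^T *m (rotU a0 *m rotV b0) = 1%:M.
  by apply: orthogonal_mul; [exact: rotU_orthogonal|exact: rotV_orthogonal].
have [ga ga0 gaE] := frame_same_axis hh0 hh' hE.
rewrite -[RHS](tor0 a0 b0 T a00 b00 dT Td).
transitivity (torus_integral w2 d2 d1 (along h' u) T).
  apply: eq_segint => t _; apply: eq_segint => a _.
  have circleE (s' a' : R) : circle_point (turn al (along h u s')) z a' t =
      along h' u s' (sin a' * cos t) (sin a' * sin t) (cos a').
    rewrite /circle_point /turn /along /h' -!mulmxA rotV_vec3 rotU_vec3 acosK ?in_itv// sin_acos//.
    congr (_ * u (_ *m vec3 _ _ _)); ring.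
  by rewrite !circleE.
apply: torus_integral_rotate ga0 _ => //; [exact: ltW|exact: along_cont|].
case: gaE => gaE; [left|right] => s' x y z'; rewrite /along gaE;
  congr (_ * u (_ *m vec3 _ _ _)); ring.
Qed.

End Injectivity.

Theorem theorem4 (R : realType) (eps1 eps2 : R)
  (heps1 : 0 < eps1) (heps12 : eps1 < eps2) (heps2 : eps2 < 1)
  (w : R -> R -> R -> R) (w1 w2 : R -> R -> R)
  (hw : forall r' t phi, 0 < t <= r' -> 0 <= phi <= pi ->
     w r' t phi = w1 r' t * w2 t phi)
  (hW2 : forall far : bool,
     continuous_with_partial1 (triangle (delta eps2) (delta eps1))
       (W2 w2 far))
  (hW2diag : forall rho, delta eps2 <= rho <= delta eps1 ->
     W2 w2 false rho rho != 0)
  (hw1 : bounded_with_partials w1_domain w1)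
  (hw1diag : forall r', 0 <= r' -> w1 r' r' != 0)
  (f g : 'cV[R]_3 -> R)
  (hf : C0_infty (hollow_ball eps1 eps2 `&` upper_half_space) f)
  (hg : C0_infty (hollow_ball eps1 eps2 `&` upper_half_space) g)
  (hfex : forall r' alpha beta, 0 <= r' -> 0 <= alpha <= 2 * pi ->
     0 <= beta <= pi -> interior_transform_exists w f r' alpha beta)
  (hgex : forall r' alpha beta, 0 <= r' -> 0 <= alpha <= 2 * pi ->
     0 <= beta <= pi -> interior_transform_exists w g r' alpha beta)
  (hI : forall r' alpha beta, 0 <= r' -> 0 <= alpha <= 2 * pi ->
     0 <= beta <= pi ->
     interior_transform w f r' alpha beta
     = interior_transform w g r' alpha beta) :
  forall x : 'cV[R]_3, 0 < enorm x < 1 -> f x = g x.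
Proof.
move=> x /andP[n0 n1]; set n := enorm x in n0 n1.
have [//|fgx] := eqVneq (f x) (g x).
have [e1n ne2 x2] : [/\ eps1 < n, n < eps2 & 0 < x 2 0].
  have [fx|fx] := eqVneq (f x) 0; last exact: (support_bounds hf).
  by apply: (support_bounds hg); rewrite -fx eq_sym.
pose u y := ftilde f y - ftilde g y.
have cf := ftilde_cont heps1 hf; have cg := ftilde_cont heps1 hg.
have cu : continuous u by move=> y; apply: continuousB; [exact: cf|exact: cg].
have sf : shell_supported eps1 eps2 (ftilde f).
  move=> y H; by apply: (ftilde_eq0 hf) => -[? ? _]; apply: H.
have sg : shell_supported eps1 eps2 (ftilde g).
  move=> y H; by apply: (ftilde_eq0 hg) => -[? ? _]; apply: H.
have su : shell_supported eps1 eps2 u.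
  by move=> y H; rewrite /u sf// sg// subrr.
have d21 : delta eps2 <= delta eps1 by rewrite ltW// delta_lt.
have tor0 al be T : 0 <= al <= 2 * pi -> 0 <= be <= pi ->
    delta eps2 < T -> T < delta eps1 ->
    torus_integral w2 (delta eps2) (delta eps1) (along (rotU al *m rotV be) u) T = 0.
  move=> al0 be0 dT Td.
  have -> : along (rotU al *m rotV be) u = (fun s a b c =>
      along (rotU al *m rotV be) (ftilde f) s a b c -
      along (rotU al *m rotV be) (ftilde g) s a b c).
    by do 4 (apply/funext => ?); exact: alongB.
  rewrite torus_integralB//; [|by move=> far; have [] := hW2 far|exact: along_cont
    |exact: along_cont].
  apply/eqP; rewrite subr_eq0; apply/eqP.
  exact: (torus_integrals_eq heps1 heps12 heps2 hw hW2 hw1 hw1diag cf cg sf sg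
    (fun r' r0 => hfex r' al be r0 al0 be0) (fun r' r0 => hgex r' al be r0 al0 be0)
    (fun r' r0 => hI r' al be r0 al0 be0) dT Td).
have n2 : n ^+ 2 = x 0 0 ^+ 2 + x 1 0 ^+ 2 + x 2 0 ^+ 2.
  by rewrite /n (vec3E x) enorm_vec3 sqr_sqrtr ?addr_ge0 ?sqr_ge0// !mxE.
have [al [be [al0 be0 hx]]] : exists al be : R, [/\ 0 <= al <= 2 * pi, 0 <= be <= pi &
    (rotU al *m rotV be) *m vec3 0 0 1 = vec3 (x 0 0 / n) (x 1 0 / n) (x 2 0 / n)].
  apply: spherical_coordinates; rewrite !exprMn -!mulrDl -n2 exprVn.
  by rewrite mulfV// expf_neq0// gt_eqF.
(* A frame whose axis passes through [x]. *)
pose h : 'M[R]_3 := rotU al *m rotV be.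
have hh : h^T *m h = 1%:M.
  by apply: orthogonal_mul; [exact: rotU_orthogonal|exact: rotV_orthogonal].
have rn : rad (delta n) = n by exact: rad_delta.
have axis (c : R) : along h u (delta n) 0 0 c = density (delta n) * u (c *: x).
  have v3 : vec3 0 0 (n * c) = (n * c) *: vec3 0 0 1 :> 'cV[R]_3.
    apply/matrixP => i j; rewrite !mxE.
    by case: i => [[|[|[|i]]] hi] //=; rewrite ?mulr0 ?mulr1.
  rewrite /along rn !mulr0 v3 -scalemxAr hx; congr (_ * u _).
  rewrite [in RHS](vec3E x); apply/matrixP => i j; rewrite !mxE.
  have n0' : n != 0 by rewrite gt_eqF.
  by case: i => [[|[|[|i]]] hi] //=; field.
have := even_part_eq0 heps1 heps12 heps2 hW2 hW2diag cu su tor0 (delta n) hh.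
rewrite !axis scale1r scaleN1r -mulrDr => /eqP.
rewrite mulf_eq0 gt_eqF ?density_gt0 ?delta_gt0//=.
(* The antipode of [x] lies outside of the half space. *)
have -> : u (- x) = 0.
  rewrite /u (ftilde_eq0 hf) ?(ftilde_eq0 hg) ?subrr// => -[_ _];
    by rewrite mxE oppr_gt0 ltNge ltW.
rewrite addr0 /u !ftildeE -mulrBr mulf_eq0 gt_eqF ?tilde_factor_gt0//= subr_eq0.
by move/eqP.
Qed.
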